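(* For all integers $n\ge1$ and $t\ge1$, \[ \operatorname{las}'_t(\mathbb{R}^n)=\delta_{\operatorname{las}'_t,n}. \]
   Context: Regard any $C\subseteq\mathbb{R}^n$ as a graph with vertex set $C$ and edges the pairs $xy$ with $0<|x-y|<2$; an independent set is thus a subset of $C$ whose distinct points are at distance at least $2$. Let $I_{=k,C}$ be the set of independent sets of size exactly $k$, topologized as a subset of the quotient of $C^k$ under $(v_1,\dots,v_k)\mapsto\{v_1,\dots,v_k\}$ (with $I_{=0,C}=\{\emptyset\}$), and let $I_{t,C}$ be the disjoint union of $I_{=k,C}$ for $k=0,\dots,t$, with the disjoint union topology. For $f\colon I_{t,C}\times I_{t,C}\to\mathbb{R}$ and $S\in I_{2t,C}$, set $A_tf(S)=\sum f(J,J')$, the sum being over all ordered pairs $(J,J')$ with $J,J'\in I_{t,C}$ and $J\cup J'=S$. A kernel $K\colon I_{t,C}\times I_{t,C}\to\mathbb{R}$ is positive semidefinite if $K(J,J')=K(J',J)$ and $\sum_{J,J'\in S}w_Jw_{J'}K(J,J')\ge0$ for every finite $S\subseteq I_{t,C}$ and all real weights $w_J$. For a finite set $F\subseteq\mathbb{R}^n$, $\operatorname{las}'_t(F)$ is the supremum of $\lambda(I_{=1,F})$ over all nonnegative measures $\lambda$ on the finite set $I_{2t,F}$ such that $\lambda(\{\emptyset\})=1$ and $\int_{I_{2t,F}}A_tK\,d\lambda\ge0$ for every positive semidefinite kernel $K$ on $I_{t,F}$. For bounded $C\subseteq\mathbb{R}^n$, $\operatorname{las}'_t(C)$ is the supremum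 of $\operatorname{las}'_t(F)$ over finite subsets $F\subseteq C$. Define $\delta_{\operatorname{las}'_t,n}=\lim_{k\to\infty}\operatorname{las}'_t(2^k[0,1]^n)/2^{kn}$ (the limit exists). $\mathbb{R}^n$ acts on $I_{2t,\mathbb{R}^n}$, and hence on Radon measures on it, by translation. If $\mu$ is a translation-invariant Radon measure on $I_{2t,\mathbb{R}^n}$, its restriction to $I_{=1,\mathbb{R}^n}$ (identified with $\mathbb{R}^n$) is a multiple of Lebesgue measure, and $\widehat{\mu}(0)$ denotes this multiple. $\operatorname{las}'_t(\mathbb{R}^n)$ is the supremum of $\widehat{\mu}(0)$ over all nonnegative translation-invariant Radon measures $\mu$ on $I_{2t,\mathbb{R}^n}$ such that $\mu(\{\emptyset\})=1$ and $A_t^*\mu$ is positive semidefinite on $I_{t,\mathbb{R}^n}\times I_{t,\mathbb{R}^n}$, meaning that $\int_{I_{2t,\mathbb{R}^n}}A_tK\,d\mu\ge0$ for every continuous, compactly supported, positive semidefinite kernel $K\colon I_{t,\mathbb{R}^n}\times I_{t,\mathbb{R}^n}\to\mathbb{R}$. *)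

(* Defs.v *)
From HB Require Import structures.
From mathcomp Require Import all_boot all_order all_algebra finmap.
From mathcomp Require Import all_classical all_reals all_analysis.

Set Implicit Arguments.
Unset Strict Implicit.
Unset Printing Implicit Defensive.

Import Order.TTheory GRing.Theory Num.Theory.
Import numFieldNormedType.Exports.

Local Open Scope classical_set_scope.
Local Open Scope ring_scope.

(* The max norm of the library induces the right topology on 'rV[R]_n, but
   distances between points are Euclidean. *)
Definition eucl_dist (R : realType) (n : nat) (x y : 'rV[R]_n) : R :=
  Num.sqrt (\sum_(i < n) (x ord0 i - y ord0 i) ^+ 2).

Definition edge (R : realType) (n : nat) (x y : 'rV[R]_n) : bool :=
  0 < eucl_dist x y < 2.

Definition independent (R : realType) (n : nat) (S : {fset 'rV[R]_n}) : Prop :=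
  forall x y, x \in S -> y \in S -> ~~ edge x y.

Definition indep_sets (R : realType) (n : nat) (C : set 'rV[R]_n) (t : nat) :
    set {fset 'rV[R]_n} :=
  [set S | [/\ [set` S] `<=` C, independent S & (#|` S| <= t)%N]].

Definition ind (R : realType) (n : nat) (C : set 'rV[R]_n) (t : nat) : Type :=
  set_type (indep_sets C t).

HB.instance Definition _ (R : realType) (n : nat) (C : set 'rV[R]_n)
  (t : nat) := Choice.copy (ind C t) (set_type (indep_sets C t)).

Definition pts (R : realType) (n : nat) (C : set 'rV[R]_n) (t : nat)
  (S : ind C t) : {fset 'rV[R]_n} := val S.

Section ind_space.
Variables (R : realType) (n : nat) (C : set 'rV[R]_n) (t : nat).

Lemma indep_sets0 : indep_sets C t fset0.
Proof. by split=> // [x|x y]; rewrite /= ?inE ?cardfs0. Qed.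

Definition ind0 : ind C t := exist _ fset0 (mem_set indep_sets0).

HB.instance Definition _ := isPointed.Build (ind C t) ind0.

Definition unordered (k : nat) (v : {ptws 'I_k -> C}) : {fset 'rV[R]_n} :=
  [fset (val (v i) : 'rV[R]_n) | i in 'I_k]%fset.

(* Final topology on sets of points of C along C^k -> {v_1, ..., v_k}. *)
Definition quot_open (k : nat) (W : set {fset 'rV[R]_n}) : Prop :=
  open (@unordered k @^-1` W).

(* Disjoint union over k of the subspace topologies on I_{=k,C}. *)
Definition ind_open (U : set (ind C t)) : Prop :=
  forall k : nat, exists2 W : set {fset 'rV[R]_n}, quot_open k W &
    forall S : ind C t, #|` pts S| = k -> (U S <-> W (pts S)).

Lemma ind_openT : ind_open setT.
Proof.
by move=> k; exists setT => //; rewrite /quot_open preimage_setT; exact: openT.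
Qed.

Lemma ind_openI : setI_closed ind_open.
Proof.
move=> U1 U2 o1 o2 k; have [W1 oW1 E1] := o1 k; have [W2 oW2 E2] := o2 k.
exists (W1 `&` W2); first by rewrite /quot_open preimage_setI; exact: openI.
by move=> S Sk; split=> -[] /(E1 _ Sk) ? /(E2 _ Sk).
Qed.

Lemma ind_open_bigcup (I : Type) (U : I -> set (ind C t)) :
  (forall i, ind_open (U i)) -> ind_open (\bigcup_i U i).
Proof.
move=> oU k; have /choice [W WP] : forall i, exists W, quot_open k W /\
    forall S : ind C t, #|` pts S| = k -> (U i S <-> W (pts S)).
  by move=> i; have [W] := oU i k; exists W.
exists (\bigcup_i W i).
  rewrite /quot_open preimage_bigcup; apply: bigcup_open => i _.
  by have [] := WP i.
by move=> S Sk; split=> -[i _ /(proj2 (WP i) _ Sk)] ?; exists i.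
Qed.

HB.instance Definition _ :=
  isOpenTopological.Build (ind C t) ind_openT ind_openI ind_open_bigcup.

Definition ind_card (k : nat) : set (ind C t) := [set S | #|` pts S| = k].

End ind_space.

Notation borel T := (g_sigma_algebraType (@open T)).

Definition radon (R : realType) (T : ptopologicalType)
    (mu : {measure set (borel T) -> \bar R}) : Prop :=
  (forall x : T, exists2 U : set T, open_nbhs x U & (mu U < +oo)%E) /\
  (forall B : set (borel T), measurable B ->
     mu B = ereal_sup [set mu K | K in [set K : set T | compact K /\ K `<=` B]]).

(* The index set is finite, as J and J' are subsets of S. *)
Definition A_op (R : realType) (n : nat) (C : set 'rV[R]_n) (t : nat)
    (f : ind C t -> ind C t -> R) (S : ind C (2 * t)) : R :=
  \sum_(p \in [set p : ind C t * ind C t | (pts p.1 `|` pts p.2)%fset = pts S])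
    f p.1 p.2.

Definition psd (R : realType) (T : choiceType) (K : T -> T -> R) : Prop :=
  (forall x y, K x y = K y x) /\
  (forall (S : {fset T}) (w : T -> R),
     0 <= \sum_(x <- S) \sum_(y <- S) w x * w y * K x y).

(* The topology of ind F (2 * t) is discrete for finite F, so that every set is
   Borel and every kernel is continuous. *)
Definition las_finite (R : realType) (n t : nat) (F : set 'rV[R]_n) : \bar R :=
  ereal_sup [set lam (@ind_card R n F (2 * t) 1)
    | lam in [set lam : {finite_measure set (borel (ind F (2 * t))) -> \bar R} |
        lam [set @ind0 R n F (2 * t)] = 1%E /\
        (forall K : ind F t -> ind F t -> R, psd K ->
           (0 <= \int[lam]_S (A_op K S)%:E)%E)]].

Definition las (R : realType) (n t : nat) (C : set 'rV[R]_n) : \bar R :=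
  ereal_sup [set las_finite t F
    | F in [set F : set 'rV[R]_n | finite_set F /\ F `<=` C]].

Definition cube (R : realType) (n : nat) : set 'rV[R]_n :=
  [set x | forall i, 0 <= x ord0 i <= 1].

Definition las_density (R : realType) (n t k : nat) : \bar R :=
  (las t [set (2 ^+ k *: x)%R | x in @cube R n] * ((2 ^+ (k * n))^-1)%:E)%E.

Definition delta_las (R : realType) (n t : nat) : \bar R :=
  limn (las_density R n t).

Definition box (R : realType) (n : nat) (a b : 'rV[R]_n) : set 'rV[R]_n :=
  [set x | forall i, a ord0 i < x ord0 i <= b ord0 i].

(* Outer measure; on Borel sets it is Lebesgue measure. *)
Definition lebesgue_rV (R : realType) (n : nat) (A : set 'rV[R]_n) : \bar R :=
  ereal_inf [set s | exists a b : nat -> 'rV[R]_n,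
    [/\ forall k i, a k ord0 i <= b k ord0 i,
        A `<=` \bigcup_k box (a k) (b k) &
        s = (\sum_(0 <= k <oo) (\prod_(i < n) (b k ord0 i - a k ord0 i))%:E)%E]].

Section translation.
Variables (R : realType) (n t : nat).
Implicit Types (v : 'rV[R]_n) (S : ind [set: 'rV[R]_n] t).

Lemma translate_subproof v S :
  indep_sets [set: 'rV[R]_n] t [fset (v + x)%R | x in pts S]%fset.
Proof.
have [_ iS cS] := set_mem (valP S); split=> //; last first.
  by rewrite card_imfset /= ?cS; last exact: addrI.
move=> _ _ /imfsetP[x /= xS ->] /imfsetP[y /= yS ->].
suff -> : edge (v + x) (v + y) = edge x y by exact: iS.
rewrite /edge /eucl_dist; under eq_bigr do rewrite !mxE opprD addrACA subrr add0r.
by [].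
Qed.

Definition translate v S : ind [set: 'rV[R]_n] t :=
  exist _ [fset (v + x)%R | x in pts S]%fset
    (mem_set (translate_subproof v S)).

Definition translation_invariant
    (mu : {measure set (borel (ind [set: 'rV[R]_n] t)) -> \bar R}) : Prop :=
  forall v (B : set (borel (ind [set: 'rV[R]_n] t))), measurable B ->
    mu (translate v @^-1` B) = mu B.

(* The restriction of mu to I_{=1}, carried to R^n along x |-> {x}, is c times
   Lebesgue measure. *)
Definition has_density
    (mu : {measure set (borel (ind [set: 'rV[R]_n] t)) -> \bar R}) (c : R) :
    Prop :=
  forall B : set 'rV[R]_n, <<s @open 'rV[R]_n >> B ->
    mu [set S | exists2 x, B x & pts S = [fset x]%fset] = (c%:E * lebesgue_rV B)%E.

End translation.

Definition compactly_supported (R : realType) (T : topologicalType)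
    (f : T -> R) : Prop :=
  compact (closure [set x | f x != 0]).

Definition adjoint_psd (R : realType) (n t : nat)
    (mu : {measure set (borel (ind [set: 'rV[R]_n] (2 * t))) -> \bar R}) : Prop :=
  forall K : ind [set: 'rV[R]_n] t -> ind [set: 'rV[R]_n] t -> R,
    continuous (fun p => K p.1 p.2) ->
    compactly_supported (fun p => K p.1 p.2) ->
    psd K ->
    (0 <= \int[mu]_S (A_op K S)%:E)%E.

Definition las_Rn (R : realType) (n t : nat) : \bar R :=
  ereal_sup [set c%:E | c in [set c : R |
    exists mu : {measure set (borel (ind [set: 'rV[R]_n] (2 * t))) -> \bar R},
      [/\ radon mu, translation_invariant mu,
          mu [set @ind0 R n [set: 'rV[R]_n] (2 * t)] = 1%E,
          adjoint_psd mu & has_density mu c]]].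

(* Main.v *)
(* Write las_k for las'_t of the cube [0, L]^n with L = 2^k. Both inequalities
   las'_t(R^n) <= las_k / L^n <= las'_t(R^n) ((L + 2) / L)^n are proved by an
   explicit construction, and the limit follows by letting k tend to infinity.

   From R^n to the cube: let mu be feasible with density rho. Cut a cube slightly
   smaller than [0, L]^n into M^n cells, collapse the points of each cell to one
   site of [0, L]^n, and let f be a Lipschitz bump function that vanishes between
   the cells. The sites are spread out so that points of distinct cells that are
   at distance at least 2 go to sites at distance at least 2. The set T of sites
   gets the weight int [S collapses to T] min_S f dmu. These weights are feasible
   because a kernel K on sets of sites pulls back to the continuous, compactly
   supported kernel K(J, J') min(min_J f, min_J' f), which is positive
   semidefinite. They have mass close to rho L^n on singletons as M grows.

   From the cube to R^n: let l be feasible on a finite F in [0, L]^n. Choose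
   subsets of the translates of F by the lattice ((L + 2) Z)^n with the product of
   the weights l, and average over the translations in a period. This measure is
   translation invariant with density l(singletons) / (L + 2)^n, and it is feasible
   by the Schur product theorem. *)
Require Import Defs.
From HB Require Import structures.
From mathcomp Require Import all_boot all_order all_algebra finmap.
From mathcomp Require Import all_classical all_reals all_analysis.
From mathcomp Require Import measurable_realfun lra.

Set Implicit Arguments.
Unset Strict Implicit.
Unset Printing Implicit Defensive.

Import Order.TTheory GRing.Theory Num.Theory.
Import numFieldNormedType.Exports.

Local Open Scope classical_set_scope.
Local Open Scope ring_scope.

(** * Topology of the space of independent sets *)

(** Being at distance at least 2 is a closed condition that already implies distinctness, so points
    of an independent set cannot merge in a limit; this is the source of compactness in the space of
    independent sets. Discretization: collapsing is discontinuous at the walls of the cells, hence a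
    bump function that vanishes there. The kernel weight is a minimum and not a product, because
    min(min_J f, min_J' f) depends only on the union of J and J' and therefore leaves the sum that
    defines A_t. Periodization: feasibility is a pairing with all positive semidefinite kernels,
    whereas the Schur product needs the matrix with entries l(union of J and J') itself to be
    positive semidefinite; rank-one test kernels provide this. The weights l act like correlation
    functions rather than probabilities: l is 1 on the empty set, so a cell without chosen points
    contributes the factor 1, and the product over the infinite lattice is a finite one. The sum
    over all finite subsets may have infinite mass, but it is a finite sum on bounded regions, where
    all integrals take place. *)

Lemma nbhs_ptws (R : realType) (n k : nat) (C : set 'rV[R]_n)
    (v : {ptws 'I_k -> C}) (A : set {ptws 'I_k -> C}) :
  nbhs v A <-> exists2 e : R, 0 < e &
    forall w : {ptws 'I_k -> C},
      (forall i, `|val (w i) - val (v i)| < e) -> A w.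
Proof.
split; last first.
  have Fv : Filter (nbhs v) by apply: nbhs_filter.
  case=> e e0 sub; apply: (@filterS _ (nbhs v) _ _ _ sub).
  have := @filter_forall {ptws 'I_k -> C} 'I_k
    (fun i w => `|val (w i) - val (v i)| < e) (nbhs v).
  move=> /(_ Fv); apply=> i.
  have pc := @proj_continuous 'I_k (fun=> C) i v.
  have vc := @initial_continuous C 'rV[R]_n set_val (v i).
  apply: (@pc [set x | `|val x - val (v i)| < e]).
  apply: (@vc [set x | `|x - val (v i)| < e]).
  apply/nbhs_ballP; exists e => // x; rewrite -ball_normE /= distrC//.
(* The pointwise topology is a supremum of initial topologies, so the filter of uniform
   neighbourhoods converges to [v] once it does so in each coordinate. *)
pose F : set_system {ptws 'I_k -> C} := filter_from [set e : R | 0 < e]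
  (fun e => [set w | forall i, `|val (w i) - val (v i)| < e]).
have FF : Filter F.
  apply: filter_from_filter; first by exists 1 => /=.
  move=> e1 e2 /= e10 e20; exists (Num.min e1 e2); first by rewrite /= lt_min e10.
  by move=> w wv; split=> i; have := wv i; rewrite lt_min => /andP[].
suff Fv : F --> v.
  by move=> vA; have [d d0 dA] := Fv A vA; exists d.
apply/cvg_sup => i B; rewrite nbhsE => -[D [[D1 oD1 D1E] Dv] DB].
case: oD1 => D2 oD2 D2E; rewrite -D1E -D2E /= in Dv DB => {D1E D2E}.
have /nbhs_ballP[e e0 eO] : nbhs (val (v i)) D2 by apply: open_nbhs_nbhs.
exists e => // w wv; apply: (DB w) => /=; apply: eO.
by rewrite -ball_normE /= distrC; exact: wv.
Qed.

Section ind_topology.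
Variables (R : realType) (n : nat) (C : set 'rV[R]_n) (t : nat).
Local Notation V := 'rV[R]_n.
Implicit Types (S T : ind C t) (U : set (ind C t)) (X : {fset V}).

(* By [nbhs_closeP] below, these are the basic neighbourhoods of the quotient
   topology. *)
Definition close (e : R) S T := exists phi : V -> V,
  [/\ pts T = [fset phi x | x in pts S]%fset, #|` pts T| = #|` pts S| &
      forall x, x \in pts S -> `|phi x - x| < e].

Lemma pts_inj : injective (@pts R n C t).
Proof. exact: val_inj. Qed.

Lemma indP S : indep_sets C t (pts S).
Proof. exact: set_mem (valP S). Qed.

Lemma indep_sub X X' :
  indep_sets C t X' -> (X `<=` X')%fset -> indep_sets C t X.
Proof.
move=> [XC Xi Xt] /fsubsetP sub; split=> [x xX|x y xX yX|].
- by apply: XC; exact: sub.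
- by apply: Xi; exact: sub.
- by apply: leq_trans Xt; apply: fsubset_leq_card; apply/fsubsetP.
Qed.

(* Junk value: the empty set if [X] is not in [indep_sets C t]. *)
Definition mkind X : ind C t :=
  if pselect (indep_sets C t X) is left H then exist _ X (mem_set H)
  else ind0 C t.

Lemma pts_mkind X : indep_sets C t X -> pts (mkind X) = X.
Proof. by rewrite /mkind; case: pselect. Qed.

Lemma mkindK S : mkind (pts S) = S.
Proof. by apply: pts_inj; rewrite pts_mkind//; exact: indP. Qed.

Lemma close_refl e S : 0 < e -> close e S S.
Proof.
move=> e0; exists id; split=> // [|x _]; last by rewrite subrr normr0.
by apply/fsetP => x; rewrite imfset_id.
Qed.

Lemma close_trans e1 e2 S1 S2 S3 :
  close e1 S1 S2 -> close e2 S2 S3 -> close (e1 + e2) S1 S3.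
Proof.
move=> [p [pE pc pe]] [q [qE qc qe]]; exists (q \o p); split.
- by rewrite qE pE -imfset_comp.
- by rewrite qc pc.
- move=> x xS; have px : p x \in pts S2 by rewrite pE in_imfset.
  have -> : (q \o p) x - x = (q (p x) - p x) + (p x - x).
    by rewrite /= addrA subrK.
  by rewrite (le_lt_trans (ler_normD _ _))// [ltRHS]addrC ltrD ?pe ?qe.
Qed.

Lemma fset_enum_ord (X : {fset V}) : [set` X] `<=` C ->
  exists v : {ptws 'I_(#|` X|) -> C}, unordered v = X.
Proof.
move=> XC; have vP (i : 'I_(#|` X|)) : C (nth 0 X i).
  by apply: XC; rewrite /= mem_nth.
exists (fun i : 'I_(#|` X|) => exist _ (nth 0 X i) (mem_set (vP i)) : C).
apply/fsetP => x; apply/imfsetP/idP => /= [[i _ ->]|xX]; first exact: mem_nth.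
have ix : (index x X < #|` X|)%N by rewrite index_mem.
by exists (Ordinal ix) => //=; rewrite nth_index.
Qed.

Lemma unordered_inj k (v : {ptws 'I_k -> C}) :
  #|` unordered v| = k -> injective (fun i => val (v i)).
Proof.
move=> vk; have E : unordered v =
    ((fun i => val (v i)) @` [fset i in 'I_k])%fset.
  by apply/fsetP => x; apply/imfsetP/imfsetP => -[i _ ->]; exists i; rewrite ?inE.
have /card_in_imfsetP I : #|` ((fun i => val (v i)) @` [fset i in 'I_k])%fset| ==
    #|` [fset i in 'I_k]%fset|.
  by rewrite -E vk card_imfset//= -cardE card_ord.
by move=> i j ij; apply: I; rewrite ?inE.
Qed.

Lemma card_unordered k (v : {ptws 'I_k -> C}) :
  injective (fun i => val (v i)) -> #|` unordered v| = k.
Proof. by move=> vi; rewrite card_imfset//= -cardE card_ord. Qed.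

Lemma nbhs_close S U : nbhs S U ->
  exists2 e : R, 0 < e & forall T, close e S T -> U T.
Proof.
rewrite nbhsE => -[B [oB BS] BU].
have [W oW WB] := oB #|` pts S|.
have [SC _ _] := indP S.
have [v vS] := fset_enum_ord SC.
have vi i : val (v i) \in pts S.
  by have : val (v i) \in unordered v; [exact: in_imfset|rewrite vS].
have Wv : W (unordered v) by rewrite vS; apply/WB.
have /nbhs_ptws[e e0 eW] : nbhs v (@unordered R n C _ @^-1` W).
  by apply: open_nbhs_nbhs.
exists e => // T [p [pT cT pe]]; apply/BU/(proj2 (WB T cT)).
have wP i : C (p (val (v i))).
  have [+ _ _] := indP T; apply => /=; rewrite pT.
  by apply: in_imfset; exact: vi.
have := eW (fun i => exist _ (p (val (v i))) (mem_set (wP i)) : C).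
have -> : pts T = unordered
    ((fun i => exist _ (p (val (v i))) (mem_set (wP i)) : C) : {ptws _ -> C}).
  rewrite pT; apply/fsetP => x; apply/imfsetP/imfsetP => /= -[].
    move=> y yS ->; have : y \in unordered v by rewrite vS.
    by move=> /imfsetP[i _ ->]; exists i.
  by move=> i _ ->; exists (val (v i)) => //; exact: vi.
by apply => i /=; apply: pe; exact: vi.
Qed.

(** The radius may depend on [S], so the quotient-open set is the union of all perturbations of
    members of [U], each within its own radius. *)
Lemma open_close U :
  (forall S, U S -> exists2 e : R, 0 < e & forall T, close e S T -> U T) ->
  open U.
Proof.
move=> UP; have /choice[e eP] : forall S, exists e : R, 0 < e /\
    (U S -> forall T, close e S T -> U T).
  move=> S; have [/UP[e e0 eU]|nUS] := pselect (U S); first by exists e.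
  by exists 1.
(* Members of [W] need not be independent: [quot_open] tests all of C^k, and only the trace of [W]
   on independent sets has to be [U]. *)
move=> k; pose W := [set X : {fset V} | #|` X| = k /\ exists S (p : V -> V),
  [/\ U S, #|` pts S| = k, X = [fset p x | x in pts S]%fset &
      forall x, x \in pts S -> `|p x - x| < e S]].
exists W; last first.
  move=> S Sk; split=> [US|[_ [S' [p [US' S'k SE pe]]]]].
    split=> //; exists S, id; split=> //; first by rewrite imfset_id.
    by move=> x _; rewrite subrr normr0; have [] := eP S.
  by have [_ /(_ US' S)] := eP S'; apply; exists p; split; rewrite // Sk S'k.
rewrite /quot_open openE => v [vk [S [p [US Sk vE pe]]]].
have vi := unordered_inj vk.
apply/nbhs_ptws.
(* Moving each [v i] by less than half of the least gap keeps the [k] points distinct; [d] is the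
   slack that [p] leaves in the radius of [S]. *)
pose g : R := \big[Num.min/1]_(ij : 'I_k * 'I_k | ij.1 != ij.2)
  (`|val (v ij.1) - val (v ij.2)| / 2).
pose d : R := \big[Num.min/1]_(x <- pts S) (e S - `|p x - x|).
have g0 : 0 < g.
  apply/bigmin_gtP; split=> //= -[i j] /= ij; rewrite divr_gt0// normr_gt0.
  by rewrite subr_eq0; apply: contra_neq ij => /vi.
have d0 : 0 < d.
  rewrite /d big_seq; elim/big_ind: _ => //= [x y x0 y0|x xS].
    by rewrite lt_min x0.
  by rewrite subr_gt0 pe.
exists (Num.min g d) => [|w wv]; first by rewrite lt_min g0.
have wi : injective (fun i => val (w i)).
  move=> i j /= wij; apply/eqP; apply: contraT => ij.
  have gi := wv i; have gj := wv j.
  have : g <= `|val (v i) - val (v j)| / 2.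
    by rewrite /g (bigD1 (i, j))//= ge_min lexx.
  rewrite leNgt => /negP; case.
  move: gi gj; rewrite !lt_min => /andP[gi _] /andP[gj _].
  rewrite ltr_pdivrMr// mulr_natr mulr2n.
  have -> : val (v i) - val (v j) = (val (w j) - val (v j)) - (val (w i) - val (v i)).
    by rewrite (wij : val (w i) = val (w j)) opprB [RHS]addrC addrA subrK.
  by rewrite (le_lt_trans (ler_normB _ _))// ltrD.
split; first exact: card_unordered.
(* [c] matches a point of [S] with the index of its image in [v], so that the new perturbation can
   send it on to the entry of [w] with that index. *)
have /choice[c cP] : forall x : V, exists i : option 'I_k,
    x \in pts S -> if i is Some i then val (v i) = p x else False.
  move=> x; have [xS|] := boolP (x \in pts S); last by exists None.
  have : p x \in unordered v by rewrite vE in_imfset.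
  by move=> /imfsetP[i _ xi]; exists (Some i).
have cS x : x \in pts S -> exists2 i, c x = Some i & val (v i) = p x.
  by move=> /cP; case: (c x) => // i; exists i.
exists S, (fun x => if c x is Some i then val (w i) else 0); split=> //.
  apply/fsetP => x; apply/imfsetP/imfsetP => /= -[].
    move=> i _ ->; have : val (v i) \in unordered v by exact: in_imfset.
    rewrite vE => /imfsetP[y /= yS vy]; exists y => //.
    have [j -> vj] := cS _ yS; congr (val (w _)); apply: vi.
    by rewrite vj.
  by move=> y yS ->; have [i -> _] := cS _ yS; exists i.
move=> x xS; have [i -> vi'] := cS _ xS.
have -> : val (w i) - x = (val (w i) - val (v i)) + (p x - x).
  by rewrite vi' addrA subrK.
rewrite (le_lt_trans (ler_normD _ _))// -ltrBrDr (lt_le_trans (wv i))//.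
rewrite ge_min; apply/orP; right.
by apply: (@bigmin_inf_seq _ R _ (pts S) 1 x xpredT _ (fun x => e S - `|p x - x|)).
Qed.

Lemma nbhs_closeP S U :
  nbhs S U <-> exists2 e : R, 0 < e & forall T, close e S T -> U T.
Proof.
split; first exact: nbhs_close.
move=> [e e0 eU]; rewrite nbhsE.
(* The interior of [U]: radii add up under composition of perturbations, so half of the radius is
   still available after a move by the other half. *)
exists [set T | exists2 d : R, 0 < d & forall T', close d T T' -> U T'].
  split; last by exists e.
  apply: open_close => T [d d0 dU]; exists (d / 2); first by rewrite divr_gt0.
  move=> T' TT'; exists (d / 2); first by rewrite divr_gt0.
  by move=> T'' /(close_trans TT'); rewrite -splitr; exact: dU.
by move=> T [d d0]; apply; exact: close_refl.
Qed.

End ind_topology.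

Lemma seq_uniform (R : realDomainType) (T : eqType) (X : seq T)
    (P : T -> R -> Prop) :
  (forall x d d', d' <= d -> P x d -> P x d') ->
  (forall x, x \in X -> exists2 d, 0 < d & P x d) ->
  exists2 d, 0 < d & forall x, x \in X -> P x d.
Proof.
move=> Pm; elim: X => [_|x X IH XP]; first by exists 1.
have [|d d0 dP] := IH; first by move=> y yX; apply: XP; rewrite !inE yX orbT.
have [|d' d'0 d'P] := XP x; first by rewrite !inE eqxx.
exists (Num.min d d'); first by rewrite lt_min d0.
move=> y; rewrite !inE => /predU1P[->|yX].
  by apply: Pm d'P; rewrite ge_min lexx orbT.
by apply: Pm (dP y yX); rewrite ge_min lexx.
Qed.

Section ind_continuity.
Variables (R : realType) (n : nat) (C : set 'rV[R]_n) (t : nat).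
Local Notation V := 'rV[R]_n.
Implicit Types (S T : ind C t) (U : set (ind C t)) (X : {fset V}).

Lemma continuous_close (f : ind C t -> R) :
  (forall S e, 0 < e -> exists2 d : R, 0 < d &
     forall T, close d S T -> `|f S - f T| < e) ->
  continuous f.
Proof.
move=> fP S; have FS : Filter (nbhs S) by apply: nbhs_filter.
apply/(@cvgrPdist_lt _ _ _ (nbhs S)) => e e0; apply/nbhs_closeP; exact: fP.
Qed.

Lemma open_subpts (A : set V) : open A -> open [set S : ind C t | [set` pts S] `<=` A].
Proof.
move=> oA; apply: open_close => S SA.
have [|x xS|d d0 dP] := @seq_uniform R _ (pts S)
    (fun x d => forall y, `|y - x| < d -> A y).
- by move=> x d d' dd' dA y yx; apply: dA; exact: lt_le_trans dd'.
- have /nbhs_ballP[d d0 dA] : nbhs x A by apply: open_nbhs_nbhs; split => //; exact: SA.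
  by exists d => // y yx; apply: dA; rewrite -ball_normE /= distrC.
exists d => // T [p [TE _ pd]] x /=; rewrite TE => /imfsetP[y /= yS ->].
by apply: (dP y) => //; exact: pd.
Qed.

Lemma closed_subpts (A : set V) : closed A -> closed [set S : ind C t | [set` pts S] `<=` A].
Proof.
move=> cA; rewrite -openC; apply: open_close => S /existsNP[x /not_implyP[xS xA]].
have /nbhs_ballP[d d0 dA] : nbhs x (~` A).
  by apply: open_nbhs_nbhs; split => //; rewrite openC.
exists d => // T [p [TE _ pd]] TA; apply: (dA (p x)).
  by rewrite -ball_normE /= distrC; exact: pd.
by apply: TA; rewrite /= TE; exact: in_imfset.
Qed.

Lemma open_card (P : nat -> Prop) : open [set S : ind C t | P #|` pts S|].
Proof.
by apply: open_close => S Sk; exists 1 => // T [p [_ /= -> _]].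
Qed.

(** A perturbation by less than every gap of [C] is the identity, so the topology is discrete. *)
Lemma finite_ind_open U : finite_set C -> open U.
Proof.
move=> /finite_fsetP[X CX]; apply: open_close => S US.
have [|x xX|d d0 dP] := @seq_uniform R _ X
    (fun x d => forall y, y \in X -> `|y - x| < d -> y = x).
- by move=> x d d' dd' dA y yX yx; apply: dA => //; exact: lt_le_trans dd'.
- have [|y yX|d d0 dP] := @seq_uniform R _ X
    (fun y d => `|y - x| < d -> y = x).
  + by move=> y d d' dd' dA yx; apply: dA; exact: lt_le_trans dd'.
  + have [->|yx] := eqVneq y x; first by exists 1.
    exists `|y - x|; first by rewrite normr_gt0 subr_eq0.
    by rewrite ltxx.
  + by exists d.
exists d => // T [p [TE _ pd]]; suff -> : T = S by [].
apply: pts_inj; rewrite TE; have [SC _ _] := indP S; have [TC _ _] := indP T.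
have {}SC x : x \in pts S -> x \in X by move/SC; rewrite CX.
have {}TC x : x \in pts T -> x \in X by move/TC; rewrite CX.
rewrite -[RHS]imfset_id; apply: eq_in_imfset => x xS /=.
apply: dP => //; [exact: SC| |exact: pd].
by apply: TC; rewrite TE; exact: in_imfset.
Qed.

End ind_continuity.

Lemma continuous_close2 (R : realType) (n t : nat) (C : set 'rV[R]_n)
    (K : ind C t -> ind C t -> R) (S S' : ind C t) (e : R) :
  continuous (fun p => K p.1 p.2) -> 0 < e ->
  exists2 d : R, 0 < d & forall T T', close d S T -> close d S' T' ->
    `|K S S' - K T T'| < e.
Proof.
move=> /(_ (S, S')) Kc e0; have FS : Filter (nbhs (S, S')) by apply: nbhs_filter.
have /(@cvgrPdist_lt _ _ _ (nbhs (S, S')))/(_ e e0) := Kc.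
case=> -[A B] /= [/nbhs_closeP[d d0 dA] /nbhs_closeP[d' d'0 d'B]] AB.
exists (Num.min d d') => [|T T' ST ST']; first by rewrite lt_min d0.
have cl d1 d2 S1 S2 : d1 <= d2 -> @close R n C t d1 S1 S2 -> close d2 S1 S2.
  by move=> dd [p [? ? pd]]; exists p; split=> // x /pd /lt_le_trans; exact.
apply: (AB (T, T')); split => /=; [apply: dA|apply: d'B].
  by apply: cl ST; rewrite ge_min lexx.
by apply: cl ST'; rewrite ge_min lexx orbT.
Qed.

(** * Independent sets in the whole space: separation and compactness *)

Section ind_Rn.
Variables (R : realType) (n t : nat).
Local Notation V := 'rV[R]_n.
Local Notation ind := (ind [set: V] t).

Lemma edgeE (x y : V) :
  edge x y = (x != y) && (\sum_(i < n) (x ord0 i - y ord0 i) ^+ 2 < 4).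
Proof.
rewrite /edge /eucl_dist; set s := \sum_(i < n) _.
have s0 : 0 <= s by apply: sumr_ge0 => i _; exact: sqr_ge0.
congr (_ && _); last first.
  have -> : (2 : R) = Num.sqrt 4.
    by rewrite -[4]/(4%:R) (_ : 4%:R = 2 ^+ 2) ?sqrtr_sqr ?ger0_norm// expr2 -natrM.
  by rewrite ltr_sqrt.
rewrite sqrtr_gt0 lt0r s0 andbT; congr (~~ _).
apply/eqP/eqP => [s00|xy]; last first.
  by rewrite /s xy big1// => i _; rewrite subrr expr0n.
apply/rowP => i; apply/eqP; rewrite -subr_eq0 -sqrf_eq0.
have /allP/(_ i) : all (fun i => (x ord0 i - y ord0 i) ^+ 2 == 0) (enum 'I_n).
  move/eqP: s00; rewrite /s psumr_eq0 => [/allP s00|j _]; last exact: sqr_ge0.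
  by apply/allP => j _; have := s00 j; rewrite mem_index_enum => /(_ isT).
by rewrite mem_enum => /(_ isT).
Qed.

Lemma continuous_translate (S : ind) : continuous (fun x => translate x S).
Proof.
move=> x U /nbhs_closeP[e e0 eU]; apply/nbhs_ballP; exists e => // y.
rewrite -ball_normE /= => xy; apply: eU.
exists (fun z => z + (y - x)); split.
- rewrite /= -imfset_comp; apply: eq_imfset => // z /=.
  by rewrite [x + z]addrC -addrA [x + _]addrC subrK addrC.
- by rewrite !card_imfset//=; exact: addrI.
- by move=> z _; rewrite addrAC subrr add0r distrC.
Qed.

Lemma pts_subE (S : ind) (k : nat) : #|` pts S| = k -> 
  exists v : 'rV[V]_k, pts S = [fset v ord0 i | i in 'I_k]%fset /\
    (forall i j, i != j -> v ord0 i != v ord0 j).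
Proof.
move=> <-; exists (\row_(i < #|` pts S|) nth 0 (pts S) i); split.
  apply/fsetP => x; apply/idP/imfsetP => /= [xX|[i _ ->]]; last first.
    by rewrite mxE mem_nth.
  have ix : (index x (pts S) < #|` pts S|)%N by rewrite index_mem.
  by exists (Ordinal ix) => //=; rewrite mxE nth_index.
move=> i j ij; rewrite !mxE; apply: contra_neq ij => /eqP.
by rewrite nth_uniq ?fset_uniq// => /eqP/val_inj.
Qed.

Lemma coord_rV_continuous k (i : 'I_k) : continuous (fun v : 'rV[V]_k => v ord0 i).
Proof.
move=> /= M s /= /(nbhs_ballP (M ord0 i)) [e e0 es].
by apply/nbhs_ballP; exists e => //= N [_ MN]; exact/es/MN.
Qed.

(** Two conditions, of which distinctness alone is not closed, become one closed polynomial
    inequality. *)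
Lemma edge_apart (x y : V) :
  x != y /\ ~~ edge x y <-> 4 <= \sum_(i < n) (x ord0 i - y ord0 i) ^+ 2.
Proof.
rewrite edgeE; split=> [[-> /=]|h]; first by rewrite -leNgt.
split; last by rewrite negb_and -leNgt h orbT.
apply: contraTneq h => ->; rewrite big1 ?lern0// => i _.
by rewrite subrr expr0n.
Qed.

(** For each k at most [t] the k-tuples of pairwise separated points of [A] form a closed subset of
    the compact set A^k, and the set is the union of their continuous images. The number of points
    cannot drop in a limit, because separation is closed. *)
Lemma compact_subpts (A : set V) : compact A ->
  compact [set S : ind | [set` pts S] `<=` A].
Proof.
move=> cA; pose P k : set 'rV[V]_k := [set v | (forall i, A (v ord0 i)) /\
   forall i j, i != j -> v ord0 i != v ord0 j /\ ~~ edge (v ord0 i) (v ord0 j)].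
pose q k (v : 'rV[V]_k) : ind := mkind _ _ [fset v ord0 i | i in 'I_k]%fset.
have ptsq k v : (k <= t)%N -> P k v -> pts (q k v) = [fset v ord0 i | i in 'I_k]%fset.
  move=> kt [vA vE]; rewrite /q pts_mkind//; split=> //.
    move=> _ _ /imfsetP[i /= _ ->] /imfsetP[j /= _ ->].
    have [->|/vE[]//] := eqVneq i j.
    by rewrite edgeE eqxx.
  rewrite (leq_trans (leq_imfset_card _ _ _))//=.
  by rewrite -cardE card_ord.
have -> : [set S : ind | [set` pts S] `<=` A] =
    \big[setU/set0]_(k < t.+1) (@q k @` P k).
  rewrite -(bigcup_mkord _ (fun k => @q k @` P k)); apply/seteqP;
    split=> [S SA|S [k /= kt [v Pv <-]]].
    have [_ iS cS] := indP S.
    have [k sk] : exists k, #|` pts S| = k by exists #|` pts S|.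
    rewrite sk in cS.
    have [v [vS vi]] := pts_subE sk.
    exists k => //; exists v; last by rewrite /q -vS mkindK.
    have vS' i : v ord0 i \in pts S by rewrite vS; exact: in_imfset.
    split=> [i|i j ij]; first exact: SA (vS' i).
    by split; [exact: vi|exact: iS].
  rewrite (ptsq _ _ _ Pv)// => x /= /imfsetP[i _ ->].
  by have [+ _] := Pv; apply.
apply: bigsetU_compact => -[k /= kt] _; apply: continuous_compact; last first.
  have cAk := @rV_compact V k (fun=> A) (fun=> cA).
  apply: subclosed_compact cAk _; last by move=> v [].
  have -> : P k = [set v | forall i, A (v ord0 i)] `&`
      \bigcap_(ij in [set ij : 'I_k * 'I_k | ij.1 != ij.2])
        [set v | 4 <= \sum_(l < n) (v ord0 ij.1 ord0 l - v ord0 ij.2 ord0 l) ^+ 2].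
    apply/seteqP; split=> v [vA vE]; split=> //.
      by move=> [i j] /= ij; apply/edge_apart; exact: vE.
    by move=> i j ij; apply/edge_apart; exact: (vE (i, j)).
  apply: closedI.
    rewrite [X in closed X](_ : _ =
        \bigcap_i ((fun v : 'rV[V]_k => v ord0 i) @^-1` A)); last first.
      by apply/seteqP; split=> v vA i; [move=> _|]; exact: vA.
    apply: closed_bigI => i _; apply: preimage_closed.
      by move=> v _; exact: coord_rV_continuous.
    apply: compact_closed => //; exact: norm_hausdorff.
  apply: closed_bigI => -[i j] /= _.
  apply: (@preimage_closed _ _ (fun v : 'rV[V]_k =>
    \sum_(l < n) (v ord0 i ord0 l - v ord0 j ord0 l) ^+ 2) [set x | 4 <= x]).
    move=> v _; have Fv : Filter (nbhs v) by apply: nbhs_filter.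
    apply: (@cvg_big _ _ _ _ _ _ _ (nbhs v)) => [|l _]; first exact: add_continuous.
    have c m : (fun u : 'rV[V]_k => u ord0 m ord0 l) @ v --> v ord0 m ord0 l.
      apply: (@continuous_comp _ _ _ (fun u : 'rV[V]_k => u ord0 m)
        (fun x : V => x ord0 l)); [exact: coord_rV_continuous|exact: coord_continuous].
    have cB := @cvgB _ _ _ (nbhs v) Fv _ _ _ _ (c i) (c j).
    rewrite expr2; under eq_fun do rewrite expr2.
    exact: (@cvgM _ _ (nbhs v) Fv _ _ _ _ cB cB).
  exact: closed_ge.
rewrite continuous_subspace_in => v /set_mem Pv U /nbhs_closeP[e e0 eU].
rewrite /nbhs /= -nbhs_subspace_in// /within /=.
apply/nbhs_ballP; exists e => // w [_ vw] Pw; apply: eU.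
(* The perturbation that witnesses closeness sends each entry of [v] to the entry of [w] with the
   same index; it is well defined as the entries of [v] are distinct. *)
pose phi x := if [pick i | v ord0 i == x] is Some i then w ord0 i else 0.
have phiE i : phi (v ord0 i) = w ord0 i.
  rewrite /phi; case: pickP => [j /eqP vji|/(_ i)]; last by rewrite eqxx.
  have [->//|/(proj2 Pv)[+ _]] := eqVneq j i.
  by rewrite vji eqxx.
have cP u : P k u -> #|` [fset u ord0 i | i in 'I_k]%fset| = k.
  move=> [_ uE]; rewrite card_imfset//= -?cardE ?card_ord// => i j uij.
  by apply/eqP/negPn/negP => /uE[]; rewrite uij eqxx.
exists phi; rewrite !ptsq// !cP//; split=> //.
  apply/fsetP => x; apply/imfsetP/imfsetP => /= -[].
    by move=> i _ ->; exists (v ord0 i); rewrite ?phiE//; exact: in_imfset.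
  by move=> _ /imfsetP[i /= _ ->] ->; exists i; rewrite ?phiE.
move=> _ /imfsetP[i /= _ ->]; rewrite phiE.
by have := vw ord0 i; rewrite -ball_normE /= distrC.
Qed.

End ind_Rn.

(** * Lebesgue measure *)

Section cover_volume.
Variable R : realType.
Local Open Scope ereal_scope.

(* The multiplicities [c] are there for the induction on [n]: fixing the last
   coordinate [s] multiplies [c k] by the indicator of [s] in the last side of
   the [k]-th box, and the inequality so obtained is integrated over [s]. *)
Lemma cover_volume n (A B : nat -> R) (a b : nat -> nat -> R) (c : nat -> R) :
  (forall i, A i <= B i)%R -> (forall k i, a k i <= b k i)%R ->
  (forall k, 0 <= c k)%R ->
  (forall x : nat -> R, (forall i, (i < n)%N -> (A i < x i <= B i)%R) ->
    exists k, (1 <= c k)%R /\ forall i, (i < n)%N -> (a k i < x i <= b k i)%R) ->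
  (\prod_(i < n) (B i - A i))%R%:E <=
  \sum_(0 <= k <oo) (c k * \prod_(i < n) (b k i - a k i))%R%:E.
Proof.
move=> AB ab; elim: n c => [|n IH] c c0 cov.
  have [//|k [ck _]] := cov (fun=> 0%R).
  rewrite big_ord0 (@le_trans _ _ (c k)%:E)// (@nneseriesD1 _ _ k)//; last first.
    by move=> i _; rewrite lee_fin big_ord0 mulr1.
  rewrite big_ord0 mulr1 leeDl// nneseries_ge0// => i _ _.
  by rewrite lee_fin big_ord0 mulr1.
pose v k : R := (\prod_(i < n) (b k i - a k i))%R.
have v0 k : (0 <= v k)%R by apply: prodr_ge0 => i _; rewrite subr_ge0.
pose D : set R := `]A n, B n]%classic.
pose I k : set R := `]a k n, b k n]%classic.
have mD : measurable D by exact: measurable_itv.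
have mI k : measurable (I k) by exact: measurable_itv.
pose mu := @lebesgue_measure R.
have muD : mu D = (B n - A n)%:E.
  rewrite /mu /D lebesgue_measure_itv/= lte_fin; case: ltgtP (AB n) => // -> _.
  by rewrite subrr.
have muI k : mu (I k) = (b k n - a k n)%:E.
  rewrite /mu /I lebesgue_measure_itv/= lte_fin; case: ltgtP (ab k n) => // -> _.
  by rewrite subrr.
pose V := (\prod_(i < n) (B i - A i))%R.
have V0 : (0 <= V)%R by apply: prodr_ge0 => i _; rewrite subr_ge0.
have slice s : D s -> V%:E <= \sum_(0 <= k <oo) ((c k * v k)%:E * (\1_(I k) s)%:E).
  move=> Ds; apply: (le_trans (IH (fun k => c k * \1_(I k) s)%R _ _)).
  - by move=> k; rewrite mulr_ge0// indicE.
  - move=> x xAB; have [i|k [ck xk]] := cov (fun i => if i == n then s else x i).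
      rewrite ltnS leq_eqVlt => /predU1P[->|iltn].
        by rewrite eqxx; move: Ds; rewrite /D /= in_itv.
      by rewrite (ltn_eqF iltn); exact: xAB.
    exists k; split.
      have := xk n (ltnSn n); rewrite eqxx => sk.
      by rewrite indicE mem_set ?mulr1//= /I /= in_itv.
    by move=> i iltn; have := xk i (ltnW iltn); rewrite (ltn_eqF iltn).
  apply: lee_nneseries => [k _ _|k _].
    rewrite lee_fin; apply: mulr_ge0; last exact: v0.
    by rewrite mulr_ge0// indicE.
  by rewrite -EFinM lee_fin mulrAC.
pose F k : measurableTypeR R -> \bar R :=
  fun s => (c k * v k)%:E * (\1_(I k) s)%:E.
have mF k : measurable_fun D (F k).
  apply: measurable_funeM; apply/measurable_EFinP.
  exact: measurable_indic.
have F0 k s : 0 <= F k s.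
  by rewrite /F -EFinM lee_fin; apply: mulr_ge0; [exact: mulr_ge0|rewrite indicE].
rewrite big_ord_recr/= -/V EFinM -muD -integral_cst//.
apply: (@le_trans _ _ (\int[mu]_(s in D)
    (\sum_(0 <= k <oo) F k s))).
  apply: ge0_le_integral => //.
  - exact: (@ge0_emeasurable_sum _ _ R D F xpredT (fun k x _ _ => F0 k x)
      (fun k _ => mF k)).
rewrite integral_nneseries//; apply: lee_nneseries => [k _ _|k _].
  by apply: integral_ge0.
rewrite /F ge0_integralZl//.
- rewrite integral_indic//.
  rewrite big_ord_recr/= mulrA [leRHS]EFinM.
  apply: lee_wpmul2l; first by rewrite lee_fin; apply: mulr_ge0; [exact: c0|exact: v0].
  rewrite -muI; apply: le_measure; last exact: subIsetl.
    by apply: mem_set; exact: (measurableI _ _ (mI k) mD).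
  by apply: mem_set; exact: mI.
- exact: mI.
- by apply/measurable_EFinP; apply: measurable_indic; exact: mI.
- by rewrite lee_fin; apply: mulr_ge0; [exact: c0|exact: v0].
Qed.

End cover_volume.

(** * Lebesgue outer measure: volume of boxes, subadditivity, measurability of boxes *)

Section lebesgue_rV.
Variables (R : realType) (n : nat).
Local Notation V := 'rV[R]_n.+1.
Local Notation leb := (@lebesgue_rV R n.+1).
Local Open Scope ereal_scope.
Implicit Types (A B X : set V) (a b v x y : V).

Definition vol a b : R := (\prod_(i < n.+1) (b ord0 i - a ord0 i))%R.

Definition ordered a b := forall i, (a ord0 i <= b ord0 i)%R.

Lemma vol_ge0 a b : ordered a b -> (0 <= vol a b)%R.
Proof. by move=> ab; apply: prodr_ge0 => i _; rewrite subr_ge0; exact: ab. Qed.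

(** This needs a coordinate: in dimension 0 the empty product is 1 and every countable cover has
    infinite total volume. The degenerate boxes pad a finite cover to a sequence. *)
Lemma volxx a : vol a a = 0%R.
Proof. by rewrite /vol (bigD1 ord0)//= subrr mul0r. Qed.

Lemma lebesgue_rV_le X (a b : nat -> V) : (forall k, ordered (a k) (b k)) ->
  X `<=` \bigcup_k box (a k) (b k) ->
  leb X <= \sum_(0 <= k <oo) (vol (a k) (b k))%:E.
Proof.
by move=> ab Xab; apply: ereal_inf_lbound; exists a, b; split.
Qed.

Lemma lebesgue_rV_ge0 X : 0 <= leb X.
Proof.
apply: le_ereal_inf_tmp => _ [a [b [ab _ ->]]]; apply: nneseries_ge0 => k _ _.
by rewrite lee_fin vol_ge0//; exact: ab.
Qed.

Lemma lebesgue_rV_mono : {homo leb : X B / X `<=` B >-> X <= B}.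
Proof.
move=> X B XB; apply: le_ereal_inf => _ [a [b [ab Bab ->]]]; exists a, b; split=> //.
exact: subset_trans Bab.
Qed.

Lemma lebesgue_rV_box_le a b : ordered a b -> leb (box a b) <= (vol a b)%:E.
Proof.
move=> ab; pose b' k := if k is 0%N then b else a.
have := @lebesgue_rV_le (box a b) (fun=> a) b'.
rewrite (@nneseriesD1 _ _ 0%N)//=; last first.
  by move=> [|k] _; rewrite lee_fin vol_ge0.
rewrite eseries0 ?adde0; last by move=> [|k] _ //=; rewrite volxx.
by apply=> [[|k]//|x xab]; exists 0%N.
Qed.

Lemma lebesgue_rV_box a b : ordered a b -> leb (box a b) = (vol a b)%:E.
Proof.
move=> ab; apply/eqP; rewrite eq_le lebesgue_rV_box_le//=.
apply: le_ereal_inf_tmp => _ [c [d [cd abcd ->]]].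
pose ext x (i : nat) : R := x ord0 (inord i).
have extE x (i : 'I_n.+1) : ext x i = x ord0 i by rewrite /ext inord_val.
have := @cover_volume R n.+1 (ext a) (ext b) (fun k => ext (c k)) (fun k => ext (d k)) (fun=> 1%R).
under eq_bigr do rewrite !extE.
under eq_eseriesr do under eq_bigr do rewrite !extE.
under eq_eseriesr do rewrite mul1r.
apply=> [i|k i|k|x xab]; [exact: ab|exact: cd|by []|].
have [|k _ xk] := abcd (\row_i x i).
  by move=> i /=; rewrite mxE -!extE; exact: xab.
exists k; split=> // i iltn; have := xk (Ordinal iltn).
by rewrite mxE -!extE.
Qed.

Lemma lebesgue_rV0 : leb set0 = 0.
Proof.
apply/eqP; rewrite eq_le lebesgue_rV_ge0 andbT.
rewrite -[leRHS]/(0%R)%:E -(volxx 0) (le_trans (lebesgue_rV_mono (sub0set (box 0 0)%R)))//.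
by apply: lebesgue_rV_box_le => i.
Qed.

(** Flattens a sequence of covers into one cover of the union, with the same total volume. *)
Lemma nneseries_pairing (u : nat -> nat -> \bar R) : (forall i j, 0 <= u i j) ->
  exists f : nat -> nat * nat, (forall p, exists k, f k = p) /\
    \sum_(0 <= k <oo) u (f k).1 (f k).2 =
    \sum_(0 <= i <oo) \sum_(0 <= j <oo) u i j.
Proof.
move=> u0; have /card_esym/ppcard_eqP[f] := card_nat2.
exists f; split=> [p|].
  by exists (f^-1%FUN p); rewrite invK ?inE.
rewrite nneseries_esumT//.
rewrite -(@reindex_esum _ _ _ setT setT f (fun p => u p.1 p.2)) ?bij//.
rewrite nneseries_esumT; last by move=> i; exact: nneseries_ge0.
under [RHS]eq_esum do rewrite nneseries_esumT//.
rewrite esum_esum//; congr esum.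
by apply/seteqP; split.
Qed.

Lemma lebesgue_rV_sigma_subadditive : sigma_subadditive leb.
Proof.
move=> F; have [[i ioo]|] := pselect (exists i, leb (F i) = +oo).
  rewrite (eseries_pinfty _ _ ioo) ?leey// => k _.
  by rewrite -ltNye (lt_le_trans _ (lebesgue_rV_ge0 _)).
rewrite -forallNE => Foo.
apply/lee_addgt0Pr => e e0.
rewrite (le_trans _ (@epsilon_trick _ _ _ _ _ (ltW e0)))//; last first.
  by move=> k; exact: lebesgue_rV_ge0.
have /choice[g gP] : forall k, exists ab : nat -> V * V,
   [/\ forall j, ordered (ab j).1 (ab j).2,
       F k `<=` \bigcup_j box (ab j).1 (ab j).2 &
       \sum_(0 <= j <oo) (vol (ab j).1 (ab j).2)%:E <=
         leb (F k) + (e / (2 ^ k.+1)%:R)%:E].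
  move=> k; have en1 : (0 < e / (2 ^ k.+1)%:R)%R by rewrite divr_gt0// ltr0n expn_gt0.
  have : leb (F k) \is a fin_num.
    by rewrite ge0_fin_numE ?lebesgue_rV_ge0// ltey; apply/eqP; exact: Foo.
  move=> /(lb_ereal_inf_adherent en1)[_ [a [b [ab Fab ->]]] /ltW h].
  by exists (fun j => (a j, b j)); split.
have [i j|f [fs fE]] := @nneseries_pairing (fun i j => (vol (g i j).1 (g i j).2)%:E).
  by rewrite lee_fin vol_ge0//; have [+ _ _] := gP i; apply.
apply: (@le_trans _ _ (\sum_(0 <= i <oo) \sum_(0 <= j <oo)
    (vol (g i j).1 (g i j).2)%:E)).
  rewrite -fE; apply: (@lebesgue_rV_le _ (fun k => (g (f k).1 (f k).2).1)
    (fun k => (g (f k).1 (f k).2).2)) => [k|x [i _ Fix]].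
    by have [+ _ _] := gP (f k).1; apply.
  have [_ /(_ x Fix)[j _ xij] _] := gP i.
  by have [k fk] := fs (i, j); exists k => //; rewrite fk.
apply: lee_nneseries => [k _ _|k _]; last by have [] := gP k.
by apply: nneseries_ge0 => j _ _; rewrite lee_fin vol_ge0//; have [+ _ _] := gP k; apply.
Qed.

HB.instance Definition _ := isOuterMeasure.Build R V leb lebesgue_rV0
  lebesgue_rV_ge0 lebesgue_rV_mono lebesgue_rV_sigma_subadditive.

Definition upd a (i : 'I_n.+1) (s : R) : V := \row_j (if j == i then s else a ord0 j).

(** The hyperplane cuts every box of a cover into two boxes whose volumes add up to the old one, so
    any cover of [X] yields covers of its two parts at no extra cost. *)
Lemma halfspace_caratheodory (i : 'I_n.+1) (s : R) :
  leb.-caratheodory [set x : V | (x ord0 i <= s)%R].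
Proof.
apply: le_caratheodory_measurable => X; set H := [set x : V | _].
apply: le_ereal_inf_tmp => _ [a [b [ab Xab ->]]].
(* The cut [s] is clamped to the side of the box, so that both pieces are ordered even if the
   hyperplane misses the box. *)
pose m k := Num.max (a k ord0 i) (Num.min (b k ord0 i) s).
have am k : (a k ord0 i <= m k)%R by rewrite /m le_max lexx.
have mb k : (m k <= b k ord0 i)%R by rewrite /m ge_max ge_min lexx ab.
have o1 k : ordered (a k) (upd (b k) i (m k)).
  by move=> j; rewrite mxE; case: eqP => [->//|_]; exact: ab.
have o2 k : ordered (upd (a k) i (m k)) (b k).
  by move=> j; rewrite mxE; case: eqP => [->//|_]; exact: ab.
have -> : \sum_(0 <= k <oo) (\prod_(i < n.+1) (b k ord0 i - a k ord0 i))%R%:E =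
    \sum_(0 <= k <oo) (vol (a k) (upd (b k) i (m k)))%:E +
    \sum_(0 <= k <oo) (vol (upd (a k) i (m k)) (b k))%:E.
  rewrite -nneseriesD; last 2 first.
  - by move=> k _ _; rewrite lee_fin vol_ge0.
  - by move=> k _ _; rewrite lee_fin vol_ge0.
  apply: eq_eseriesr => k _; rewrite -EFinD; congr EFin.
  rewrite /vol (bigD1 i)//= [in RHS](bigD1 i)//= [X in (_ = _ + X)%R](bigD1 i)//=.
  rewrite !mxE eqxx.
  rewrite [X in (_ = _ * X + _)%R](eq_bigr (fun j => b k ord0 j - a k ord0 j)%R); last first.
    by move=> j ji; rewrite mxE (negbTE ji).
  rewrite [X in (_ = _ + _ * X)%R](eq_bigr (fun j => b k ord0 j - a k ord0 j)%R); last first.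
    by move=> j ji; rewrite mxE (negbTE ji).
  by rewrite -mulrDl [X in (_ = X * _)%R]addrC addrA subrK.
apply: leeD; apply: lebesgue_rV_le => // x [Xx Hx].
  have [k _ xk] := Xab x Xx; exists k => // j /=; rewrite mxE.
  have [ji|_] := eqVneq j i; last exact: xk.
  have /andP[xk1 xk2] := xk j.
  by rewrite xk1/= /m le_max le_min -ji xk2 ji Hx orbT.
have [k _ xk] := Xab x Xx; exists k => // j /=; rewrite mxE.
have [ji|_] := eqVneq j i; last exact: xk.
have /andP[xk1 xk2] := xk j; rewrite xk2 andbT /m gt_max gt_min -ji xk1/=.
by move/negP: Hx; rewrite -ltNge ji => ->; rewrite orbT.
Qed.

Lemma box_caratheodory a b : leb.-caratheodory (box a b).
Proof.
have -> : box a b = \big[setI/setT]_(i < n.+1)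
    ([set x : V | (x ord0 i <= b ord0 i)%R] `\` [set x : V | (x ord0 i <= a ord0 i)%R]).
  rewrite -bigcap_seq; apply/seteqP; split=> x.
    by move=> xab i _ /=; have /andP[ax ->] := xab i; split=> //; apply/negP; rewrite -ltNge.
  move=> xab i; have [|/= -> /negP] := xab i; first exact: mem_index_enum.
  by rewrite -ltNge => ->.
elim/big_ind: _ => [|X Y|i _].
- by have := caratheodory_measurable_setC (caratheodory_measurable_set0 leb); rewrite setC0.
- exact: caratheodory_measurable_setI.
- apply: caratheodory_measurable_setD; exact: halfspace_caratheodory.
Qed.

End lebesgue_rV.

(** * Lebesgue measure on Borel sets: translations and inner regularity *)

Section lebesgue_rV_borel.
Variables (R : realType) (n : nat).
Local Notation V := 'rV[R]_n.+1.
Local Notation leb := (@lebesgue_rV R n.+1).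
Local Open Scope ereal_scope.
Implicit Types (A B X : set V) (a b v x y : V).

Lemma lebesgue_rV_translate v A : leb [set x | A (v + x)%R] = leb A.
Proof.
suff le w B : leb [set x | B (w + x)%R] <= leb B.
  apply/eqP; rewrite eq_le le/= -[leLHS]/(leb A).
  rewrite [in leLHS](_ : A = [set x | A (v + (- v + x))%R]); last first.
    by apply/seteqP; split=> x /=; rewrite addrA subrr add0r.
  exact: (le (- v)%R [set x | A (v + x)%R]).
apply: le_ereal_inf_tmp => _ [a [b [ab Bab ->]]].
have -> : \sum_(0 <= k <oo) (\prod_(i < n.+1) (b k ord0 i - a k ord0 i))%R%:E =
    \sum_(0 <= k <oo) (vol (a k - w) (b k - w))%R%:E.
  apply: eq_eseriesr => k _; congr EFin; apply: eq_bigr => i _.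
  by rewrite !mxE opprB addrA subrK.
apply: lebesgue_rV_le => [k i|x /Bab[k _ xk]].
  by rewrite !mxE lerD2r; exact: ab.
exists k => // i; have := xk i.
by rewrite !mxE ltrBlDl lerBrDl.
Qed.

Lemma open_bigcup_box A : open A ->
  exists a b : nat -> V, A = \bigcup_k box (a k) (b k).
Proof.
move=> oA; pose T := ('rV[rat]_n.+1 * 'rV[rat]_n.+1)%type.
pose q (u : 'rV[rat]_n.+1) : V := \row_i ratr (u ord0 i).
(* Enumerates the rational boxes contained in [A]; the default pair of zero vectors gives the empty
   box. *)
pose P (k : nat) : V * V := if @choice.unpickle T k is Some u then
   (if pselect (box (q (u : T).1) (q u.2) `<=` A) then (q u.1, q u.2) else (0%R, 0%R))
   else (0%R, 0%R).
exists (fun k => (P k).1), (fun k => (P k).2); apply/seteqP; split=> x; last first.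
  move=> [k _]; rewrite /P; case: choice.unpickle => [u|] /=.
    case: pselect => [uA|nuA]; first exact: uA.
    by move=> /(_ ord0); rewrite mxE lt_le_asym.
  by move=> /(_ ord0); rewrite mxE lt_le_asym.
move=> Ax; have /nbhs_ballP[e e0 eA] : nbhs x A by apply: open_nbhs_nbhs.
have /choice[p pP] : forall i, exists r : rat, (x ord0 i - e < ratr r < x ord0 i)%R.
  move=> i; have [|r] := @rat_in_itvoo R (x ord0 i - e)%R (x ord0 i).
    by rewrite ltrBlDr ltrDl.
  by rewrite in_itv/=; exists r.
have /choice[r rP] : forall i, exists r : rat, (x ord0 i < ratr r < x ord0 i + e)%R.
  move=> i; have [|r] := @rat_in_itvoo R (x ord0 i)%R (x ord0 i + e)%R.
    by rewrite ltrDl.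
  by rewrite in_itv/=; exists r.
exists (choice.pickle ((\row_i p i, \row_i r i) : T)) => //.
rewrite /P choice.pickleK /=; case: pselect => [qA i|[]].
  rewrite !mxE; have /andP[_ ->] := pP i; have /andP[h _] := rP i.
  exact: ltW.
move=> y yb; apply: eA; split=> // i j; rewrite (ord1 i) /ball /=.
have := yb j; rewrite !mxE => /andP[y1 y2].
have /andP[p1 p2] := pP j; have /andP[r1 r2] := rP j.
rewrite ltr_norml; apply/andP; split.
  by rewrite ltrBrDr -ltrBrDl opprK addrC (le_lt_trans y2)// addrC.
by rewrite ltrBlDr -ltrBlDl (lt_trans p1).
Qed.

Lemma borel_caratheodory A : <<s @open V >> A -> leb.-caratheodory A.
Proof.
apply: smallest_sub => [|B oB].
  split=> [|B mB|F mF].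
  - exact: caratheodory_measurable_set0.
  - by rewrite setTD; exact: caratheodory_measurable_setC.
  - exact: caratheodory_measurable_bigcup.
have [a [b ->]] := open_bigcup_box oB.
by apply: caratheodory_measurable_bigcup => k; exact: box_caratheodory.
Qed.

(** The same function on the Borel sigma-algebra, where it is a measure by Caratheodory's theorem
    and can be restricted and integrated against. *)
Definition lebV (A : set (borel V)) : \bar R := leb A.

Let lebV0 : lebV set0 = 0. Proof. exact: lebesgue_rV0. Qed.
Let lebV_ge0 A : 0 <= lebV A. Proof. exact: lebesgue_rV_ge0. Qed.
Let lebV_sigma_additive : semi_sigma_additive lebV.
Proof.
move=> F mF tF mUF.
apply: (@caratheodory_measure_sigma_additive _ _ leb F) => //.
  by move=> i; apply: borel_caratheodory; exact: mF.
exact: borel_caratheodory.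
Qed.

HB.instance Definition _ := isMeasure.Build _ (borel V) R lebV
  lebV0 lebV_ge0 lebV_sigma_additive.

Lemma open_borel A : open A -> measurable (A : set (borel V)).
Proof. exact: sub_sigma_algebra. Qed.

Lemma closed_borel A : closed A -> measurable (A : set (borel V)).
Proof.
by move=> cA; rewrite -[A]setCK; apply: measurableC; apply: open_borel; rewrite openC.
Qed.

Lemma halfspace_closed i (s : R) : closed [set x : V | (x ord0 i <= s)%R].
Proof.
apply: (@preimage_closed _ _ (fun x : V => x ord0 i) [set y | (y <= s)%R]).
  by move=> x _; exact: coord_continuous.
exact: closed_le.
Qed.

Lemma box_borel a b : measurable (box a b : set (borel V)).
Proof.
have -> : box a b = \big[setI/setT]_(i < n.+1)
    ([set x : V | (x ord0 i <= b ord0 i)%R] `\` [set x : V | (x ord0 i <= a ord0 i)%R]).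
  rewrite -bigcap_seq; apply/seteqP; split=> x.
    by move=> xab i _ /=; have /andP[ax ->] := xab i; split=> //; apply/negP; rewrite -ltNge.
  move=> xab i; have [|/= -> /negP] := xab i; first exact: mem_index_enum.
  by rewrite -ltNge => ->.
elim/big_ind: _ => [|X Y|i _].
- exact: measurableT.
- exact: measurableI.
- apply: measurableD; apply: closed_borel; exact: halfspace_closed.
Qed.

Lemma cbox_compact a b : compact [set x : V | forall i, (a ord0 i <= x ord0 i <= b ord0 i)%R].
Proof.
have := @rV_compact R n.+1 (fun i => `[a ord0 i, b ord0 i]%classic)
  (fun i => @segment_compact R _ _).
by congr compact; apply/seteqP; split=> x xab i; have := xab i; rewrite /= in_itv.
Qed.

Lemma vol_enlarge a b (e : R) : (0 < e)%R ->
  exists2 d : R, (0 < d)%R & (vol a (b + const_mx d) < vol a b + e)%R.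
Proof.
move=> e0; pose f (d : R) : R := (\prod_(i < n.+1) (b ord0 i + d - a ord0 i))%R.
have fE d : vol a (b + const_mx d) = f d by apply: eq_bigr => i _; rewrite !mxE.
have fc : f @ (0%R : R) --> f 0%R.
  apply: (@cvg_big R _ _ _ _ _ _ (nbhs (0 : R)%R) _
     (fun i d => b ord0 i + d - a ord0 i)%R) => [|i _]; first exact: mul_continuous.
  by apply: cvgB; [apply: cvgD; [exact: cvg_cst|exact: cvg_id]|exact: cvg_cst].
move/cvgrPdist_lt : fc => /(_ e e0) /nbhs_ballP[d d0 dP].
exists (d / 2)%R; first by rewrite divr_gt0.
have := dP (d / 2)%R; rewrite /ball /= sub0r normrN gtr0_norm ?divr_gt0//.
rewrite ltr_pdivrMr// ltr_pMr// ltr1n => /(_ isT).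
have -> : f 0%R = vol a b by apply: eq_bigr => i _; rewrite addr0.
rewrite fE distrC ltr_norml => /andP[_].
by rewrite ltrBlDl.
Qed.

(** Outer regularity of the complement: in the closed box [Q], cover D = Q \ A by an open [U] whose
    measure exceeds that of [D] by at most [e], and take K = Q \ U. The part of [A] lost in [U] has
    measure at most [e], since [Q] meets [U] in that part and in [D], which has finite measure. *)
Lemma lebesgue_rV_inner_regular a b A (e : R) : ordered a b ->
  <<s @open V >> A -> A `<=` box a b -> (0 < e)%R ->
  exists K, [/\ compact K, K `<=` A & leb A <= leb K + e%:E].
Proof.
move=> ab mA Aab e0.
pose Q := [set x : V | forall i, (a ord0 i <= x ord0 i <= b ord0 i)%R].
have cQ : compact Q := @cbox_compact a b.
have clQ : closed Q by apply: compact_closed => //; exact: norm_hausdorff.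
have mQ : measurable (Q : set (borel V)) := closed_borel clQ.
have AQ : A `<=` Q.
  by move=> x /Aab xab i; have /andP[/ltW -> ->] := xab i.
pose D := Q `\` A.
have mD : measurable (D : set (borel V)) by exact: measurableD.
have Qfin : leb Q < +oo.
  have QB : Q `<=` box (a - const_mx 1)%R b.
    move=> x xQ i; have /andP[ax ->] := xQ i.
    by rewrite !mxE andbT ltrBlDr (le_lt_trans ax)// ltrDl.
  rewrite (le_lt_trans (lebesgue_rV_mono QB))// lebesgue_rV_box ?ltry//.
  by move=> i; rewrite !mxE lerBlDr (le_trans (ab i))// lerDl.
have DQ : D `<=` Q by move=> x [].
have Dfin : leb D \is a fin_num.
  by rewrite ge0_fin_numE ?lebesgue_rV_ge0// (le_lt_trans (lebesgue_rV_mono DQ)).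
(* One half of [e] pays for the choice of a cover of [D] by boxes, the other for enlarging these
   boxes to open ones. *)
have e20 : (0 < e / 2)%R by rewrite divr_gt0.
have [_ [c [d [cd Dcd ->]]] /ltW cdD] := lb_ereal_inf_adherent e20 Dfin.
have /choice[h hP] : forall k, exists h : R, (0 < h)%R /\
    (vol (c k) (d k + const_mx h) < vol (c k) (d k) + (e / 2) / (2 ^ k.+1)%:R)%R.
  move=> k; have [|h h0 hv] := @vol_enlarge (c k) (d k) ((e / 2) / (2 ^ k.+1)%:R)%R.
    by rewrite divr_gt0// ltr0n expn_gt0.
  by exists h.
pose O_ k := [set x : V | forall i, (c k ord0 i < x ord0 i < d k ord0 i + h k)%R].
have oO k : open (O_ k).
  rewrite [X in open X](_ : _ = \bigcap_(i in [set` index_enum 'I_n.+1])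
      ([set x : V | (c k ord0 i < x ord0 i)%R] `&`
       [set x : V | (x ord0 i < d k ord0 i + h k)%R])); last first.
    apply/seteqP; split=> x xO i; first by move=> _; have /andP[] := xO i.
    by have [|/= -> ->] := xO i; first exact: mem_index_enum.
  rewrite bigcap_seq; elim/big_ind: _ => [|X Y|i _]; [exact: openT|exact: openI|].
  apply: openI.
    apply: (@open_comp _ _ (fun x : V => x ord0 i) [set y | (c k ord0 i < y)%R]).
      by move=> x _; exact: coord_continuous.
    exact: open_gt.
  apply: (@open_comp _ _ (fun x : V => x ord0 i) [set y | (y < d k ord0 i + h k)%R]).
    by move=> x _; exact: coord_continuous.
  exact: open_lt.
pose U := \bigcup_k O_ k.
have oU : open U by apply: bigcup_open.
have DU : D `<=` U.
  move=> x /Dcd[k _ xk]; exists k => // i; have /andP[-> xd] := xk i.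
  by rewrite (le_lt_trans xd)// ltrDl; have [] := hP k.
have Ule : leb U <= leb D + e%:E.
  have : leb U <= \sum_(0 <= k <oo) (vol (c k) (d k + const_mx (h k)))%:E.
    apply: lebesgue_rV_le => [k i|x [k _ xk]].
      rewrite !mxE (le_trans (cd k i))// lerDl; have [+ _] := hP k; exact: ltW.
    by exists k => // i; have := xk i; rewrite !mxE => /andP[-> /ltW].
  move=> /le_trans; apply.
  apply: (@le_trans _ _ (\sum_(0 <= k <oo)
      ((vol (c k) (d k))%:E + ((e / 2) / (2 ^ k.+1)%:R)%:E))).
    apply: lee_nneseries => [k _ _|k _].
      rewrite lee_fin vol_ge0// => i.
      rewrite !mxE (le_trans (cd k i))// lerDl; have [+ _] := hP k; exact: ltW.
    by rewrite -EFinD lee_fin; have [_ /ltW] := hP k.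
  apply: (le_trans (@epsilon_trick _ (fun k => (vol (c k) (d k))%:E) _ _ _ (ltW e20))).
    by move=> k; rewrite lee_fin vol_ge0//; exact: cd.
  by rewrite [in leRHS](splitr e) EFinD addeA leeD2r.
exists (Q `\` U); split.
- apply: (subclosed_compact _ cQ); last by move=> x [].
  by rewrite setDE; apply: closedI => //; exact: open_closedC.
- move=> x [Qx nUx]; apply: contrapT => nAx; apply: nUx; apply: DU; split => //.
have mU : leb.-caratheodory U by apply: borel_caratheodory; exact: sub_sigma_algebra.
have h1 : leb A = leb (A `&` U) + leb (A `&` ~` U) by exact: mU.
have h2 : leb (Q `&` U) = leb (Q `&` U `&` A) + leb (Q `&` U `&` ~` A).
  exact: borel_caratheodory.
have E1 : Q `&` U `&` A = A `&` U.
  by apply/seteqP; split=> x; [move=> [[_ ?] ?]|move=> [Ax ?]; do 2?split => //; exact: AQ].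
have E2 : Q `&` U `&` ~` A = D.
  apply/seteqP; split=> x; first by move=> [[? _] ?].
  by move=> Dx; have [? ?] := Dx; do 2?split => //; exact: DU.
rewrite h1 addeC; apply: leeD.
  by apply: lebesgue_rV_mono => x [Ax nUx]; split => //; exact: AQ.
rewrite -E1; rewrite E2 in h2.
rewrite -(leeD2rE _ _ Dfin) -h2 addeC.
by apply: (le_trans _ Ule); apply: lebesgue_rV_mono => x [].
Qed.

End lebesgue_rV_borel.

(** * Positive semidefinite kernels *)

Section psd_theory.
Variable R : realType.

(** The points [h i] may repeat, while [psd] sums over finite sets; the weights of equal points are
    added. *)
Lemma psd_sum (T : choiceType) (K : T -> T -> R) (I : eqType) (r : seq I)
    (h : I -> T) (w : I -> R) : psd K ->
  0 <= \sum_(i <- r) \sum_(j <- r) w i * w j * K (h i) (h j).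
Proof.
move=> [_ Kp]; pose S := [fset x in map h r]%fset.
pose w' x := \sum_(i <- r | h i == x) w i.
have fib (G : T -> R) : \sum_(x <- S) w' x * G x = \sum_(i <- r) w i * G (h i).
  under eq_bigr do rewrite mulr_suml big_mkcond/=.
  rewrite exchange_big/=; apply: eq_big_seq => i ir.
  have hiS : h i \in S by rewrite inE /= map_f.
  rewrite (bigD1_seq (h i))//= eqxx big1_seq ?addr0// => x /andP[xh _].
  by rewrite eq_sym (negbTE xh).
apply: le_trans (Kp S w') _.
under eq_bigr do under eq_bigr do rewrite -mulrA.
under eq_bigr do rewrite -mulr_sumr fib.
under [leRHS]eq_bigr do under eq_bigr do rewrite -mulrA.
under [leRHS]eq_bigr do rewrite -mulr_sumr.
by rewrite (fib (fun x => \sum_(j <- r) w j * K x (h j))).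
Qed.

Lemma psd_comp (T T' : choiceType) (K : T -> T -> R) (h : T' -> T) :
  psd K -> psd (fun x y => K (h x) (h y)).
Proof.
move=> Kp; split=> [x y|S w]; first exact: Kp.1.
exact: psd_sum.
Qed.

Lemma psd_rank1 (T : choiceType) (v : T -> R) : psd (fun x y => v x * v y).
Proof.
split=> [x y|S w]; first exact: mulrC.
have -> : \sum_(x <- S) \sum_(y <- S) w x * w y * (v x * v y) =
    (\sum_(x <- S) w x * v x) ^+ 2.
  rewrite expr2 mulr_suml; apply: eq_bigr => x _; rewrite mulr_sumr.
  by apply: eq_bigr => y _; rewrite mulrACA.
exact: sqr_ge0.
Qed.

Section schur_complement.
Variables (T : choiceType) (K : T -> T -> R) (x0 : T).
Hypothesis Kp : psd K.

Lemma psd_diag_ge0 : 0 <= K x0 x0.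
Proof.
have := Kp.2 [fset x0]%fset (fun=> 1).
by rewrite !big_seq_fset1 !mul1r.
Qed.

(** The quadratic form at [w] plus [c] times the unit vector at [x0]. Indexing by [option T] keeps
    the additional [x0] apart from an [x0] that may lie in [S]. *)
Lemma psd_quad (S : {fset T}) (w : T -> R) (c : R) :
  0 <= \sum_(x <- S) \sum_(y <- S) w x * w y * K x y +
    (c * \sum_(x <- S) w x * K x0 x) *+ 2 + c ^+ 2 * K x0 x0.
Proof.
pose h (o : option T) := if o is Some x then x else x0.
pose u (o : option T) := if o is Some x then w x else c.
pose r := None :: map Some (S : seq T).
have := @psd_sum T K (option T) r h u Kp; congr (0 <= _).
rewrite /r big_cons big_cons !big_map.
under [X in _ + X = _]eq_bigr do rewrite big_cons big_map.
rewrite big_split/=.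
have -> : \sum_(j <- S) w j * c * K j x0 = c * \sum_(x <- S) w x * K x0 x.
  by rewrite mulr_sumr; apply: eq_bigr => x _; rewrite Kp.1 mulrA [w x * c]mulrC.
have -> : \sum_(j <- S) c * w j * K x0 j = c * \sum_(x <- S) w x * K x0 x.
  by rewrite mulr_sumr; apply: eq_bigr => x _; rewrite mulrA.
set q := \sum_(x <- S) \sum_(y <- S) _; set z := \sum_(x <- S) w x * _.
lra.
Qed.

(** With a zero diagonal entry [psd_quad] is affine in [c], and an affine function bounded below has
    slope 0. *)
Lemma psd_zero_diag y : K x0 x0 = 0 -> K x0 y = 0.
Proof.
move=> K0; have h c : 0 <= K y y + (c * K x0 y) *+ 2.
  have := psd_quad [fset y]%fset (fun=> 1) c.
  by rewrite !big_seq_fset1 !mul1r K0 mulr0 addr0.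
apply/eqP; apply: contraT => Ky.
have := h (- (K y y + 1) / K x0 y); rewrite divfK//.
have := psd_diag_ge0; have := Kp.2 [fset y]%fset (fun=> 1).
by rewrite !big_seq_fset1 !mul1r; lra.
Qed.

(** The Schur complement is [psd_quad] minimized over [c], with minimizer [- B / K x0 x0]. If the
    pivot is 0, its whole row vanishes and nothing is subtracted. *)
Lemma psd_schur : psd (fun x y => K x y - K x0 x * K x0 y / K x0 x0).
Proof.
have [K0|K0] := eqVneq (K x0 x0) 0.
  have -> : (fun x y => K x y - K x0 x * K x0 y / K x0 x0) = K.
    by apply/funext => x; apply/funext => y; rewrite (psd_zero_diag x K0) !mul0r subr0.
  exact: Kp.
split=> [x y|S w]; first by rewrite Kp.1 [K x0 x * _]mulrC.
pose B := \sum_(x <- S) w x * K x0 x.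
have := psd_quad S w (- B / K x0 x0); congr (0 <= _); rewrite -/B.
have -> : \sum_(x <- S) \sum_(y <- S) w x * w y * (K x y - K x0 x * K x0 y / K x0 x0) =
    \sum_(x <- S) \sum_(y <- S) w x * w y * K x y - B ^+ 2 / K x0 x0.
  rewrite expr2 -mulrA {1}/B mulr_suml -sumrB; apply: eq_bigr => x _.
  rewrite /B mulr_suml mulr_sumr -sumrB; apply: eq_bigr => y _.
  rewrite mulrBr; congr (_ - _).
  by rewrite !mulrA; congr (_ / _); lra.
rewrite -addrA; congr (_ + _); rewrite expr_div_n sqrrN mulr2n.
have -> : B ^+ 2 / K x0 x0 ^+ 2 * K x0 x0 = B ^+ 2 / K x0 x0.
  by rewrite [K x0 x0 ^+ 2]expr2 invfM mulrA -mulrA mulVf// mulr1.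
set k := (K x0 x0)^-1; lra.
Qed.

End schur_complement.

(** Cholesky factorization: each step splits off the rank-one kernel of the pivot [x0] and continues
    with the Schur complement. *)
Lemma psd_gram (T : choiceType) (K : T -> T -> R) (s : seq T) : psd K ->
  exists vs : seq (T -> R), forall x y, x \in s -> y \in s ->
    K x y = \sum_(v <- vs) v x * v y.
Proof.
elim: s K => [|x0 s IH] K Kp; first by exists [::].
have [vs vsE] := IH _ (psd_schur x0 Kp).
pose u x := K x0 x / Num.sqrt (K x0 x0).
(* The induction controls the factors on [s] only. They are set to 0 at [x0], where the Schur
   complement has a zero row. *)
pose kill (v : T -> R) x := if x == x0 then 0 else v x.
have uE x y : u x * u y = K x0 x * K x0 y / K x0 x0.
  rewrite /u mulrACA -invfM -expr2 sqr_sqrtr//; exact: psd_diag_ge0.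
have row0 y : K x0 y = u x0 * u y.
  rewrite uE; have [K0|K0] := eqVneq (K x0 x0) 0.
    by rewrite (psd_zero_diag Kp y K0) (psd_zero_diag Kp x0 K0) !mul0r.
  by rewrite mulrC mulrA mulVf// mul1r.
exists (u :: map kill vs) => x y.
rewrite !inE big_cons big_map /kill.
have [-> _ _|xx0] /= := eqVneq x x0.
  by rewrite big1 ?addr0// => v _; rewrite mul0r.
have [-> _ _|yx0] /= := eqVneq y x0.
  by rewrite big1 ?addr0 => [|v _]; rewrite ?mulr0// Kp.1 row0 mulrC.
by move=> xs ys; rewrite -vsE// uE addrC subrK.
Qed.

(** Schur product theorem: for a Gram factor [v] of [M], the form of the product is the form of [K]
    at the weights [w x * v x], and these forms are summed over [v]. *)
Lemma psdM (T : choiceType) (K M : T -> T -> R) :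
  psd K -> psd M -> psd (fun x y => K x y * M x y).
Proof.
move=> Kp Mp; split=> [x y|S w]; first by rewrite Kp.1 Mp.1.
have [vs vsE] := psd_gram (S : seq T) Mp.
have -> : \sum_(x <- S) \sum_(y <- S) w x * w y * (K x y * M x y) =
    \sum_(v <- vs) \sum_(x <- S) \sum_(y <- S) (w x * v x) * (w y * v y) * K x y.
  rewrite [RHS]exchange_big/=; apply: eq_big_seq => x xS.
  rewrite [RHS]exchange_big/=; apply: eq_big_seq => y yS.
  rewrite vsE// mulrA mulr_sumr; apply: eq_bigr => v _.
  lra.
by apply: sumr_ge0 => v _; exact: (Kp.2 S (fun x => w x * v x)).
Qed.

Lemma psd_prod (T : choiceType) (I : eqType) (r : seq I) (K : I -> T -> T -> R) :
  (forall i, i \in r -> psd (K i)) -> psd (fun x y => \prod_(i <- r) K i x y).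
Proof.
elim: r => [|i r IH] Kp.
  have := @psd_rank1 T (fun=> 1); congr psd.
  by apply/funext => x; apply/funext => y; rewrite big_nil mulr1.
have -> : (fun x y => \prod_(j <- i :: r) K j x y) =
    (fun x y => K i x y * \prod_(j <- r) K j x y).
  by apply/funext => x; apply/funext => y; rewrite big_cons.
apply: psdM; first by apply: Kp; rewrite inE eqxx.
by apply: IH => j jr; apply: Kp; rewrite inE jr orbT.
Qed.

(* With [a0] the least positive value of [a], [min (a x) (a y)] is [a0] on the
   support of [a] plus the minimum of the positive parts of [a - a0], whose
   support is smaller. *)
Lemma psd_min (T : choiceType) (K : T -> T -> R) (a : T -> R) :
  psd K -> (forall x, 0 <= a x) -> psd (fun x y => K x y * Num.min (a x) (a y)).
Proof.
move=> Kp a0; split=> [x y|S w]; first by rewrite Kp.1 minC.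
have [m] := ubnP (count (fun x => 0 < a x) S).
elim: m => // m IH in a a0 *; rewrite ltnS => am.
have [pos|] := boolP (has (fun x => 0 < a x) S); last first.
  rewrite -all_predC => /allP neg.
  have az x : x \in (S : seq T) -> a x = 0.
    by move=> /neg /=; rewrite -leNgt => ax; apply/le_anti; rewrite ax a0.
  rewrite big_seq big1// => x xS; rewrite big_seq big1// => y yS.
  by rewrite !az// minxx !mulr0.
have [x0 x0S /andP[ax0 x0min]] : exists2 x0, x0 \in (S : seq T) &
    (0 < a x0) && all (fun x => (0 < a x) ==> (a x0 <= a x)) S.
  elim: (S : seq T) pos => // x s IHs /= /orP.
  have [/IHs[y ys /andP[ay ymin]] _|nos] := boolP (has (fun x => 0 < a x) s).
    have [xy|yx] := boolP ((0 < a x) && (a x <= a y)).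
      exists x; rewrite ?mem_head//; have /andP[-> xy'] := xy; rewrite /= lexx ?implybT/=.
      apply/allP => z zs; apply/implyP => az.
      have /allP/(_ z zs)/implyP/(_ az) := ymin; exact: le_trans.
    exists y; first by rewrite inE ys orbT.
    rewrite ay ymin andbT /=; apply/implyP => ax.
    by move: yx; rewrite ax/= -ltNge => /ltW.
  move=> [ax|//]; exists x; rewrite ?mem_head// ax lexx ?implybT/=.
  apply/allP => z zs; apply/implyP => az.
  by move/hasPn : nos => /(_ z zs); rewrite az.
pose b x : R := Num.max (a x - a x0) 0.
pose p x : R := (0 < a x)%R%:R.
have b0 x : 0 <= b x by rewrite le_max lexx orbT.
have mE x y : x \in (S : seq T) -> y \in (S : seq T) ->
    Num.min (a x) (a y) = a x0 * (p x * p y) + Num.min (b x) (b y).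
  move=> /(allP x0min)/implyP ax /(allP x0min)/implyP ay; rewrite /p /b.
  have [x0p|x0p] := ltP 0 (a x); last first.
    have -> : a x = 0 by apply/le_anti; rewrite x0p a0.
    rewrite mul0r mulr0 add0r sub0r max_r ?oppr_le0 1?ltW//.
    by rewrite !min_l// le_max lexx orbT.
  have [y0p|y0p] := ltP 0 (a y); last first.
    have -> : a y = 0 by apply/le_anti; rewrite y0p a0.
    have -> : Num.max (0 - a x0) 0 = 0 by rewrite sub0r max_r ?oppr_le0 1?ltW.
    rewrite !mulr0 add0r.
    by rewrite !min_r// le_max lexx orbT.
  have {}ax := ax x0p; have {}ay := ay y0p.
  rewrite !max_l ?subr_ge0// !mulr1.
  by case: (leP (a x) (a y)) => h; [rewrite min_l|rewrite min_r]; lra.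
have -> : \sum_(x <- S) \sum_(y <- S) w x * w y * (K x y * Num.min (a x) (a y)) =
    a x0 * (\sum_(x <- S) \sum_(y <- S) (w x * p x) * (w y * p y) * K x y) +
    \sum_(x <- S) \sum_(y <- S) w x * w y * (K x y * Num.min (b x) (b y)).
  rewrite mulr_sumr -big_split/=; apply: eq_big_seq => x xS.
  rewrite mulr_sumr -big_split/=; apply: eq_big_seq => y yS.
  by rewrite mE//; lra.
apply: addr_ge0; first by apply: mulr_ge0; [exact: ltW|exact: (Kp.2 S (fun x => w x * p x))].
apply: IH => //; apply: leq_trans am.
have bp x : 0 < b x -> 0 < a x.
  rewrite /b lt_max ltxx orbF subr_gt0; exact: lt_trans.
have sub : count (fun x => 0 < b x) S = count (predI (fun x => 0 < b x) (fun x => 0 < a x)) S.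
  by apply: eq_count => x /=; case: (ltP 0 (b x)) => // /bp ->.
(* The point [x0] is counted for [a] but not for [b], as [b x0] is 0; hence the count drops. *)
have pc := permP (perm_to_rem x0S); rewrite sub !pc/=.
rewrite ax0 {1}/b subrr maxxx ltxx /= add0n add1n ltnS.
by apply: sub_count => x /= /andP[].
Qed.

End psd_theory.

(** * Feasible measures of the finite problem *)

(** The pairs J, J' with union [S] are indexed by pairs of subsets of a set [s] that [h] maps
    bijectively onto [S]. Keeping [s] and changing [h] compares [A_op] at [S] and at a collapsed,
    perturbed or translated copy of [S] term by term. *)
Lemma A_opE (R : realType) (n t : nat) (C : set 'rV[R]_n) (P : choiceType)
    (f : ind C t -> ind C t -> R) (S : ind C (2 * t)) (s : {fset P})
    (h : P -> 'rV[R]_n) :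
  {in s &, injective h} -> pts S = [fset h x | x in s]%fset ->
  A_op f S = \sum_(j <- fpowerset s) \sum_(j' <- fpowerset s)
    if [&& #|` j| <= t, #|` j'| <= t & (j `|` j')%fset == s]%N
    then f (mkind C t [fset h x | x in j]%fset)
           (mkind C t [fset h x | x in j']%fset) else 0.
Proof.
move=> hi Ss; pose hs j := [fset h x | x in (j : {fset P})]%fset.
pose g (p : {fset P} * {fset P}) := (mkind C t (hs p.1), mkind C t (hs p.2)).
pose c (p : {fset P} * {fset P}) :=
  [&& #|` p.1| <= t, #|` p.2| <= t & (p.1 `|` p.2)%fset == s]%N.
pose r := [seq p <- [seq (j, j') | j <- fpowerset s, j' <- fpowerset s] | c p].
have -> : \sum_(j <- fpowerset s) \sum_(j' <- fpowerset s)
    (if [&& #|` j| <= t, #|` j'| <= t & (j `|` j')%fset == s]%N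
    then f (mkind C t (hs j)) (mkind C t (hs j')) else 0) =
    \sum_(p <- r) f (g p).1 (g p).2.
  by rewrite /r big_filter [RHS]big_mkcond big_allpairs_dep.
have ur : uniq r.
  by apply: filter_uniq; apply: allpairs_uniq; [exact: fset_uniq..|move=> [? ?] [? ?]].
have rP p : p \in r -> [/\ (p.1 `<=` s)%fset, (p.2 `<=` s)%fset,
    (#|` p.1| <= t)%N, (#|` p.2| <= t)%N & (p.1 `|` p.2)%fset = s].
  rewrite mem_filter => /andP[/and3P[p1 p2 /eqP ps]] /allpairsP[[j j'] /=].
  by rewrite !fpowersetE => -[j1 j2 E]; subst p.
have hsub j : (j `<=` s)%fset -> (#|` j| <= t)%N -> indep_sets C t (hs j).
  move=> js jt; have [SC Si _] := indP S.
  have hjS x : x \in hs j -> x \in pts S.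
    by move=> /imfsetP[y /= yj ->]; rewrite Ss; apply: in_imfset; exact: (fsubsetP js).
  split=> [x /hjS|x y /hjS + /hjS|]; [exact: SC|exact: Si|].
  by rewrite (leq_trans (leq_imfset_card _ _ _)).
have card_hs j : (j `<=` s)%fset -> #|` hs j| = #|` j|.
  move=> js; rewrite card_in_imfset//= => x y xj yj.
  by apply: hi; exact: (fsubsetP js).
have hs_inj j j' : (j `<=` s)%fset -> (j' `<=` s)%fset -> hs j = hs j' -> j = j'.
  suff sub k k' : (k `<=` s)%fset -> (k' `<=` s)%fset -> hs k = hs k' -> (k `<=` k')%fset.
    by move=> js js' E; apply/eqP; rewrite eqEfsubset (sub j j')// (sub j' j).
  move=> ks ks' E; apply/fsubsetP => x xk.
  have : h x \in hs k' by rewrite -E; exact: in_imfset.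
  move=> /imfsetP[y /= yk' hxy]; rewrite (hi x y)//; [exact: (fsubsetP ks)|exact: (fsubsetP ks')].
rewrite fsbig_seq// /A_op; apply: (@reindex_fsbig _ _ _ _ _ g).
split.
- move=> p /= /rP[p1 p2 c1 c2 ps] /=.
  by rewrite !pts_mkind; [|exact: hsub..]; rewrite -imfsetU ps Ss.
- move=> p q /set_mem/= /rP[p1 p2 c1 c2 ps] /set_mem/= /rP[q1 q2 d1 d2 qs].
  move=> [] /(congr1 (@pts _ _ _ _)) + /(congr1 (@pts _ _ _ _)).
  rewrite !pts_mkind; [|exact: hsub..].
  move=> /hs_inj E1 /hs_inj E2.
  by rewrite [p]surjective_pairing [q]surjective_pairing E1// E2.
- move=> [J J'] /= JJ'.
  (* Surjectivity: subsets of [S] are recovered from their preimages under [h]. *)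
  pose pre (X : {fset 'rV[R]_n}) := [fset x in s | h x \in X]%fset.
  have preK (X : ind C t) : (pts X `<=` pts S)%fset -> hs (pre (pts X)) = pts X.
    move=> XS; apply/fsetP => y; apply/imfsetP/idP => /= [[x]|yX].
      by rewrite !inE => /andP[_ hX] ->.
    have := fsubsetP XS _ yX; rewrite Ss => /imfsetP[x /= xs yx].
    by exists x => //; rewrite !inE xs -yx.
  have pres X : (pre X `<=` s)%fset by apply/fsubsetP => x; rewrite !inE => /andP[].
  have [JS J'S] : (pts J `<=` pts S)%fset /\ (pts J' `<=` pts S)%fset.
    by rewrite -JJ' fsubsetUl fsubsetUr.
  exists (pre (pts J), pre (pts J')); last by rewrite /g /= !preK// !mkindK.
  rewrite /= mem_filter /c /=; apply/andP; split.
    rewrite -(card_hs _ (pres (pts J))) -(card_hs _ (pres (pts J'))) !preK//.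
    have [_ _ ->] := indP J; have [_ _ ->] := indP J' => /=.
    apply/eqP/hs_inj => //; first by rewrite fsubUset !pres.
    have hsU k k' : hs (k `|` k')%fset = (hs k `|` hs k')%fset by exact: imfsetU.
    by rewrite hsU !preK// JJ' Ss.
  by apply/allpairsP; exists (pre (pts J), pre (pts J')); rewrite !fpowersetE !pres.
Qed.

Section finite_packings.
Variables (R : realType) (n : nat) (FF : {fset 'rV[R]_n}).
Local Notation V := 'rV[R]_n.
Local Notation C := [set` FF].
Local Open Scope ereal_scope.

Lemma ind_finite_measurable m (A : set (borel (ind C m))) : measurable A.
Proof.
apply: sub_sigma_algebra; apply: finite_ind_open; exact: finite_fset.
Qed.

Definition fiber m (X : {fset V}) : set (borel (ind C m)) :=
  [set S | pts (S : ind C m) = X].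

Lemma pts_fpowerset m (S : ind C m) : pts S \in fpowerset FF.
Proof. by rewrite fpowersetE; apply/fsubsetP => x; have [+ _ _] := indP S; apply. Qed.

Lemma fun_fiber m (f : ind C m -> R) S :
  f S = (\sum_(X <- fpowerset FF) f (mkind C m X) * \1_(fiber X) S)%R.
Proof.
rewrite (bigD1_seq (pts S)) ?fset_uniq ?pts_fpowerset//= mkindK indicE mem_set//.
rewrite mulr1 big1 ?addr0// => X XS; rewrite indicE memNset ?mulr0// => SX.
by move: XS; rewrite -(SX : pts S = X) eqxx.
Qed.

Lemma integral_ind_finite m (lam : {finite_measure set (borel (ind C m)) -> \bar R})
    (f : ind C m -> R) :
  \int[lam]_S (f S)%:E =
  (\sum_(X <- fpowerset FF) fine (lam (fiber X)) * f (mkind C m X))%R%:E.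
Proof.
have iX X : lam.-integrable setT (fun S => (\1_(@fiber m X) S)%:E).
  by apply: integrable_indic; exact: ind_finite_measurable.
under eq_integral do rewrite fun_fiber -sumEFin.
rewrite integral_sum//; last first.
  by move=> X; apply: (integrableZl measurableT (f (mkind C m X)) (iX X)).
rewrite -sumEFin; apply: eq_bigr => X _.
under eq_integral do rewrite EFinM.
rewrite (integralZl measurableT (iX X)).
rewrite integral_indic ?setIT; [|exact: measurableT|exact: ind_finite_measurable].
by rewrite EFinM fineK 1?muleC//; exact: fin_num_measure (ind_finite_measurable _).
Qed.

(* The values on points of the feasible measures of [las_finite]. *)
Definition weights t (l : {fset V} -> R) := [/\ forall X, (0 <= l X)%R,
  forall X, l X != 0%R -> indep_sets C (2 * t) X, l fset0 = 1%R &
  forall K : ind C t -> ind C t -> R, psd K ->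
    (0 <= \sum_(X <- fpowerset FF) l X * A_op K (mkind C (2 * t) X))%R].

Lemma sum_card1 (l : {fset V} -> R) :
  (\sum_(X <- fpowerset FF) l X * (#|` X| == 1%N)%:R =
   \sum_(x <- FF) l [fset x]%fset)%R.
Proof.
rewrite (eq_bigr (fun X => if #|` X| == 1%N then l X else 0%R)); last first.
  by move=> X _; case: ifP; rewrite ?mulr1 ?mulr0.
rewrite -big_mkcond/= -big_filter -(big_map (fun x => [fset x]%fset) xpredT l).
rewrite (perm_big [seq [fset x]%fset | x <- FF])//; apply: uniq_perm.
- by apply: filter_uniq; exact: fset_uniq.
- by rewrite map_inj_uniq ?fset_uniq//; exact: fset1_inj.
move=> X; rewrite mem_filter fpowersetE; apply/andP/mapP => [[/cardfs1P[x ->] xF]|[x xF ->]].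
  by exists x => //; rewrite -fsub1set.
by rewrite cardfs1 fsub1set.
Qed.

(** On a finite discrete space integrals are finite sums over point masses. A set that is not
    independent has an empty fiber, hence mass 0. *)
Lemma finite_weights t (lam : {finite_measure set (borel (ind C (2 * t))) -> \bar R}) :
  lam [set ind0 C (2 * t)] = 1 ->
  (forall K : ind C t -> ind C t -> R, psd K -> 0 <= \int[lam]_S (A_op K S)%:E) ->
  exists2 l, weights t l &
    lam (@ind_card R n C (2 * t) 1) = (\sum_(x <- FF) l [fset x]%fset)%R%:E.
Proof.
move=> lam0 lamp; pose l X := fine (lam (@fiber (2 * t) X)).
have lI X : l X != 0%R -> indep_sets C (2 * t) X.
  apply: contra_neqP => nX; rewrite /l (_ : fiber X = set0) ?measure0//.
  by apply/seteqP; split=> // S /= SX; apply: nX; rewrite -SX; exact: indP.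
exists l.
  split=> [X||//|K Kp]; first by rewrite fine_ge0.
  - exact: lI.
  - rewrite /l (_ : fiber fset0 = [set ind0 C (2 * t)]) ?lam0//.
    apply/seteqP; split=> [S /= S0|S /= ->]//; exact: pts_inj.
  - by rewrite -lee_fin -integral_ind_finite; exact: lamp.
have m1 : measurable (@ind_card R n C (2 * t) 1 : set (borel _)).
  exact: ind_finite_measurable.
have -> : lam (@ind_card R n C (2 * t) 1) =
    \int[lam]_S (\1_(@ind_card R n C (2 * t) 1) S)%:E.
  by rewrite integral_indic// setIT.
rewrite integral_ind_finite -sum_card1; congr EFin; apply: eq_bigr => X _.
rewrite -?/(l X); have [->|/lI XI] := eqVneq (l X) 0%R; first by rewrite !mul0r.
congr (_ * _)%R; rewrite indicE; congr (nat_of_bool _)%:R%R; apply/idP/eqP => [/set_mem|X1].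
  by rewrite /ind_card /= pts_mkind.
by apply/mem_set; rewrite /ind_card /= pts_mkind.
Qed.

Section measure_of_weights.
Variables (m : nat) (l : {fset V} -> R).
Hypothesis l0 : forall X, (0 <= l X)%R.

(** A sum of Dirac masses. The default of [mkind] would place the mass of a set that is not
    independent at the empty set; for feasible weights this mass is 0. *)
Definition weight_measure : set (borel (ind C m)) -> \bar R :=
  msum (fun i => mscale (NngNum (l0 (nth fset0 (fpowerset FF) i)))
    (\d_(mkind C m (nth fset0 (fpowerset FF) i) : borel (ind C m))))
    (size (fpowerset FF)).

HB.instance Definition _ := Measure.on weight_measure.

Lemma weight_measureE A :
  weight_measure A = (\sum_(X <- fpowerset FF) l X * \1_A (mkind C m X))%R%:E.
Proof.
rewrite /weight_measure /msum (big_nth fset0) big_mkord -sumEFin.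
by apply: eq_bigr => i _; rewrite EFinM.
Qed.

Let weight_measure_fin : fin_num_fun weight_measure.
Proof. by move=> A _; rewrite weight_measureE. Qed.

HB.instance Definition _ := @Measure_isFinite.Build _ _ _ weight_measure
  weight_measure_fin.

End measure_of_weights.

Lemma weight_measure_fiber m (l : {fset V} -> R) (l0 : forall X, (0 <= l X)%R) X :
  (forall X, l X != 0%R -> indep_sets C m X) ->
  @weight_measure m l l0 (fiber X) = (l X)%:E.
Proof.
move=> lI; rewrite weight_measureE; congr EFin.
have [lX|/lI XI] := eqVneq (l X) 0%R.
  rewrite lX big1// => Y _; have [->|/lI YI] := eqVneq (l Y) 0%R; first by rewrite mul0r.
  rewrite indicE; case: (boolP (_ \in _)) => [/set_mem|_]; last by rewrite mulr0.
  by rewrite /fiber /= pts_mkind// => ->; rewrite lX mul0r.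
have XF : X \in fpowerset FF by rewrite -(pts_mkind XI) pts_fpowerset.
rewrite (bigD1_seq X) ?fset_uniq//= indicE mem_set ?mulr1; last first.
  by rewrite /fiber /= pts_mkind.
rewrite big1 ?addr0// => Y YX; have [->|/lI YI] := eqVneq (l Y) 0%R; first by rewrite mul0r.
rewrite indicE memNset ?mulr0// /fiber /= pts_mkind// => E.
by rewrite E eqxx in YX.
Qed.

Lemma las_finite_ge t (l : {fset V} -> R) : weights t l ->
  (\sum_(x <- FF) l [fset x]%fset)%R%:E <= las_finite t C.
Proof.
move=> [l0 lI l1 lK]; apply: ereal_sup_ubound.
pose lam : {finite_measure set (borel (ind C (2 * t))) -> \bar R} :=
  @weight_measure (2 * t) l l0.
have lamE X : lam (fiber X) = (l X)%:E by exact: weight_measure_fiber.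
exists lam.
  split.
    have -> : [set ind0 C (2 * t)] = fiber fset0.
      apply/seteqP; split=> [S /= ->|S /= S0]//; exact: pts_inj.
    by rewrite lamE l1.
  move=> K Kp; rewrite integral_ind_finite lee_fin.
  under eq_bigr do rewrite lamE/=.
  exact: lK.
rewrite [LHS]weight_measureE -sum_card1; congr EFin; apply: eq_bigr => X _.
have [->|/lI XI] := eqVneq (l X) 0%R; first by rewrite !mul0r.
congr (_ * _)%R; rewrite indicE; congr (nat_of_bool _)%:R%R.
apply/idP/eqP => [/set_mem|X1].
  by rewrite /ind_card /= pts_mkind.
by apply/mem_set; rewrite /ind_card /= pts_mkind.
Qed.

End finite_packings.

(** * Discretization of a measure *)

Section borel_space.
Variables (R : realType) (T : ptopologicalType).
Local Open Scope ereal_scope.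

Lemma continuous_borel (f : T -> R) : continuous f ->
  measurable_fun setT (f : borel T -> R).
Proof.
move=> /continuousP cf; apply: (measurability _ (RGenOpens.measurableE R)).
move=> _ [_ [a [b ->] <-]]; rewrite setTI; apply: sub_sigma_algebra.
by apply: cf; exact: interval_open.
Qed.

Lemma radon_compact (mu : {measure set (borel T) -> \bar R}) (D : set T) :
  radon mu -> compact D -> closed D -> mu D < +oo.
Proof.
move=> [lf _] cD clD; have /choice[U UP] : forall x : T, exists U : set T,
    open_nbhs x U /\ mu U < +oo by move=> x; have [U ? ?] := lf x; exists U.
move: (cD); rewrite compact_cover => /(_ T D U) [x Dx|x Dx|D' D'D Dsub].
- by have [[]] := UP x.
- by exists x => //; have [[]] := UP x.
have mU x : measurable (U x : set (borel T)).
  by apply: sub_sigma_algebra; have [[]] := UP x.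
have mD : measurable (D : set (borel T)).
  rewrite -[D]setCK; apply: measurableC; apply: sub_sigma_algebra.
  by rewrite openC.
apply: (@le_lt_trans _ _ (\sum_(x <- D') mu (U x))); last first.
  by apply: lte_sum_pinfty => x _; have [] := UP x.
have /le_trans -> // : mu D <= mu (\big[setU/set0]_(x <- D') U x).
  apply: le_measure; rewrite ?inE//; first by apply: bigsetU_measurable.
  by rewrite -bigcup_seq.
elim: (D' : seq T) => [|x s IH]; first by rewrite !big_nil measure0.
rewrite !big_cons (le_trans (measureU2 _ _ _))//; first by apply: bigsetU_measurable.
by rewrite leeD2l.
Qed.

End borel_space.

Section min_over_set.
Variables (R : realType) (T : choiceType) (g : T -> R).

(** The initial value 1 caps the minimum and gives weight 1 to the empty set, which keeps the mass
    of the empty set normalized. *)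
Definition fmin (X : {fset T}) : R := \big[Num.min/1]_(x <- X) g x.

Lemma le_fmin u (X : {fset T}) :
  (u <= fmin X) = (u <= 1) && all (fun x => u <= g x) X.
Proof.
rewrite /fmin; elim: (X : seq T) => [|x s IH]; first by rewrite big_nil andbT.
by rewrite big_cons le_min IH /= andbCA.
Qed.

Lemma fmin_le1 (X : {fset T}) : fmin X <= 1.
Proof. by have := le_fmin (fmin X) X; rewrite lexx => /esym/andP[]. Qed.

Lemma fmin0 : fmin fset0 = 1.
Proof. by apply/le_anti; rewrite fmin_le1 le_fmin lexx; apply/allP. Qed.

Lemma fmin_le (X : {fset T}) x : x \in X -> fmin X <= g x.
Proof. by have := le_fmin (fmin X) X; rewrite lexx => /esym/andP[_ /allP]; exact. Qed.

Lemma fminU (X Y : {fset T}) : fmin (X `|` Y)%fset = Num.min (fmin X) (fmin Y).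
Proof.
apply/le_anti; rewrite le_min !le_fmin fmin_le1/= ge_min.
apply/andP; split.
  by apply/andP; split; apply/allP => x xX; apply: fmin_le; rewrite inE xX ?orbT.
rewrite fmin_le1/=; apply/allP => x; rewrite inE => /orP[] /fmin_le h; rewrite ge_min h ?orbT//.
Qed.

Lemma fmin_ge0 (X : {fset T}) : (forall x, 0 <= g x) -> 0 <= fmin X.
Proof. by move=> g0; rewrite le_fmin ler01; apply/allP => x _. Qed.

End min_over_set.

(* [c] collapses each cell to a point of [FF], and [g] vanishes between the
   cells. *)
Section transfer.
Variables (R : realType) (n : nat).
Local Notation V := 'rV[R]_n.
Variables (g : V -> R) (c : V -> V) (FF : {fset V}) (B : set V) (lip : R).
Hypothesis g0 : forall x, 0 <= g x.
Hypothesis lip0 : 0 < lip.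
Hypothesis g_lip : forall x y, `|g x - g y| <= lip * `|x - y|.
Hypothesis c_loc : forall x, 0 < g x ->
  exists2 d : R, 0 < d & forall y, `|y - x| < d -> c y = c x.
Hypothesis c_supp : forall x, 0 < g x -> c x \in FF /\ B x.
Hypothesis c_apart : forall x y, 0 < g x -> 0 < g y -> x != y -> ~~ edge x y ->
  c x != c y /\ ~~ edge (c x) (c y).
Hypothesis cB : compact B.

Local Notation Ind t := (ind [set: V] t).
Local Notation cs X := ([fset c x | x in (X : {fset V})]%fset).

Definition cellw (X Y : {fset V}) : R := if cs Y == X then fmin g Y else 0.

Lemma cellw_ge0 X Y : 0 <= cellw X Y.
Proof. by rewrite /cellw; case: ifP => // _; exact: fmin_ge0. Qed.

Lemma cellw_le X Y : cellw X Y <= fmin g Y.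
Proof. by rewrite /cellw; case: ifP => // _; exact: fmin_ge0. Qed.

Lemma fmin_close m (d : R) (S T : Ind m) : 0 < d -> close d S T ->
  `|fmin g (pts S) - fmin g (pts T)| <= lip * d.
Proof.
move=> d0 [p [TE _ pd]].
have gp x : x \in pts S -> `|g x - g (p x)| <= lip * d.
  move=> xS; rewrite (le_trans (g_lip _ _))// ler_pM2l// distrC ltW//; exact: pd.
have ld0 : 0 <= lip * d by rewrite mulr_ge0// ltW.
have h1 : fmin g (pts T) - lip * d <= fmin g (pts S).
  rewrite le_fmin; apply/andP; split; first by have := fmin_le1 g (pts T); lra.
  apply/allP => x xS; have pT : p x \in pts T by rewrite TE; exact: in_imfset.
  have := gp x xS; rewrite ler_norml => /andP[h _].
  by have := fmin_le g pT; lra.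
have h2 : fmin g (pts S) - lip * d <= fmin g (pts T).
  rewrite le_fmin; apply/andP; split; first by have := fmin_le1 g (pts S); lra.
  apply/allP => y; rewrite TE => /imfsetP[x /= xS ->].
  have := gp x xS; rewrite ler_norml => /andP[_ h].
  by have := fmin_le g xS; lra.
by rewrite ler_norml; apply/andP; split; lra.
Qed.

(** Where [fmin g] is positive, all points lie in cells and the collapsed set is locally constant;
    where it is 0, a jump of the collapsed set is invisible, as [cellw] is at most [fmin g], which
    is Lipschitz. *)
Lemma cellw_continuous m X : continuous (fun S : Ind m => cellw X (pts S)).
Proof.
apply: continuous_close => S e e0.
have el0 : 0 < e / lip / 2 by rewrite !divr_gt0.
have lel : lip * (e / lip / 2) < e.
  by rewrite mulrA [lip * _]mulrC divfK ?gt_eqF//; lra.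
have [S0|S0] := ltP 0 (fmin g (pts S)).
  have [|x xS|d d0 dP] := @seq_uniform R _ (pts S)
      (fun x d => forall y, `|y - x| < d -> c y = c x).
  - by move=> x d d' dd' dA y yx; apply: dA; exact: lt_le_trans dd'.
  - by apply: c_loc; exact: lt_le_trans (fmin_le g xS).
  exists (Num.min d (e / lip / 2)); first by rewrite lt_min d0.
  move=> T ST; have cT : cs (pts T) = cs (pts S).
    have [p [TE _ pd]] := ST; rewrite TE -imfset_comp; apply: eq_in_imfset => x xS /=.
    by apply: (dP x xS); rewrite (lt_le_trans (pd _ xS))// ge_min lexx.
  rewrite /cellw cT; case: ifP => _; last by rewrite subrr normr0.
  apply: le_lt_trans lel; apply: le_trans (fmin_close _ ST) _.
    by rewrite lt_min d0.
  by rewrite ler_pM2l// ge_min lexx orbT.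
have {}S0 : fmin g (pts S) = 0 by apply/le_anti; rewrite S0 fmin_ge0.
exists (e / lip / 2) => // T ST.
have -> : cellw X (pts S) = 0 by rewrite /cellw S0; case: ifP.
rewrite sub0r normrN ger0_norm ?cellw_ge0//.
apply: le_lt_trans (cellw_le _ _) _; have := fmin_close el0 ST.
by rewrite S0 sub0r normrN ger0_norm ?fmin_ge0// => /le_lt_trans; exact.
Qed.

Lemma cellw_gt0 X Y : 0 < cellw X Y -> X = cs Y /\ 0 < fmin g Y.
Proof. by rewrite /cellw; case: eqP => [<-//|_]; rewrite ltxx. Qed.

Lemma cell_inj m (S : Ind m) : 0 < fmin g (pts S) -> {in pts S &, injective c}.
Proof.
move=> S0 x y xS yS; apply: contra_eq => xy.
have gx z : z \in pts S -> 0 < g z by move=> /(fmin_le g); exact: lt_le_trans.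
have E : ~~ edge x y by have [_ + _] := indP S; apply.
by have [] := c_apart (gx _ xS) (gx _ yS) xy E.
Qed.

Lemma cell_indep m (S : Ind m) : 0 < fmin g (pts S) ->
  indep_sets [set` FF] m (cs (pts S)).
Proof.
move=> S0; have gx x : x \in pts S -> 0 < g x.
  by move=> /(fmin_le g); exact: lt_le_trans.
split.
- by move=> _ /= /imfsetP[x /= xS ->]; have [] := c_supp (gx _ xS).
- move=> _ _ /imfsetP[x /= xS ->] /imfsetP[y /= yS ->].
  have [->|xy] := eqVneq x y; first by rewrite edgeE eqxx.
  have E : ~~ edge x y by have [_ + _] := indP S; apply.
  by have [] := c_apart (gx _ xS) (gx _ yS) xy E.
- by rewrite (leq_trans (leq_imfset_card _ _ _))//=; have [] := indP S.
Qed.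

Lemma fmin_supp m (S : Ind m) : 0 < fmin g (pts S) -> [set` pts S] `<=` B.
Proof.
move=> S0 x /= xS; have [] // := @c_supp x.
exact: lt_le_trans (fmin_le g xS).
Qed.

Section kernel.
Variables (t : nat) (K : ind [set` FF] t -> ind [set` FF] t -> R).
Hypothesis Kp : psd K.

Local Notation mk t := (mkind [set` FF] t).

Definition pullback (J J' : Ind t) : R :=
  K (mk t (cs (pts J))) (mk t (cs (pts J'))) *
  Num.min (fmin g (pts J)) (fmin g (pts J')).

Lemma pullback_psd : psd pullback.
Proof.
apply: (psd_min (psd_comp (fun J : Ind t => mk t (cs (pts J))) Kp)) => J.
exact: fmin_ge0.
Qed.

Lemma cell_fpowerset m (S : Ind m) : 0 < fmin g (pts S) ->
  cs (pts S) \in fpowerset FF.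
Proof.
move=> S0; rewrite fpowersetE; apply/fsubsetP => x.
by have [+ _ _] := cell_indep S0; apply.
Qed.

Lemma sum_cellw m (S : Ind m) (f : {fset V} -> R) :
  \sum_(X <- fpowerset FF) f X * cellw X (pts S) =
  f (cs (pts S)) * fmin g (pts S).
Proof.
have [S0|S0] := ltP 0 (fmin g (pts S)); last first.
  have {}S0 : fmin g (pts S) = 0 by apply/le_anti; rewrite S0 fmin_ge0.
  by rewrite S0 mulr0 big1// => X _; rewrite /cellw S0; case: ifP; rewrite mulr0.
rewrite (bigD1_seq (cs (pts S))) ?fset_uniq ?cell_fpowerset//= {1}/cellw eqxx.
rewrite big1 ?addr0// => X XS.
by rewrite /cellw eq_sym (negbTE XS) mulr0.
Qed.

(** Only the term of the two collapsed sets survives. The expansion is a finite sum of constants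
    times minima of continuous functions, which gives continuity although collapsing itself
    jumps. *)
Lemma pullbackE (J J' : Ind t) : pullback J J' =
  \sum_(X <- fpowerset FF) \sum_(X' <- fpowerset FF)
    K (mk t X) (mk t X') * Num.min (cellw X (pts J)) (cellw X' (pts J')).
Proof.
have minE X : \sum_(X' <- fpowerset FF)
    K (mk t X) (mk t X') * Num.min (cellw X (pts J)) (cellw X' (pts J')) =
    K (mk t X) (mk t (cs (pts J'))) * Num.min (cellw X (pts J)) (fmin g (pts J')).
  have [S0|S0] := ltP 0 (fmin g (pts J')); last first.
    have {}S0 : fmin g (pts J') = 0 by apply/le_anti; rewrite S0 fmin_ge0.
    rewrite S0 [Num.min _ 0]min_r ?cellw_ge0// mulr0 big1// => X' _.
    rewrite [cellw X' _](_ : _ = 0) ?min_r ?cellw_ge0 ?mulr0//.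
    by rewrite /cellw S0; case: ifP.
  rewrite (bigD1_seq (cs (pts J'))) ?fset_uniq ?cell_fpowerset//=.
  rewrite {2}/cellw eqxx big1 ?addr0// => X' XS.
  by rewrite {2}/cellw eq_sym (negbTE XS) min_r ?cellw_ge0// mulr0.
under eq_bigr do rewrite minE.
rewrite /pullback; have [S0|S0] := ltP 0 (fmin g (pts J)); last first.
  have {}S0 : fmin g (pts J) = 0 by apply/le_anti; rewrite S0 fmin_ge0.
  rewrite S0 min_l ?fmin_ge0// mulr0 big1// => X' _.
  rewrite [cellw X' _](_ : _ = 0) ?min_l ?fmin_ge0 ?mulr0//.
  by rewrite /cellw S0; case: ifP.
rewrite (bigD1_seq (cs (pts J))) ?fset_uniq ?cell_fpowerset//=.
rewrite {1}/cellw eqxx big1 ?addr0// => X' XS.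
by rewrite /cellw eq_sym (negbTE XS) min_l ?fmin_ge0// mulr0.
Qed.

Lemma pullback_continuous : continuous (fun p : Ind t * Ind t => pullback p.1 p.2).
Proof.
have -> : (fun p : Ind t * Ind t => pullback p.1 p.2) = (fun p : Ind t * Ind t =>
    \sum_(X <- fpowerset FF) \sum_(X' <- fpowerset FF)
    K (mk t X) (mk t X') * Num.min (cellw X (pts p.1)) (cellw X' (pts p.2))).
  by apply/funext => p; exact: pullbackE.
apply: continuous_big => [|X _]; first exact: add_continuous.
apply: continuous_big => [|X' _]; first exact: add_continuous.
move=> p; have Fp : Filter (nbhs p) by apply: nbhs_filter.
apply: (@cvgM _ _ (nbhs p) Fp); first exact: cvg_cst.
apply: (@continuous_min _ _ (fun p : Ind t * Ind t => cellw X (pts p.1))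
  (fun p : Ind t * Ind t => cellw X' (pts p.2))).
  apply: (@continuous_comp _ _ _ fst (fun S : Ind t => cellw X (pts S))).
    exact: cvg_fst.
  exact: cellw_continuous.
apply: (@continuous_comp _ _ _ snd (fun S : Ind t => cellw X' (pts S))).
  exact: cvg_snd.
exact: cellw_continuous.
Qed.

(** A nonzero value forces both sets into the compact set [B], and the subsets of [B] form a compact
    closed set. *)
Lemma pullback_supported : compactly_supported (fun p : Ind t * Ind t => pullback p.1 p.2).
Proof.
have clB : closed B by apply: compact_closed => //; exact: norm_hausdorff.
pose D : set (Ind t) := [set S | [set` pts S] `<=` B].
have cD : compact (D `*` D) by apply: compact_setX; exact: compact_subpts.
have clD : closed (D `*` D).
  have -> : D `*` D = fst @^-1` D `&` snd @^-1` D by [].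
  apply: closedI; apply: preimage_closed; try exact: closed_subpts.
    by move=> p _; exact: cvg_fst.
  by move=> p _; exact: cvg_snd.
apply: (subclosed_compact (@closed_closure _ _) cD).
apply: subset_trans _ (_ : closure (D `*` D) `<=` _);
  last by rewrite closure_id in clD; rewrite -clD.
apply: closure_subset => -[J J'] /= /eqP pJ.
have [m0|m0] := ltP 0 (Num.min (fmin g (pts J)) (fmin g (pts J'))).
  by move: m0; rewrite lt_min => /andP[J0 J'0]; split; exact: fmin_supp.
case: pJ; rewrite /pullback [Num.min _ _](_ : _ = 0) ?mulr0//.
by apply/le_anti; rewrite m0 le_min !fmin_ge0.
Qed.

(** If J and J' have union [S], the minimum of their weights is [fmin g] of [S] by [fminU], a common
    factor. Where it is positive, [c] is injective on [S], so the pairs with union [S] match the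
    pairs with union the collapse of [S]. *)
Lemma A_op_pullback (S : Ind (2 * t)) :
  A_op pullback S =
  \sum_(X <- fpowerset FF) A_op K (mk (2 * t) X) * cellw X (pts S).
Proof.
rewrite (sum_cellw S (fun X => A_op K (mk (2 * t) X))).
rewrite (@A_opE _ _ _ _ _ _ _ (pts S) id); [|by []|by rewrite imfset_id].
have E (j j' : {fset V}) : (#|` j| <= t)%N -> (#|` j'| <= t)%N ->
    (j `|` j')%fset = pts S ->
    pullback (mkind _ t [fset x | x in j]%fset) (mkind _ t [fset x | x in j']%fset) =
    K (mk t (cs j)) (mk t (cs j')) * fmin g (pts S).
  move=> jt j't jS; rewrite /pullback !imfset_id.
  have ind k : (k `<=` pts S)%fset -> (#|` k| <= t)%N -> indep_sets [set: V] t k.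
    move=> kS kt; split=> // x y xk yk; have [_ + _] := indP S.
    by apply; apply: (fsubsetP kS).
  rewrite !pts_mkind ?fminU -?jS ?fminU//; apply: ind => //; rewrite -jS.
    exact: fsubsetUr.
  exact: fsubsetUl.
have [S0|S0] := ltP 0 (fmin g (pts S)); last first.
  have {}S0 : fmin g (pts S) = 0 by apply/le_anti; rewrite S0 fmin_ge0.
  rewrite S0 mulr0 big1// => j _; rewrite big1// => j' _.
  by case: ifP => // /and3P[jt j't /eqP jS]; rewrite E// S0 mulr0.
rewrite (@A_opE _ _ _ _ _ K (mk (2 * t) (cs (pts S))) (pts S) c); last 2 first.
- exact: cell_inj.
- by rewrite pts_mkind//; exact: cell_indep.
rewrite mulr_suml; apply: eq_bigr => j _; rewrite mulr_suml; apply: eq_bigr => j' _.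
case: ifP => [/and3P[jt j't /eqP jS]|_]; last by rewrite mul0r.
exact: E.
Qed.

End kernel.

Section moment.
Variables (t : nat) (mu : {measure set (borel (Ind (2 * t))) -> \bar R}).
Hypothesis mu_radon : radon mu.
Local Open Scope ereal_scope.

(** It is dominated by the indicator of the sets contained in [B], a compact set, whose measure is
    finite by local finiteness of [mu]. *)
Lemma cellw_integrable X :
  mu.-integrable setT (fun S : borel (Ind (2 * t)) => (cellw X (pts (S : Ind _)))%:E).
Proof.
have mw : measurable_fun setT
    (fun S : borel (Ind (2 * t)) => (cellw X (pts (S : Ind (2 * t))))%:E).
  by apply/measurable_EFinP; apply: continuous_borel; exact: cellw_continuous.
pose D : set (Ind (2 * t)) := [set S | [set` pts S] `<=` B].
have clD : closed D.
  by apply: closed_subpts; apply: compact_closed => //; exact: norm_hausdorff.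
have mD : measurable (D : set (borel (Ind (2 * t)))).
  by rewrite -[D]setCK; apply: measurableC; apply: sub_sigma_algebra; rewrite openC.
have muD : mu D < +oo by apply: radon_compact => //; exact: compact_subpts.
apply: (@le_integrable _ _ _ mu setT measurableT _
  (fun S : borel (Ind (2 * t)) => (\1_D S)%:E)) => //.
  move=> S _; rewrite !gee0_abs ?lee_fin ?cellw_ge0 ?indicE//.
  have [S0|S0] := ltP 0%R (fmin g (pts (S : Ind (2 * t)))).
    rewrite mem_set; last exact: fmin_supp.
    exact: le_trans (cellw_le _ _) (fmin_le1 _ _).
  by rewrite (le_trans (cellw_le _ _))// (le_trans S0).
apply/integrableP; split; first by apply/measurable_EFinP; exact: measurable_indic.
rewrite (eq_integral (fun S : borel (Ind (2 * t)) => (\1_D S)%:E)); last first.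
  by move=> S _; rewrite gee0_abs// lee_fin indicE.
by rewrite integral_indic// setIT.
Qed.

Definition moment X : R :=
  fine (\int[mu]_S (cellw X (pts (S : Ind (2 * t))))%:E).

Lemma momentE X : \int[mu]_S (cellw X (pts (S : Ind (2 * t))))%:E = (moment X)%:E.
Proof. by rewrite /moment fineK//; apply: integrable_fin_num => //; exact: cellw_integrable. Qed.

(** Pairing [K] with the moments equals integrating [A_op] of its pullback against [mu], by
    [A_op_pullback]; the pullback is an admissible test kernel. *)
Lemma moment_weights : mu [set ind0 [set: V] (2 * t)] = 1 -> adjoint_psd mu ->
  weights FF t moment.
Proof.
move=> mu0 mup; split.
- move=> X; rewrite -lee_fin -momentE; apply: integral_ge0 => S _.
  by rewrite lee_fin cellw_ge0.
- move=> X; apply: contra_neqP => nX; rewrite /moment.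
  rewrite (eq_integral (fun=> 0)) ?integral0// => S _; congr EFin.
  apply/eqP; rewrite eq_le cellw_ge0 andbT leNgt; apply/negP => /cellw_gt0[XS S0].
  by apply: nX; rewrite XS; exact: cell_indep.
(* For the empty set [cellw] is the indicator of the empty configuration, since a nonempty set has a
   nonempty collapse and [fmin] of the empty set is 1. *)
- apply/EFin_inj; rewrite -momentE -mu0.
  have m0 : measurable ([set ind0 [set: V] (2 * t)] : set (borel (Ind (2 * t)))).
    apply: sub_sigma_algebra.
    have := @open_card R n [set: V] (2 * t) (fun k => k = 0%N); congr open.
    apply/seteqP; split=> [S /= /eqP|S /= ->]; last by rewrite cardfs0.
    by rewrite cardfs_eq0 => /eqP S0; apply: pts_inj.
  rewrite -[in RHS](setIT [set _]) -integral_indic//.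
  apply: eq_integral => S _; congr EFin; rewrite indicE /cellw.
  have [S0|S0] := eqVneq (pts (S : Ind (2 * t))) fset0.
    rewrite S0 imfset0 eqxx fmin0 mem_set//; exact: pts_inj.
  rewrite memNset; last by move=> S0'; case/eqP: S0; rewrite S0'.
  case: eqP => // cS0; case/negP: S0; apply/eqP/fsetP => x; rewrite in_fset0.
  apply/negP => xS; have : c x \in cs (pts (S : Ind (2 * t))) by exact: in_imfset.
  by rewrite cS0 in_fset0.
- move=> K Kp; rewrite -lee_fin.
  have := mup _ (@pullback_continuous t K) (@pullback_supported t K) (pullback_psd Kp).
  congr (0 <= _); under eq_integral do rewrite A_op_pullback -sumEFin.
  rewrite integral_sum//; last first.
    by move=> X; apply: (integrableZl measurableT _ (cellw_integrable X)).
  rewrite -sumEFin; apply: eq_bigr => X _.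
  under eq_integral do rewrite EFinM.
  by rewrite (integralZl measurableT (cellw_integrable X)) momentE -EFinM mulrC.
Qed.

Definition core p : set V := [set x | c x = p /\ (1 <= g x)%R].

Lemma core_closed p : closed (core p).
Proof.
have gc : continuous g.
  move=> x; have Fx : Filter (nbhs x) by apply: nbhs_filter.
  apply/(@cvgrPdist_lt _ _ _ (nbhs x)) => e e0.
  apply/nbhs_ballP; exists (e / lip)%R.
    by rewrite /= divr_gt0.
  move=> y; rewrite -ball_normE /= => xy; apply: le_lt_trans (g_lip _ _) _.
  by rewrite mulrC -ltr_pdivlMr.
rewrite -openC openE => x /= nx.
have [g1|g1] := leP 1%R (g x).
  have [|d d0 dc] := @c_loc x; first exact: lt_le_trans g1.
  apply/nbhs_ballP; exists d => // y; rewrite -ball_normE /= distrC => xy [cy gy].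
  by apply: nx; split=> //; rewrite -cy dc.
have : nbhs x [set y | (g y < 1)%R].
  apply: (gc x [set z | (z < 1)%R]); apply: open_nbhs_nbhs.
  by split; [exact: open_lt|].
have Fx : Filter (nbhs x) by apply: nbhs_filter.
by apply: (@filterS _ (nbhs x)) => y /= gy [_]; rewrite leNgt gy.
Qed.

(** On the singletons {x} with [x] in [core p] the weight [cellw] attains its full value 1, so the
    moment is at least their measure. *)
Lemma moment_density (rho : R) p : has_density mu rho ->
  rho%:E * lebesgue_rV (core p) <= (moment [fset p]%fset)%:E.
Proof.
move=> hd; rewrite -(hd (core p)); last first.
  rewrite -[core p]setCK -setTD; apply: sigma_algebraCD.
  by apply: sub_sigma_algebra; rewrite openC; exact: core_closed.
set E := [set S | _].
(* Written as an open set intersected with a closed one, the set is visibly measurable. *)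
have EE : E = [set S : Ind (2 * t) | #|` pts S| = 1%N] `&`
    [set S : Ind (2 * t) | (1 <= cellw [fset p]%fset (pts S))%R].
  have c1 x : cs [fset x]%fset = [fset c x]%fset by rewrite imfset_fset1.
  have f1 x : fmin g [fset x]%fset = Num.min (g x) 1%R.
    apply/le_anti; rewrite le_min fmin_le1 fmin_le ?inE//= le_fmin ge_min lexx orbT /=.
    by apply/allP => y; rewrite inE => /eqP ->; rewrite ge_min lexx.
  apply/seteqP; split=> S /=.
    move=> [x [cx gx] ->]; rewrite cardfs1; split=> //.
    by rewrite /cellw c1 cx eqxx f1 min_r.
  move=> [/eqP/cardfs1P[x Sx] w1].
  have /cellw_gt0[pE _] : (0 < cellw [fset p]%fset (pts S))%R by exact: lt_le_trans w1.
  move: w1; rewrite /cellw -pE eqxx Sx f1 => w1; exists x => //; split.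
    by move: pE; rewrite Sx c1 => /fset1_inj.
  by move: w1; rewrite le_min => /andP[].
have mE : measurable (E : set (borel (Ind (2 * t)))).
  rewrite EE; apply: measurableI.
    by apply: sub_sigma_algebra; exact: (@open_card R n [set: V] (2 * t) (fun k => k = 1%N)).
  rewrite -[X in measurable X]setCK; apply: measurableC; apply: sub_sigma_algebra.
  rewrite openC; apply: (@preimage_closed _ _ (fun S : Ind (2 * t) => cellw [fset p]%fset (pts S))
    [set y | (1 <= y)%R]); last exact: closed_ge.
  by move=> S _; exact: cellw_continuous.
rewrite -momentE -[X in mu X]setIT -integral_indic//; apply: ge0_le_integral => //.
- by apply/measurable_EFinP; exact: measurable_indic.
- by apply: measurable_int (cellw_integrable _).
- move=> S _; rewrite lee_fin indicE; have [/set_mem|_] := boolP (S \in E).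
    by rewrite EE => -[].
  exact: cellw_ge0.
Qed.

End moment.

End transfer.

Section lipschitz.
Variable R : realType.

Lemma min_dist (a b c d e : R) : `|a - c| <= e -> `|b - d| <= e ->
  `|Num.min a b - Num.min c d| <= e.
Proof.
rewrite !ler_norml => /andP[h1 h2] /andP[h3 h4].
by case: (leP a b) => ?; case: (leP c d) => ?; lra.
Qed.

Lemma max_dist (a b c d e : R) : `|a - c| <= e -> `|b - d| <= e ->
  `|Num.max a b - Num.max c d| <= e.
Proof.
rewrite !ler_norml => /andP[h1 h2] /andP[h3 h4].
by case: (leP a b) => ?; case: (leP c d) => ?; lra.
Qed.

Lemma bigmin_dist (I : Type) (r : seq I) (f f' : I -> R) (x e : R) : 0 <= e ->
  (forall i, `|f i - f' i| <= e) ->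
  `|\big[Num.min/x]_(i <- r) f i - \big[Num.min/x]_(i <- r) f' i| <= e.
Proof.
move=> e0 ff; elim/big_ind2: _ => //; first by rewrite subrr normr0.
by move=> *; exact: min_dist.
Qed.

Lemma bigmax_dist (I : Type) (r : seq I) (f f' : I -> R) (x e : R) : 0 <= e ->
  (forall i, `|f i - f' i| <= e) ->
  `|\big[Num.max/x]_(i <- r) f i - \big[Num.max/x]_(i <- r) f' i| <= e.
Proof.
move=> e0 ff; elim/big_ind2: _ => //; first by rewrite subrr normr0.
by move=> *; exact: max_dist.
Qed.

Lemma coord_norm n (x : 'rV[R]_n) i : `|x ord0 i| <= `|x|.
Proof.
rewrite [leRHS]/Num.norm /= mx_normrE.
exact: (@le_bigmax _ _ _ 0 (fun ij : 'I_1 * 'I_n => `|x ij.1 ij.2|) (ord0, i)).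
Qed.

End lipschitz.

(** * Grid of cells with bump functions, and the sites in the cube *)

Section grid.
Variables (R : realType) (n m : nat) (L : R).
Hypothesis L0 : 0 < L.
Local Notation N := n.+1.
Local Notation M := m.+1.
Local Notation V := 'rV[R]_N.
Local Notation cell := {ffun 'I_N -> 'I_M}.
Implicit Types (x y : V) (z : cell).

(** The edge length of a cell. The term [L * N] in the denominator makes it smaller than the spacing
    L / M of the sites, while M times it still tends to [L]. *)
Definition side : R := L / (M%:R + L * N%:R).

Lemma den0 : 0 < M%:R + L * N%:R :> R.
Proof. by rewrite ltr_wpDr// mulr_ge0// ltW. Qed.

Lemma side0 : 0 < side.
Proof. by rewrite divr_gt0// den0. Qed.

(** In units of [side], a tent of slope 2M capped at 1: it vanishes outside the open cell and equals
    1 at distance at least 1 / (2M) from the faces. The plateau thus has relative width 1 - 1 / M =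
    m / M in each coordinate. *)
Definition bump z x : R := Num.max 0 (\big[Num.min/1]_(i < N)
  (2 * M%:R * Num.min (x ord0 i / side - (z i)%:R) ((z i)%:R + 1 - x ord0 i / side))).

Definition bumps x : R := \big[Num.max/0]_(z : cell) bump z x.

Definition site z : V := \row_i (L / M%:R * (z i)%:R).

Definition locate x : V := if [pick z | 0 < bump z x] is Some z then site z else 0.

Definition sites : {fset V} := [fset site z | z in {: cell}]%fset.

Definition grid_lip : R := 2 * M%:R / side.

Lemma grid_lip0 : 0 < grid_lip.
Proof. by apply: divr_gt0; [exact: mulr_gt0|exact: side0]. Qed.

Lemma bump_lip z x y : `|bump z x - bump z y| <= grid_lip * `|x - y|.
Proof.
have l0 : 0 <= grid_lip * `|x - y| by rewrite mulr_ge0// ltW// grid_lip0.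
apply: max_dist; first by rewrite subrr normr0.
apply: bigmin_dist => // i; rewrite -mulrBr normrM ger0_norm; last by rewrite mulr_ge0.
rewrite /grid_lip -[leRHS]mulrA ler_wpM2l ?mulr_ge0//.
have h : `|x ord0 i / side - y ord0 i / side| <= side^-1 * `|x - y|.
  rewrite -mulrBl normrM mulrC gtr0_norm ?invr_gt0 ?side0// ler_wpM2l//.
    by rewrite invr_ge0 ltW// side0.
  by have := coord_norm (x - y) i; rewrite !mxE.
have /andP[h1 h2] := etrans (esym (ler_norml _ _)) h.
by apply: min_dist; rewrite ler_norml; apply/andP; split; lra.
Qed.

Lemma bumps_lip x y : `|bumps x - bumps y| <= grid_lip * `|x - y|.
Proof.
apply: bigmax_dist; first by rewrite mulr_ge0// ltW// grid_lip0.
by move=> z; exact: bump_lip.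
Qed.

Lemma bump_gt0 z x : 0 < bump z x ->
  forall i, (z i)%:R < x ord0 i / side < (z i)%:R + 1.
Proof.
rewrite /bump lt_max ltxx/= => /bigmin_gtP[_ h] i.
have := h i isT; rewrite pmulr_rgt0 ?mulr_gt0// lt_min => /andP[h1 h2].
by apply/andP; split; lra.
Qed.

Lemma bump_unique z z' x : 0 < bump z x -> 0 < bump z' x -> z = z'.
Proof.
move=> /bump_gt0 h /bump_gt0 h'; apply/ffunP => i; apply/val_inj/eqP; rewrite eqn_leq.
have lt (u v : nat) : (u%:R < x ord0 i / side < u%:R + 1) ->
    (v%:R < x ord0 i / side < v%:R + 1) -> (u <= v)%N.
  move=> /andP[u1 _] /andP[_ v2]; rewrite -ltnS -(ltr_nat R) -natr1.
  exact: lt_trans v2.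
by apply/andP; split; apply: lt; [exact: h|exact: h'|exact: h'|exact: h].
Qed.

Lemma locateE z x : 0 < bump z x -> locate x = site z.
Proof.
move=> zx; rewrite /locate; case: pickP => [z' z'x|/(_ z)]; last by rewrite zx.
by rewrite (bump_unique z'x zx).
Qed.

Lemma bumps_ge0 x : 0 <= bumps x.
Proof. by rewrite /bumps; elim/big_ind: _ => // [a b a0 _|z _]; rewrite le_max ?a0// lexx. Qed.

Lemma bumps_gt0 x : 0 < bumps x -> exists z, 0 < bump z x.
Proof.
move=> bx; apply/existsP; apply: contraTT bx => /existsPn h.
rewrite -leNgt /bumps; elim/big_ind: _ => // [a b a0 b0|z _]; first by rewrite ge_max a0.
by rewrite leNgt.
Qed.

Lemma bump_le z x : bump z x <= bumps x.
Proof. exact: le_bigmax. Qed.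

Lemma locate_loc x : 0 < bumps x ->
  exists2 d : R, 0 < d & forall y, `|y - x| < d -> locate y = locate x.
Proof.
(* Within this distance the Lipschitz bound keeps the bump of the same cell positive. *)
move=> /bumps_gt0[z zx]; exists (bump z x / grid_lip); first by rewrite divr_gt0// grid_lip0.
move=> y; rewrite ltr_pdivlMr ?grid_lip0// => yx.
rewrite (locateE zx); apply: locateE.
have := bump_lip z y x; rewrite ler_norml => /andP[h _].
by move: yx; rewrite mulrC; lra.
Qed.

Definition region : set V := [set x : V |
  forall i, (0 : V) ord0 i <= x ord0 i <= (const_mx (side * M%:R) : V) ord0 i].

Lemma locate_supp x : 0 < bumps x -> locate x \in sites /\ region x.
Proof.
move=> /bumps_gt0[z zx]; split; first by rewrite (locateE zx); apply: in_imfset; rewrite /= inE.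
move=> i; have /andP[h1 h2] := bump_gt0 zx i; rewrite !mxE; apply/andP; split.
  rewrite -[leRHS](@divfK _ side) ?gt_eqF ?side0//.
  by apply: mulr_ge0; [exact: le_trans (ltW h1)|exact: ltW side0].
rewrite mulrC -ler_pdivrMr ?side0// (le_trans (ltW h2))//.
by rewrite natr1 ler_nat.
Qed.

Lemma site_sqdist z z' : (\sum_(i < N) (site z ord0 i - site z' ord0 i) ^+ 2) =
  (L / M%:R) ^+ 2 * \sum_(i < N) ((z i)%:R - (z' i)%:R) ^+ 2.
Proof.
rewrite mulr_sumr; apply: eq_bigr => i _.
by rewrite !mxE -mulrBr exprMn.
Qed.

(* The sites are spread out by the factor (M + L N) / M relative to the cells,
   which compensates for the diameter of the cells. *)
Lemma locate_apart x y : 0 < bumps x -> 0 < bumps y -> x != y -> ~~ edge x y ->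
  locate x != locate y /\ ~~ edge (locate x) (locate y).
Proof.
move=> /bumps_gt0[z zx] /bumps_gt0[z' zy] xy xyE; apply/edge_apart.
have /edge_apart xy4 : x != y /\ ~~ edge x y by [].
rewrite (locateE zx) (locateE zy) site_sqdist.
pose k (i : 'I_N) : R := `|(z i)%:R - (z' i)%:R|.
pose A := Num.sqrt (\sum_(i < N) k i ^+ 2).
have A0 : 0 <= A by exact: sqrtr_ge0.
have A2 : A ^+ 2 = \sum_(i < N) k i ^+ 2.
  by rewrite sqr_sqrtr// sumr_ge0// => i _; exact: sqr_ge0.
have kA i : k i <= A.
  rewrite -(ger0_norm (normr_ge0 _ : 0 <= k i)) -sqrtr_sqr ler_wsqrtr//.
  by rewrite (bigD1 i)//= lerDl sumr_ge0// => j _; exact: sqr_ge0.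
have -> : \sum_(i < N) ((z i)%:R - (z' i)%:R) ^+ 2 = A ^+ 2.
  by rewrite A2; apply: eq_bigr => i _; rewrite /k real_normK// num_real.
have xk i : (x ord0 i - y ord0 i) ^+ 2 <= side ^+ 2 * (k i + 1) ^+ 2.
  have /andP[a1 a2] := bump_gt0 zx i; have /andP[b1 b2] := bump_gt0 zy i.
  have -> : x ord0 i - y ord0 i = side * (x ord0 i / side - y ord0 i / side).
    by rewrite -mulrBl mulrC divfK// gt_eqF// side0.
  rewrite exprMn ler_wpM2l ?sqr_ge0//.
  rewrite -(real_normK (num_real (_ - _))) ler_pXn2r ?nnegrE ?addr_ge0 ?normr_ge0//.
  have : `|(z i)%:R - (z' i)%:R| <= k i by [].
  by rewrite !ler_norml => /andP[c1 c2]; apply/andP; split; lra.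
(* [A] is the Euclidean norm of the difference of the cell indices. Each coordinate of x - y is at
   most [side * (k i + 1)] in absolute value; then k i <= A and N <= N^2 bound the sum of
   squares. *)
have bound : 4 <= side ^+ 2 * (A + N%:R) ^+ 2.
  apply: le_trans xy4 _; apply: (le_trans (ler_sum _ (fun i _ => xk i))).
  rewrite -mulr_sumr ler_wpM2l ?sqr_ge0//.
  have -> : \sum_(i < N) (k i + 1) ^+ 2 = A ^+ 2 + (\sum_(i < N) k i) *+ 2 + N%:R.
    rewrite A2 -sumrMnl -big_split/= -[X in _ + X](_ : \sum_(i < N) 1 = _); last first.
      by rewrite sumr_const card_ord.
    rewrite -big_split/=; apply: eq_bigr => i _; rewrite sqrrD mulr1 expr1n//.
  have h1 : \sum_(i < N) k i <= N%:R * A.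
    rewrite mulr_natl -[X in A *+ X](card_ord N) -sumr_const.
    by apply: ler_sum => i _; exact: kA.
  have h2 : (N%:R : R) <= N%:R ^+ 2 by rewrite -natrX ler_nat expnS leq_pmulr// expn_gt0.
  by rewrite sqrrD; lra.
have : 2 <= side * (A + N%:R).
  have p0 : 0 <= side * (A + N%:R).
    by apply: mulr_ge0; [exact: ltW side0|exact: addr_ge0].
  rewrite -ler_sqr ?nnegrE// exprMn; apply: le_trans bound.
  by rewrite -natrX.
(* [key] says 2 (M + L N) <= L (A + N), so L A >= 2 M + L N >= 2 M, which is the claim for the
   sites. *)
rewrite /side mulrAC ler_pdivlMr ?den0// => key.
rewrite -exprMn; have -> : (4 : R) = 2 ^+ 2 by rewrite -natrX.
have p1 : 0 <= L / M%:R * A by rewrite mulr_ge0// divr_ge0// ltW.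
rewrite ler_sqr ?nnegrE//.
rewrite mulrAC ler_pdivlMr//.
have LN : 0 <= L * N%:R by rewrite mulr_ge0// ltW.
lra.
Qed.

Lemma core_box z : box (\row_i (side * ((z i)%:R + (2 * M%:R)^-1)))
    (\row_i (side * ((z i)%:R + 1 - (2 * M%:R)^-1))) `<=` core bumps locate (site z).
Proof.
move=> x xz; have bz : 1 <= bump z x.
  rewrite /bump le_max; apply/orP; right; apply/bigmin_geP; split=> // i _.
  have := xz i; rewrite !mxE => /andP[/ltW l1 l2].
  have h1 : (z i)%:R + (2 * M%:R)^-1 <= x ord0 i / side.
    by rewrite ler_pdivlMr ?side0// mulrC.
  have h2 : x ord0 i / side <= (z i)%:R + 1 - (2 * M%:R)^-1.
    by rewrite ler_pdivrMr ?side0// mulrC.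
  rewrite -ler_pdivrMl ?mulr_gt0// mulr1 le_min lerBrDl h1/=.
  by rewrite lerBrDl -lerBrDr.
split; last exact: le_trans bz (bump_le _ _).
by apply: locateE; exact: lt_le_trans ltr01 bz.
Qed.

Lemma core_volume z :
  (((side * m%:R / M%:R) ^+ N)%:E <= lebesgue_rV (core bumps locate (site z)))%E.
Proof.
apply: (le_trans _ (lebesgue_rV_mono (@core_box z))).
have h : (2 * M%:R)^-1 <= 1 - (2 * M%:R)^-1 :> R.
  suff e2 : (2 * M%:R)^-1 <= 2^-1 :> R by rewrite lerBrDr [leRHS]splitr div1r lerD.
  by rewrite lef_pV2 ?posrE ?mulr_gt0// ler_peMr// ler1n.
rewrite lebesgue_rV_box; last first.
  by move=> i; rewrite !mxE; apply: ler_wpM2l; [exact: ltW side0|rewrite -addrA lerD2l].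
rewrite lee_fin /vol (eq_bigr (fun=> side * m%:R / M%:R)); last first.
  move=> i _; rewrite !mxE -mulrBr -mulrA; congr (_ * _).
  have M0 : (M%:R : R) != 0 by [].
  have ide (u w : R) : u + 1 - w - (u + w) = 1 - w *+ 2 by lra.
  rewrite ide invfM -[X in 1 - X]mulr_natr mulrAC mulVf// mul1r.
  by rewrite -[in RHS](addrK 1 m%:R) natr1 mulrBl divff// mul1r.
by rewrite prodr_const card_ord.
Qed.

Lemma site_inj : injective site.
Proof.
move=> z z' /rowP zz; apply/ffunP => i; have := zz i; rewrite !mxE.
have LM : L / M%:R != 0 by rewrite gt_eqF// divr_gt0.
by move=> /(mulfI LM)/eqP; rewrite eqr_nat => /eqP/val_inj.
Qed.

Section feasible_measure.
Variables (t : nat) (mu : {measure set (borel (ind [set: V] (2 * t))) -> \bar R}).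
Hypotheses (mu_radon : radon mu) (mu0 : mu [set ind0 [set: V] (2 * t)] = 1%E)
  (mup : adjoint_psd mu).
Variable (rho : R).
Hypothesis mud : has_density mu rho.
Local Open Scope ereal_scope.

Lemma density_ge0 : (0 <= rho)%R.
Proof.
have b1 : <<s @open V >> (box (0 : V) (const_mx 1%R)) := @box_borel R n _ _.
have : 0 <= rho%:E * lebesgue_rV (box (0 : V) (const_mx 1%R)).
  by rewrite -(mud b1) measure_ge0.
rewrite lebesgue_rV_box; last by move=> i; rewrite !mxE.
rewrite -EFinM lee_fin /vol big1 ?mulr1// => i _.
by rewrite !mxE subr0.
Qed.

(** There are M^N sites, each with moment at least [rho] times the volume (side m / M)^N of its
    plateau; the powers of M cancel. *)
Lemma las_sites_ge : (rho * (L * m%:R / (M%:R + L * N%:R)) ^+ N)%R%:E <=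
  las_finite t [set` sites].
Proof.
have cr : compact region := @cbox_compact R n _ _.
have w := moment_weights bumps_ge0 grid_lip0 bumps_lip locate_loc locate_supp
  locate_apart cr mu_radon mu0 mup.
apply: le_trans (las_finite_ge w).
apply: (@le_trans _ _ (\sum_(z : cell) rho%:E * ((side * m%:R / M%:R) ^+ N)%R%:E)).
  under eq_bigr do rewrite -EFinM.
  rewrite sumEFin sumr_const card_ffun !card_ord lee_fin.
  rewrite -[leRHS]mulr_natr natrX -[leRHS]mulrA -exprMn divfK//.
  by rewrite /side mulrAC.
rewrite big_imfset/=; last by move=> z z' _ _; exact: site_inj.
rewrite -sumEFin big_enum/=; apply: lee_sum => z _.
apply: le_trans (moment_density bumps_ge0 grid_lip0 bumps_lip locate_loc
  locate_supp cr mu_radon _ mud).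
by apply: lee_wpmul2l; [rewrite lee_fin density_ge0|exact: core_volume].
Qed.

End feasible_measure.

End grid.

Section upper_bound.
Variables (R : realType) (n : nat).
Local Notation N := n.+1.
Local Notation V := 'rV[R]_N.

Lemma grid_ratio_cvg (L : R) : 0 < L ->
  (fun m : nat => L * m%:R / (m.+1%:R + L * N%:R)) @ \oo --> L.
Proof.
move=> L0; have LN : 0 <= L * N%:R by rewrite mulr_ge0// ltW.
(* The quotient equals L - a / (M + L N) with M = m + 1, hence is at least L - a / M. *)
pose a := L * (1 + L * N%:R).
have a0 : 0 <= a by rewrite mulr_ge0 ?ltW// ltr_wpDr.
have harm : (fun m : nat => L - a * (@harmonic R m)) @ \oo --> L.
  rewrite -[X in _ --> X]subr0 -[X in _ - X](mulr0 a).
  by apply: cvgB; [exact: cvg_cst|apply: cvgM; [exact: cvg_cst|exact: cvg_harmonic]].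
apply: (squeeze_cvgr _ harm (cvg_cst L)); apply: nearW => m.
have d0 : 0 < m.+1%:R + L * N%:R by rewrite ltr_wpDr.
apply/andP; split; last first.
  by rewrite ler_pdivrMr// ler_wpM2l ?(ltW L0)// (@le_trans _ _ m.+1%:R) ?ler_nat// lerDl.
rewrite ler_pdivlMr// /harmonic /=.
have h : (m.+1%:R : R)^-1 * m.+1%:R = 1 by rewrite mulVf.
have hd : 1 <= (m.+1%:R : R)^-1 * (m.+1%:R + L * N%:R).
  by rewrite mulrDr h lerDl mulr_ge0.
have gen X : a <= X -> L * (m.+1%:R + L * N%:R) - X <= L * m%:R.
  by rewrite /a -[m.+1%:R]natr1; move: (N%:R : R) => w; lra.
by rewrite mulrBl -mulrA; apply: gen; rewrite ler_peMr.
Qed.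

Local Open Scope ereal_scope.

Lemma las_Rn_le_density t k : las_Rn R N t <= las_density R N t k.
Proof.
apply: ge_ereal_sup => _ [rho [mu [mur _ mu0 mup mud]] <-].
pose L : R := (2 ^+ k)%R.
have L0 : (0 < L)%R by rewrite exprn_gt0.
set C := [set (2 ^+ k *: x)%R | x in @cube R N].
have bound m : (rho * (L * m%:R / (m.+1%:R + L * N%:R)) ^+ N)%R%:E <= las t C.
  apply: le_trans (las_sites_ge m L0 mur mu0 mup mud) _.
  apply: ereal_sup_ubound; exists [set` sites n m L] => //; split.
    exact: finite_fset.
  move=> _ /imfsetP[z /= _ ->]; exists (\row_i ((z i)%:R / m.+1%:R)%R).
    by move=> i; rewrite mxE divr_ge0//= ler_pdivrMr// mul1r ler_nat ltnW.
  by apply/rowP => i; rewrite !mxE mulrA mulrAC.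
(* The sites change with [m], but the supremum over all finite subsets of the cube does not, so the
   bound passes to the limit. *)
have lim : (rho * L ^+ N)%R%:E <= las t C.
  have cv : (fun m : nat => (rho * (L * m%:R / (m.+1%:R + L * N%:R)) ^+ N)%R%:E) @ \oo
      --> (rho * L ^+ N)%R%:E.
    apply: cvg_EFin; first exact: nearW.
    apply: cvgM; first exact: cvg_cst.
    exact: (cvg_comp _ _ (grid_ratio_cvg L0) (@exprn_continuous R N L)).
  rewrite -(cvg_lim _ cv)//; apply: lime_le; last exact: nearW.
  by apply/cvg_ex; exists (rho * L ^+ N)%R%:E.
have -> : rho%:E = (rho * L ^+ N)%R%:E * ((2 ^+ (k * N))^-1)%R%:E.
  rewrite -EFinM /L exprM mulfK// expf_neq0// expf_neq0//.
exact: lee_wpmul2r.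
Qed.

End upper_bound.

(** * Periodization of a finite solution *)

Lemma sum_fset_swap (R : realType) (T : choiceType) (A B : {fset T}) (F : T -> R) :
  (forall x, x \in A -> x \notin B -> F x = 0) ->
  \sum_(x <- A) F x = \sum_(x <- B) if x \in A then F x else 0.
Proof.
move=> F0; rewrite -big_mkcond/= (bigID (fun x => x \in B))/=.
rewrite [X in _ + X]big1_seq ?addr0; last by move=> x /andP[xB xA]; exact: F0.
rewrite -[LHS]big_filter -[RHS]big_filter; apply/perm_big/uniq_perm.
- exact/filter_uniq/fset_uniq.
- exact/filter_uniq/fset_uniq.
- by move=> x; rewrite !mem_filter andbC.
Qed.

(** A pairing of [c] with an [A_op]-type sum is a double sum over pairs with coefficient [c] of the
    union: each pair determines its [X]. *)
Lemma sum_union_swap (R : realType) (T : choiceType) (S : {fset T})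
    (p : rel {fset T}) (c : {fset T} -> R) (f : {fset T} -> {fset T} -> R) :
  \sum_(X <- fpowerset S) c X * (\sum_(Y <- fpowerset X) \sum_(Z <- fpowerset X)
     if p Y Z && ((Y `|` Z)%fset == X) then f Y Z else 0) =
  \sum_(Y <- fpowerset S) \sum_(Z <- fpowerset S)
     c (Y `|` Z)%fset * if p Y Z then f Y Z else 0.
Proof.
transitivity (\sum_(X <- fpowerset S) \sum_(Y <- fpowerset S) \sum_(Z <- fpowerset S)
    if (Y `|` Z)%fset == X then c X * if p Y Z then f Y Z else 0 else 0).
  apply: eq_big_seq => X XS.
  have sub Y : Y \in fpowerset X -> Y \in fpowerset S.
    by rewrite !fpowersetE => /fsubset_trans; apply; rewrite -fpowersetE.
  rewrite mulr_sumr (sum_fset_swap (B := fpowerset S)); last by move=> Y /sub ->.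
  apply: eq_bigr => Y _; case: ifPn => [YX|YX]; last first.
    rewrite big1// => Z _; case: eqP => // E; case/negP: YX.
    by rewrite fpowersetE -E fsubsetUl.
  rewrite mulr_sumr (sum_fset_swap (B := fpowerset S)); last by move=> Z /sub ->.
  apply: eq_bigr => Z _; case: ifPn => [ZX|ZX]; last first.
    case: eqP => // E; case/negP: ZX.
    by rewrite fpowersetE -E fsubsetUr.
  by rewrite andbC; case: eqP => _ /=; rewrite ?mulr0.
rewrite exchange_big/=; apply: eq_big_seq => Y YS.
rewrite exchange_big/=; apply: eq_big_seq => Z ZS.
have YZ : (Y `|` Z)%fset \in fpowerset S.
  by move: YS ZS; rewrite !fpowersetE fsubUset => -> ->.
rewrite (bigD1_seq (Y `|` Z)%fset) ?fset_uniq//= eqxx big1 ?addr0// => X XYZ.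
by rewrite eq_sym (negbTE XYZ).
Qed.

Section weights_kernel.
Variables (R : realType) (n t : nat) (FF : {fset 'rV[R]_n}).
Local Notation V := 'rV[R]_n.
Variable l : {fset V} -> R.
Hypothesis lw : weights FF t l.

(** The truncated moment matrix of [l]. *)
Definition union_kernel (X Y : {fset V}) : R :=
  if (#|` X| <= t)%N && (#|` Y| <= t)%N then l (X `|` Y)%fset else 0.

(** Feasibility of [l] tested on the rank-one kernel u(J) u(J') is the quadratic form of this matrix
    at [u]. *)
Lemma union_kernel_psd : psd union_kernel.
Proof.
have [l0 lI l1 lK] := lw.
split=> [X Y|S w]; first by rewrite /union_kernel andbC fsetUC.
pose u (J : ind [set` FF] t) : R := if pts J \in S then w (pts J) else 0.
pose c (X Y : {fset V}) : R := if (#|` X| <= t)%N && (#|` Y| <= t)%N then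
   u (mkind _ _ X) * u (mkind _ _ Y) else 0.
have := lK _ (psd_rank1 u); congr (0 <= _).
have -> : \sum_(X <- fpowerset FF) l X * A_op (fun x y => u x * u y) (mkind [set` FF] (2 * t) X) =
    \sum_(Y <- fpowerset FF) \sum_(Z <- fpowerset FF) l (Y `|` Z)%fset * c Y Z.
  rewrite /c -sum_union_swap; apply: eq_big_seq => X XF.
  have [->|lX] := eqVneq (l X) 0; first by rewrite !mul0r.
  rewrite (@A_opE _ _ _ _ _ _ _ X id); [|by []|by rewrite imfset_id pts_mkind//; exact: lI].
  by congr (_ * _); apply: eq_bigr => Y _; apply: eq_bigr => Z _; rewrite !imfset_id andbA.
(* Nonzero entries involve independent sets only, as subsets of an independent union; so the default
   of [mkind] and sets outside [FF] do not matter. *)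
have K0 X Y : union_kernel X Y != 0 -> [/\ (#|` X| <= t)%N, (#|` Y| <= t)%N,
    indep_sets [set` FF] t X & indep_sets [set` FF] t Y].
  rewrite /union_kernel; case: ifP => [/andP[Xt Yt] /lI XY|_]; last by rewrite eqxx.
  have ind Z : (Z `<=` X `|` Y)%fset -> (#|` Z| <= t)%N -> indep_sets [set` FF] t Z.
    by move=> /(indep_sub XY)[? ? _] ?; split.
  by split=> //; apply: ind => //; rewrite ?fsubsetUl ?fsubsetUr.
have inF X : indep_sets [set` FF] t X -> X \in fpowerset FF.
  by move=> XI; rewrite -(pts_mkind XI) pts_fpowerset.
rewrite [RHS](sum_fset_swap (B := fpowerset FF)); last first.
  move=> X _ XF; rewrite big1// => Y _.
  have [->|/K0[_ _ /inF]] := eqVneq (union_kernel X Y) 0; first by rewrite mulr0.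
  by rewrite (negbTE XF).
apply: eq_bigr => X _; case: ifPn => [XS|XS]; last first.
  rewrite big1// => Y _; rewrite /c; case: ifP => [/andP[Xt Yt]|_]; last by rewrite mulr0.
  have [->|lXY] := eqVneq (l (X `|` Y)%fset) 0; first by rewrite mul0r.
  have [|_ _ XI _] := K0 X Y; first by rewrite /union_kernel Xt Yt.
  by rewrite /u pts_mkind// (negbTE XS) mul0r mulr0.
rewrite [RHS](sum_fset_swap (B := fpowerset FF)); last first.
  move=> Y _ YF.
  have [->|/K0[_ _ _ /inF]] := eqVneq (union_kernel X Y) 0; first by rewrite mulr0.
  by rewrite (negbTE YF).
apply: eq_bigr => Y _; rewrite /c; case: ifP => [/andP[Xt Yt]|XYt]; last first.
  by rewrite mulr0; case: ifP => //; rewrite /union_kernel XYt mulr0.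
rewrite [union_kernel X Y]/union_kernel Xt Yt/=.
have [->|lXY] := eqVneq (l (X `|` Y)%fset) 0; first by rewrite !mul0r mulr0; case: ifP.
have [|_ _ XI YI] := K0 X Y; first by rewrite /union_kernel Xt Yt.
rewrite /u !pts_mkind// XS; case: ifP => _; last by rewrite !mulr0.
exact: mulrC.
Qed.

End weights_kernel.

(** * Finite subsets of the periodic point set and their product weights *)

Section periodic_extension.
Variables (R : realType) (n t : nat).
Local Notation N := n.+1.
Local Notation V := 'rV[R]_N.
Variables (FF : {fset V}) (l : {fset V} -> R) (L : R).
Hypothesis L0 : 0 < L.
Hypothesis FL : forall x, x \in FF -> forall i, 0 <= x ord0 i <= L.
Hypothesis lw : weights FF t l.

Local Notation Z := {ffun 'I_N -> int}.
Local Notation P := (FF * Z)%type.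
Implicit Types (s j : {fset P}) (z : Z) (p q : P).

(* The margin 2 keeps the translates of [FF] by distinct lattice points at
   distance at least 2. *)
Definition period : R := L + 2.

Definition lattice z : V := \row_i (period * (z i)%:~R).

Definition place p : V := val p.1 + lattice p.2.

Definition places s : {fset V} := [fset place p | p in s]%fset.

Definition slice s z : {fset V} := [fset val p.1 | p in s & p.2 == z]%fset.

Definition cells s : {fset Z} := [fset p.2 | p in s]%fset.

(** Formally a product over the whole lattice: as [l] is 1 on the empty set, the cells that [s] does
    not meet contribute 1, see [pweight_widen]. *)
Definition pweight s : R := \prod_(z <- cells s) l (slice s z).

Lemma period0 : 0 < period.
Proof. by rewrite addr_gt0. Qed.

Lemma sliceP s z x : reflect (exists p, [/\ p \in s, p.2 = z & val p.1 = x]) (x \in slice s z).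
Proof.
apply: (iffP idP) => [/imfsetP[p /=]|[p [ps pz px]]].
  by rewrite !inE /= => /andP[ps /eqP pz] ->; exists p.
by apply/imfsetP; exists p; rewrite //= !inE /= ps pz eqxx.
Qed.

Lemma slice_out s z : z \notin cells s -> slice s z = fset0.
Proof.
move=> zs; apply/fsetP => x; rewrite in_fset0; apply/negP => /sliceP[p [ps pz _]].
by case/negP: zs; rewrite -pz; exact: in_imfset.
Qed.

Lemma sliceU s j z : slice (s `|` j)%fset z = (slice s z `|` slice j z)%fset.
Proof.
apply/fsetP => x; rewrite inE; apply/sliceP/orP.
  by case=> p [+ pz px]; rewrite inE => /orP[ps|pj]; [left|right]; apply/sliceP; exists p.
by case=> /sliceP[p [ps pz px]]; exists p; rewrite inE ps ?orbT.
Qed.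

Lemma card_slice s z : (#|` slice s z| <= #|` s|)%N.
Proof.
apply: (@leq_trans #|` [fset val p.1 | p in s]%fset|); last exact: leq_imfset_card.
apply: fsubset_leq_card; apply/fsubsetP => x /sliceP[p [ps _ <-]].
exact: in_imfset.
Qed.

Lemma pweight_widen s (D : {fset Z}) : (cells s `<=` D)%fset ->
  pweight s = \prod_(z <- D) l (slice s z).
Proof.
have [_ _ l1 _] := lw.
move=> sD; rewrite /pweight; apply: big_fset_incl => // z _ zs.
by rewrite slice_out.
Qed.

Lemma pweight_ge0 s : 0 <= pweight s.
Proof. by have [l0 _ _ _] := lw; apply: prodr_ge0 => z _; exact: l0. Qed.

Lemma pweight0 : pweight fset0 = 1.
Proof.
rewrite /pweight big1_seq// => z /andP[_ /imfsetP[p]].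
by rewrite /= in_fset0.
Qed.

Lemma coord_place p i : period * (p.2 i)%:~R <= place p ord0 i <= period * (p.2 i)%:~R + L.
Proof.
by rewrite !mxE; have /andP[h1 h2] := FL (valP p.1) i; apply/andP; split; lra.
Qed.

Lemma place_apart p q : p.2 != q.2 ->
  place p != place q /\ ~~ edge (place p) (place q).
Proof.
move=> pq; apply/edge_apart.
have [i pqi] : exists i, p.2 i != q.2 i.
  apply/existsP; apply: contraNT pq => /existsPn h.
  by apply/eqP/ffunP => i; apply/eqP/negPn; exact: h.
rewrite (bigD1 i)//=.
apply: (@le_trans _ _ ((place p ord0 i - place q ord0 i) ^+ 2)); last first.
  by rewrite lerDl sumr_ge0// => k _; exact: sqr_ge0.
have /andP[h1 h2] := coord_place p i; have /andP[h3 h4] := coord_place q i.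
(* Distinct indices in coordinate i are at least [period] = L + 2 apart after scaling, and offsets
   within [FF] use up at most L. *)
have two (a b : int) : (a < b)%R -> period * a%:~R + period <= period * b%:~R.
  move=> ab; have : (a%:~R + 1 : R) <= b%:~R by rewrite -(intrD _ a 1) ler_int lezD1.
  by move=> /(ler_wpM2l (ltW period0)); rewrite mulrDr mulr1.
have sq (u : R) : 2 <= u -> 4 <= u ^+ 2.
  by move=> u2; rewrite expr2; nra.
have [lt|lt|/eqP] := ltgtP (p.2 i) (q.2 i); last by rewrite (negbTE pqi).
  have := two _ _ lt; rewrite -sqrrN; rewrite /period in h1 h2 h3 h4 * => h5.
  by apply: sq; lra.
have := two _ _ lt; rewrite /period in h1 h2 h3 h4 * => h5.
by apply: sq; lra.
Qed.

Lemma place_inj : injective place.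
Proof.
move=> p q pq; have [pq2|/place_apart[]] := eqVneq p.2 q.2; last by rewrite pq eqxx.
rewrite [p]surjective_pairing [q]surjective_pairing pq2; congr (_, _); apply: val_inj.
by move: pq; rewrite /place pq2 => /addIr.
Qed.

Lemma edge_translate (v x y : V) : edge (x + v) (y + v) = edge x y.
Proof.
rewrite !edgeE (inj_eq (addIr v)); congr (_ && (_ < _)).
by apply: eq_bigr => i _; rewrite !mxE opprD addrACA subrr addr0.
Qed.

Lemma pweight_slice s z : pweight s != 0 -> l (slice s z) != 0.
Proof.
have [_ _ l1 _] := lw.
move=> ws; have [zs|/slice_out ->] := boolP (z \in cells s); last by rewrite l1 oner_neq0.
by move: ws; rewrite /pweight (big_rem z)//= mulf_eq0 negb_or => /andP[].
Qed.

Lemma pweight_indep s : pweight s != 0 -> independent (places s).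
Proof.
have [_ lI _ _] := lw.
move=> ws _ _ /imfsetP[p /= ps ->] /imfsetP[q /= qs ->].
have [pq|/place_apart[]//] := eqVneq p.2 q.2.
rewrite /place pq edge_translate; have [_ si _] := lI _ (pweight_slice q.2 ws).
by apply: si; apply/sliceP; [exists p|exists q].
Qed.

Definition pkernel (j j' : {fset P}) : R :=
  if (#|` j| <= t)%N && (#|` j'| <= t)%N then pweight (j `|` j')%fset else 0.

(** On finitely many sets the kernel is an entrywise product of [union_kernel] over the finitely
    many cells in [D], times the rank-one cutoff [v]. A slice of a set of at most [t] points has at
    most [t] points, so the cutoffs in the factors are inactive. *)
Lemma pkernel_psd : psd pkernel.
Proof.
split=> [j j'|S w]; first by rewrite /pkernel andbC fsetUC.
pose D : {fset Z} := (\bigcup_(j <- S) cells j)%fset.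
pose v (j : {fset P}) : R := (#|` j| <= t)%N%:R.
have KD j j' : j \in S -> j' \in S -> pkernel j j' =
    v j * v j' * \prod_(z <- D) union_kernel t l (slice j z) (slice j' z).
  move=> jS j'S; rewrite /pkernel /v.
  case: (boolP (#|` j| <= t)%N) => jt; last by rewrite !mul0r.
  case: (boolP (#|` j'| <= t)%N) => j't /=; last by rewrite mulr0 mul0r.
  rewrite !mul1r (@pweight_widen _ D); last first.
    apply/fsubsetP => z /imfsetP[p /=]; rewrite inE => /orP[pj|pj'] ->.
      by apply/bigfcupP; exists j; rewrite ?jS//; exact: in_imfset.
    by apply/bigfcupP; exists j'; rewrite ?j'S//; exact: in_imfset.
  apply: eq_bigr => z _; rewrite /union_kernel sliceU.
  by rewrite !(leq_trans (card_slice _ _)).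
have Kp := psdM (psd_rank1 v) (@psd_prod R {fset P} Z D
  (fun z j j' => union_kernel t l (slice j z) (slice j' z))
  (fun z _ => psd_comp (fun j => slice j z) (union_kernel_psd lw))).
have := Kp.2 S w; congr (0 <= _).
by apply: eq_big_seq => j jS; apply: eq_big_seq => j' j'S; rewrite KD.
Qed.

Definition shift_point z p : P := (p.1, [ffun i => p.2 i + z i]).

Definition shift_index z s : {fset P} := [fset shift_point z p | p in s]%fset.

Lemma lattice_add z z' : lattice [ffun i => z i + z' i] = lattice z + lattice z'.
Proof. by apply/rowP => i; rewrite !mxE ffunE intrD mulrDr. Qed.

Lemma places_shift z s : places (shift_index z s) = [fset (x + lattice z)%R | x in places s]%fset.
Proof.
rewrite /places /shift_index -!imfset_comp; apply: eq_imfset => // p /=.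
by rewrite /place /= lattice_add addrA.
Qed.

Lemma shift_indexK z : cancel (shift_index z) (shift_index [ffun i => - z i]).
Proof.
move=> s; rewrite /shift_index -imfset_comp -[RHS]imfset_id; apply: eq_imfset => // -[p q] /=.
by congr (_, _); apply/ffunP => i; rewrite !ffunE addrK.
Qed.

Lemma shift_indexNK z : cancel (shift_index [ffun i => - z i]) (shift_index z).
Proof.
move=> s; rewrite /shift_index -imfset_comp -[RHS]imfset_id; apply: eq_imfset => // -[p q] /=.
by congr (_, _); apply/ffunP => i; rewrite !ffunE subrK.
Qed.

Lemma card_shift_index z s : #|` shift_index z s| = #|` s|.
Proof.
rewrite card_imfset//= => -[p q] [p' q'] /= [-> /ffunP h]; congr (_, _).
by apply/ffunP => i; have := h i; rewrite !ffunE => /addIr.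
Qed.

Lemma slice_shift z z' s :
  slice (shift_index z s) [ffun i => z' i + z i] = slice s z'.
Proof.
apply/fsetP => x; apply/sliceP/sliceP => -[p [ps pz px]].
  move: ps => /imfsetP[q /= qs pq]; exists q; split=> //; last by rewrite -px pq.
  by move: pz; rewrite pq /= => /ffunP h; apply/ffunP => i; have := h i; rewrite !ffunE => /addIr.
exists (shift_point z p); split=> //=; last by rewrite pz.
by apply/imfsetP; exists p.
Qed.

Lemma pweight_shift z s : pweight (shift_index z s) = pweight s.
Proof.
pose f (z' : Z) : Z := [ffun i => z' i + z i].
have fi : injective f.
  by move=> a b /ffunP h; apply/ffunP => i; have := h i; rewrite !ffunE => /addIr.
have -> : pweight (shift_index z s) =
    \prod_(z' <- [fset f x | x in cells s]%fset) l (slice (shift_index z s) z').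
  rewrite /pweight; congr (\prod_(_ <- enum_fset _) _).
  by rewrite /cells /shift_index -!imfset_comp.
rewrite big_imfset/=; last by move=> a b _ _; exact: fi.
by rewrite /pweight; apply: eq_bigr => z' _; rewrite slice_shift.
Qed.

End periodic_extension.

(** * Sums over countable families, supports and measurability *)

Lemma nneseries_pickle (R : realType) (T : countType) (a : T -> \bar R) :
  (forall x, 0 <= a x)%E ->
  (\sum_(0 <= i <oo) (if @choice.pickle_inv T i is Some x then a x else 0) =
   \esum_(x in [set: T]) a x)%E.
Proof.
move=> a0; pose b i := if @choice.pickle_inv T i is Some x then a x else 0%E.
have b0 i : (0 <= b i)%E.
  by rewrite /b; case: (choice.pickle_inv i) => [x|]; [exact: a0|exact: lexx].
rewrite (_ : (\sum_(0 <= i <oo) _ = \sum_(0 <= i <oo) b i)%E)// nneseries_esumT//.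
transitivity (\esum_(i in range (@choice.pickle T)) b i)%E.
  rewrite [RHS]esum_mkcond; apply: eq_esum => i _.
  case: (boolP (i \in _)) => // /negP iT; rewrite /b.
  case E : (choice.pickle_inv i) => [x|//]; case: iT; apply/mem_set; exists x => //.
  by have := @choice.pickle_invK T i; rewrite /oapp E.
rewrite esum_image; last by move=> x y _ _; exact: (pcan_inj (@choice.pickleK T)).
apply: eq_esum => x _; rewrite /b.
by rewrite choice.pickleK_inv.
Qed.

Lemma measure_partition d (T : measurableType d) (R : realType)
    (mu : {measure set T -> \bar R}) (I : countType) (F : I -> set T) (B : set T) :
  (forall i, measurable (F i)) -> measurable B ->
  (forall i j x, F i x -> F j x -> i = j) -> (forall x, exists i, F i x) ->
  mu B = (\esum_(i in [set: I]) mu (B `&` F i))%E.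
Proof.
move=> mF mB disj cover.
rewrite -(@nneseries_pickle R I (fun i => mu (B `&` F i))); last by move=> i; exact: measure_ge0.
pose G k : set T := if @choice.pickle_inv I k is Some i then B `&` F i else set0.
have mG k : measurable (G k).
  by rewrite /G; case: (choice.pickle_inv k) => [i|//]; exact: measurableI.
have BG : B = \bigcup_k G k.
  apply/seteqP; split=> x.
    move=> Bx; have [i Fi] := cover x; exists (choice.pickle i) => //.
    by rewrite /G choice.pickleK_inv.
  by move=> [k _]; rewrite /G; case: (choice.pickle_inv k) => [i|//] [].
rewrite [in LHS]BG measure_semi_bigcup//.
- apply: eq_eseriesr => k _; rewrite /G.
  by case: (choice.pickle_inv k) => [i|]; rewrite ?measure0.
- apply/trivIsetP => k k' _ _; apply: contraNeq => /set0P[x []].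
  rewrite /G; have := @choice.pickle_invK I k; have := @choice.pickle_invK I k'.
  case: (choice.pickle_inv k) => [i|//]; case: (choice.pickle_inv k') => [j|//] /=.
  by move=> <- <- [_ Fi] [_ Fj]; rewrite (disj _ _ _ Fi Fj).
- exact: bigcup_measurable.
Qed.

Lemma exchange_esum (R : realType) (I J : choiceType) (a : I -> J -> \bar R) :
  (forall i j, 0 <= a i j)%E ->
  (\esum_(i in [set: I]) \esum_(j in [set: J]) a i j =
   \esum_(j in [set: J]) \esum_(i in [set: I]) a i j)%E.
Proof.
move=> a0; rewrite !esum_esum//.
rewrite (@reindex_esum _ _ _ ([set: J] `*`` (fun=> [set: I])) _ (fun k => (k.2, k.1)))//.
by split=> // [|[i j] _]; [move=> [i j] [i' j'] _ _ [-> ->]|exists (j, i)].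
Qed.

Lemma esumZl (R : realType) (I : choiceType) (c : R) (a : I -> \bar R) :
  (0 <= c)%R -> (forall i, 0 <= a i)%E ->
  (\esum_(i in [set: I]) (c%:E * a i) = c%:E * \esum_(i in [set: I]) a i)%E.
Proof.
move=> c0 a0; rewrite le0r in c0; case/orP : c0 => [/eqP ->|c0].
  by rewrite mul0e esum1// => i _; rewrite mul0e.
rewrite /esum -ereal_sup_pZl//; congr (ereal_sup _).
apply/seteqP; split=> x /= [X XI <-].
  exists (\sum_(i \in X) a i)%E; first by exists X.
  by rewrite ge0_mule_fsumr.
by case: XI => X' X'I <-; exists X' => //; rewrite ge0_mule_fsumr.
Qed.

Lemma esum_support (R : realType) (I : choiceType) (D : set I) (a : I -> \bar R) :
  (forall i, ~ D i -> a i = 0)%E ->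
  (\esum_(i in [set: I]) a i = \esum_(i in D) a i)%E.
Proof.
move=> a0; rewrite [RHS]esum_mkcond; apply: eq_esum => i _.
by case: ifPn => // /negP Di; apply: a0 => /mem_set.
Qed.

Lemma integral_support d (T : measurableType d) (R : realType)
    (mu : {measure set T -> \bar R}) (D : set T) (f : T -> \bar R) :
  (forall x, ~ D x -> f x = 0)%E ->
  (\int[mu]_x f x = \int[mu]_(x in D) f x)%E.
Proof.
move=> f0; rewrite [RHS]integral_mkcond; apply: eq_integral => x _.
by rewrite patchE; case: ifPn => // /negP xD; apply: f0 => Dx; apply: xD; exact: mem_set.
Qed.

Lemma continuous_measurable_borel (T T' : ptopologicalType) (f : T -> T') :
  continuous f -> measurable_fun setT (f : borel T -> borel T').
Proof.
move=> /continuousP cf.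
apply: (measurability _ (erefl : @measurable _ (borel T') = <<s @open T' >>)).
by move=> _ [A oA <-]; rewrite setTI; apply: sub_sigma_algebra; exact: cf.
Qed.

(** * The periodic measure *)

Section periodic_measure_def.
Variables (R : realType) (n t : nat).
Local Notation N := n.+1.
Local Notation V := 'rV[R]_N.
Variables (FF : {fset V}) (l : {fset V} -> R) (L : R).
Hypothesis L0 : 0 < L.
Hypothesis FL : forall x, x \in FF -> forall i, 0 <= x ord0 i <= L.
Hypothesis lw : weights FF t l.

Local Notation Z := {ffun 'I_N -> int}.
Local Notation P := (FF * Z)%type.
Local Notation Ind t := (ind [set: V] t).
Local Notation period := (period L).
Local Notation places := (places L).
Local Notation pweight := (pweight l).
Local Notation leb := (@lebesgue_rV R N).
Implicit Types (s j : {fset P}) (z : Z) (p q : P).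
Local Open Scope ereal_scope.

Definition torus : set V := box 0%R (const_mx period).

Lemma torus_borel : measurable (torus : set (borel V)).
Proof. exact: box_borel. Qed.

Lemma leb_torus : leb torus = (period ^+ N)%R%:E.
Proof.
rewrite lebesgue_rV_box; last by move=> i; rewrite !mxE ltW// period0.
rewrite /vol (eq_bigr (fun=> period)) ?prodr_const ?card_ord// => i _.
by rewrite !mxE subr0.
Qed.

Definition orbit s (x : V) : Ind (2 * t) := translate x (mkind _ _ (places s)).

Lemma orbit_continuous s : continuous (orbit s).
Proof. exact: continuous_translate. Qed.

Lemma orbit_measurable_fun s :
  measurable_fun setT (orbit s : borel V -> borel (Ind (2 * t))).
Proof. exact: continuous_measurable_borel (@orbit_continuous s). Qed.

Lemma orbit_measurable s (A : set (borel (Ind (2 * t)))) : measurable A ->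
  measurable (orbit s @^-1` A : set (borel V)).
Proof.
by move=> mA; rewrite -[X in measurable X]setTI; exact: orbit_measurable_fun.
Qed.

(** Division by the volume of the period makes the integral over it an average. The cutoff excludes
    sets with too many points, which the default of [mkind] would turn into the empty set. *)
Definition coef s : R := if (#|` s| <= 2 * t)%N then (pweight s / period ^+ N)%R else 0%R.

Lemma coef_ge0 s : (0 <= coef s)%R.
Proof.
rewrite /coef; case: ifP => // _; rewrite divr_ge0 ?(pweight_ge0 lw)// exprn_ge0//.
by rewrite ltW// period0.
Qed.

Lemma coef_indep s : coef s != 0%R ->
  pts (mkind [set: V] (2 * t) (places s)) = places s.
Proof.
rewrite /coef; case: ifP => [st|_]; last by rewrite eqxx.
rewrite mulf_eq0 negb_or => /andP[ws _]; apply: pts_mkind; split=> //.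
  exact: (pweight_indep L0 FL lw).
by apply: leq_trans st; exact: leq_imfset_card.
Qed.

(** The image of Lebesgue measure on one period under translation of [s], scaled by [coef s]. One
    period is enough, because all lattice translates of [s] are summed as well. *)
Definition orbit_mass s (A : set (borel (Ind (2 * t)))) : \bar R :=
  (coef s)%:E * leb (orbit s @^-1` A `&` torus).

Lemma orbit_mass_ge0 s A : 0 <= orbit_mass s A.
Proof. by rewrite mule_ge0 ?lee_fin ?coef_ge0// lebesgue_rV_ge0. Qed.

Let orbit_mass0 s : orbit_mass s set0 = 0.
Proof. by rewrite /orbit_mass preimage_set0 set0I lebesgue_rV0 mule0. Qed.

Let orbit_mass_sigma_additive s : semi_sigma_additive (orbit_mass s).
Proof.
move=> F mF tF mUF.
have := @measure_semi_sigma_additive _ _ _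
  (mscale (NngNum (coef_ge0 s)) (mrestr (@lebV R n) torus_borel))
  (fun i => orbit s @^-1` (F i)).
rewrite -preimage_bigcup; apply.
- by move=> i; exact: orbit_measurable.
- apply/trivIsetP => /= i j _ _ ij; rewrite -preimage_setI.
  by move/trivIsetP : tF => /(_ _ _ _ _ ij) ->//; rewrite preimage_set0.
- exact: orbit_measurable.
Qed.

HB.instance Definition _ s := isMeasure.Build _ _ _ (orbit_mass s) (orbit_mass0 s)
  (orbit_mass_ge0 s) (@orbit_mass_sigma_additive s).

Definition orbit_measure s : {measure set (borel (Ind (2 * t))) -> \bar R} := orbit_mass s.

Definition orbit_measure_seq (i : nat) : {measure set (borel (Ind (2 * t))) -> \bar R} :=
  if @choice.pickle_inv {fset P} i is Some s then orbit_measure s else mzero.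

Definition periodic_measure : set (borel (Ind (2 * t))) -> \bar R := mseries orbit_measure_seq 0.

HB.instance Definition _ := Measure.on periodic_measure.

Lemma periodic_measureE A : periodic_measure A = \esum_(s in [set: {fset P}]) orbit_mass s A.
Proof.
rewrite -nneseries_pickle; last by move=> s; exact: orbit_mass_ge0.
by apply: eq_eseriesr => i _; rewrite /orbit_measure_seq; case: choice.pickle_inv.
Qed.

Lemma orbit_pts s x : coef s != 0%R ->
  pts (orbit s x) = [fset (x + y)%R | y in places s]%fset.
Proof. by move=> /coef_indep E; rewrite -{}E. Qed.

(** Only the empty [s] has the empty set in its orbit, and its coefficient is the inverse of the
    volume of the period. *)
Lemma periodic_measure0 : periodic_measure [set ind0 [set: V] (2 * t)] = 1.
Proof.
have o0 x : orbit fset0 x = ind0 [set: V] (2 * t).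
  apply: pts_inj; rewrite orbit_pts /coef ?cardfs0//=.
    by rewrite /places imfset0 imfset0.
  by rewrite pweight0 mul1r invr_neq0// expf_neq0// gt_eqF// period0.
rewrite periodic_measureE esum_mkcond (_ : (fun s => _) = fun s =>
    if s \in [set (fset0 : {fset P})] then orbit_mass s [set ind0 [set: V] (2 * t)] else 0).
  rewrite -esum_mkcond esum_set1; last exact: orbit_mass_ge0.
  rewrite /orbit_mass (_ : _ @^-1` _ = setT) ?setTI ?leb_torus.
    rewrite -EFinM /coef cardfs0/= pweight0 mul1r mulVf// expf_neq0//.
    by rewrite gt_eqF// period0.
  by apply/seteqP; split=> // x _ /=; exact: o0.
apply/funext => s; rewrite mem_set//.
case: (boolP (s \in _)) => // /negP s0; rewrite /orbit_mass.
have [->|cs] := eqVneq (coef s) 0%R; first by rewrite mul0e.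
rewrite (_ : _ @^-1` _ = set0) ?set0I ?lebesgue_rV0 ?mule0//.
apply/seteqP; split=> // x /= xs; apply: s0; apply/mem_set => /=.
have := congr1 (@pts _ _ _ _) xs; rewrite orbit_pts// => E.
apply/fsetP => p; rewrite in_fset0; apply/negP => ps.
have : (x + place L p)%R \in [fset (x + y)%R | y in places s]%fset.
  by apply/in_imfset/in_imfset.
by rewrite E in_fset0.
Qed.

End periodic_measure_def.

(** A small perturbation is injective on [S], so by [A_opE] both values are sums over the same pairs
    of subsets, and each term moves little. *)
Lemma continuous_A_op (R : realType) (n t : nat) (C : set 'rV[R]_n)
    (K : ind C t -> ind C t -> R) :
  continuous (fun p => K p.1 p.2) -> continuous (A_op K).
Proof.
move=> Kc; apply: continuous_close => S e e0.
set X := pts S; pose mk (Y : {fset 'rV[R]_n}) := mkind C t Y.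
pose r := [seq (Y, Z) | Y <- fpowerset X, Z <- fpowerset X].
(* One more than the number of pairs, so that the total error stays strictly below [e]. *)
pose e' := e / (size r).+1%:R.
have e'0 : 0 < e' by rewrite divr_gt0.
have [|p _|d d0 dP] := @seq_uniform R _ r (fun p d => forall T T',
    close d (mk p.1) T -> close d (mk p.2) T' -> `|K (mk p.1) (mk p.2) - K T T'| < e').
- move=> p d d' dd' dP T T' pT pT'.
  have cl S1 S2 : @close R n C t d' S1 S2 -> close d S1 S2.
    by move=> [phi [? ? h]]; exists phi; split=> // x /h /lt_le_trans; exact.
  by apply: dP; exact: cl.
- exact: continuous_close2.
exists d => // T [phi [TE TS phid]].
have phi_inj : {in X &, injective phi} by apply/card_in_imfsetP; rewrite -TE TS.
rewrite (@A_opE _ _ _ _ _ K S X id) ?imfset_id//.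
rewrite (@A_opE _ _ _ _ _ K T X phi)// -sumrB.
under eq_bigr do rewrite -sumrB.
rewrite (_ : \sum_(_ <- _) _ = \sum_(p <- r)
    ((if [&& #|` p.1| <= t, #|` p.2| <= t & (p.1 `|` p.2)%fset == X]%N
      then K (mk p.1) (mk p.2) else 0) -
     (if [&& #|` p.1| <= t, #|` p.2| <= t & (p.1 `|` p.2)%fset == X]%N
      then K (mk [fset phi x | x in p.1]%fset) (mk [fset phi x | x in p.2]%fset)
      else 0))); last first.
  rewrite big_allpairs_dep; apply: eq_bigr => Y _; apply: eq_bigr => Z _.
  by rewrite !imfset_id.
apply: (@le_lt_trans _ _ (e' *+ size r)); last first.
  rewrite -mulr_natr -mulrA gtr_pMr// ltr_pdivrMl// mulr1 ltr_nat//.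
have -> : e' *+ size r = \sum_(p <- r) e' by rewrite big_const_seq count_predT iter_addr_0.
apply: (le_trans (ler_norm_sum _ _ _)); rewrite big_seq [leRHS]big_seq.
apply: ler_sum => p pr; case: ifP => [/and3P[p1 p2 /eqP pX]|_]; last first.
  by rewrite subrr normr0 ltW.
have cl Y : (Y `<=` X)%fset -> (#|` Y| <= t)%N -> close d (mk Y) (mk [fset phi x | x in Y]%fset).
  move=> YX Yt; have [SC Si _] := indP S; have [TC Ti _] := indP T.
  have IY : indep_sets C t Y.
    split=> // [x /(fsubsetP YX)|x y /(fsubsetP YX) + /(fsubsetP YX)]; [exact: SC|exact: Si].
  have phY x : x \in [fset phi x | x in Y]%fset -> x \in pts T.
    by move=> /imfsetP[y /= /(fsubsetP YX) yX ->]; rewrite TE; exact: in_imfset.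
  have cphi : #|` [fset phi x | x in Y]%fset| = #|` Y|.
    by rewrite card_in_imfset//= => x y /(fsubsetP YX) ? /(fsubsetP YX); exact: phi_inj.
  have IT : indep_sets C t [fset phi x | x in Y]%fset.
    split; last by rewrite cphi.
      by move=> x /phY; exact: TC.
    by move=> x y /phY + /phY; exact: Ti.
  exists phi; rewrite !pts_mkind//; split=> // x /(fsubsetP YX); exact: phid.
have [p1X p2X] : (p.1 `<=` X)%fset /\ (p.2 `<=` X)%fset.
  by rewrite -pX fsubsetUl fsubsetUr.
by apply/ltW/dP => //; exact: cl.
Qed.

(** The sets contained in the ball of radius k form an open cover; the sum of the radii of a finite
    subcover bounds all of them. *)
Lemma compact_ind_bounded (R : realType) (n t : nat) (C : set 'rV[R]_n)
    (D : set (ind C t)) : compact D ->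
  exists r : R, forall S, D S -> forall x, x \in pts S -> `|x| <= r.
Proof.
pose U (k : nat) : set (ind C t) := [set S | [set` pts S] `<=` ball (0 : 'rV[R]_n) k%:R].
rewrite compact_cover => /(_ nat setT U)[k _|S _|D' _ DD'].
- by apply: open_subpts; exact: ball_open.
- exists (Num.truncn (\sum_(x <- pts S) `|x|)).+1 => // x /= xS.
  rewrite -ball_normE /= sub0r normrN; apply: le_lt_trans (truncnS_gt _).
  by rewrite (big_rem x)//= lerDl sumr_ge0.
exists (\sum_(k <- D') k%:R) => S /DD'[k /= kD' Sk] x xS.
have := Sk x xS; rewrite -ball_normE /= sub0r normrN => /ltW /le_trans; apply.
by rewrite (big_rem k)//= lerDl sumr_ge0.
Qed.

(** * Invariance, density, regularity and feasibility of the periodic measure *)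

Section periodic_properties.
Variables (R : realType) (n t : nat).
Local Notation N := n.+1.
Local Notation V := 'rV[R]_N.
Variables (FF : {fset V}) (l : {fset V} -> R) (L : R).
Hypothesis L0 : 0 < L.
Hypothesis FL : forall x, x \in FF -> forall i, 0 <= x ord0 i <= L.
Hypothesis lw : weights FF t l.

Local Notation Z := {ffun 'I_N -> int}.
Local Notation P := (FF * Z)%type.
Local Notation Ind t := (ind [set: V] t).
Local Notation period := (period L).
Local Notation lattice := (lattice L).
Local Notation place := (place L).
Local Notation places := (places L).
Local Notation pweight := (pweight l).
Local Notation leb := (@lebesgue_rV R N).
Local Notation torus := (@torus R n L).
Local Notation orbit := (@orbit R n t FF L).
Local Notation coef := (@coef R n t FF l L).
Local Notation orbit_mass := (@orbit_mass R n t FF l L).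
Local Notation periodic_measure := (periodic_measure L0 lw).
Implicit Types (s j : {fset P}) (z : Z) (p q : P).
Local Open Scope ereal_scope.

Lemma torus_unique (c : V) z z' :
  torus (c + lattice z)%R -> torus (c + lattice z')%R -> z = z'.
Proof.
move=> Tz Tz'; apply/ffunP => i; apply/eqP; rewrite eq_le.
suff le (a b : Z) : torus (c + lattice a)%R -> torus (c + lattice b)%R -> (a i <= b i)%R.
  by rewrite !le.
move=> /(_ i) /andP[_ ha] /(_ i) /andP[hb _]; move: ha hb; rewrite !mxE => ha hb.
have : ((period * ((a i)%:~R - (b i)%:~R))%R < period)%R by rewrite mulrBr; lra.
rewrite -[X in (_ < X)%R]mulr1 ltr_pM2l ?period0// -(intrB _ (a i) (b i)) -[1%R]/(1%:~R) ltr_int.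
by rewrite -[1%R]add0r ltzD1 subr_le0.
Qed.

Lemma torus_exists (c : V) : exists z, torus (c - lattice z)%R.
Proof.
(* The period is open on the left and closed on the right, hence ceiling minus 1 rather than the
   floor. *)
exists [ffun i => Num.ceil (c ord0 i / period) - 1]%R => i.
rewrite !mxE ffunE.
have /andP[h1 h2] := ceil_itv (c ord0 i / period)%R.
move: h1 h2; rewrite intrB ltr_pdivlMr ?period0// ler_pdivrMr ?period0// !mulrBr.
by rewrite -[1%:~R]/1%R !(mulrC period) mul1r => h1 h2; apply/andP; split; lra.
Qed.

Let opp z : Z := [ffun i => - z i]%R.

Lemma lattice_opp z : lattice (opp z) = (- lattice z)%R.
Proof. by apply/rowP => i; rewrite !mxE ffunE intrN mulrN. Qed.

Let oppK : involutive opp.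
Proof. by move=> z; apply/ffunP => i; rewrite !ffunE opprK. Qed.

Lemma translate_borel (c : V) (B : set V) : measurable (B : set (borel V)) ->
  measurable ([set x | B (x + c)%R] : set (borel V)).
Proof.
have mc : measurable_fun setT ((fun x => x + c)%R : borel V -> borel V).
  apply: continuous_measurable_borel => x.
  have Fx : Filter (nbhs x) by apply: nbhs_filter.
  by apply: (@cvgD _ _ _ (nbhs x) Fx id (cst c)); [exact: cvg_id|exact: cvg_cst].
by move=> mB; rewrite -[X in measurable X]setTI; exact: mc.
Qed.

Lemma leb_tilesN (c : V) (B : set V) : measurable (B : set (borel V)) ->
  leb B = \esum_(z in [set: Z]) leb (B `&` [set x | torus (x + (c - lattice z))%R]).
Proof.
move=> mB.
apply: (@measure_partition _ (borel V) R (@lebV R n) Z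
  (fun z => [set x | torus (x + (c - lattice z))%R])) => //.
- by move=> z; apply: translate_borel; exact: torus_borel.
- move=> z z' x /=; rewrite !addrA -!lattice_opp => h h'.
  by rewrite -[z]oppK -[z']oppK (torus_unique h h').
- by move=> x; have [z] := torus_exists (x + c)%R; exists z; rewrite /= addrA.
Qed.

Lemma leb_tiles (c : V) (B : set V) : measurable (B : set (borel V)) ->
  leb B = \esum_(z in [set: Z]) leb (B `&` [set x | torus (x + (c + lattice z))%R]).
Proof.
move=> /(leb_tilesN c) ->; rewrite (@reindex_esum _ _ _ [set: Z] [set: Z] opp).
  by apply: eq_esum => z _; rewrite lattice_opp opprK.
by split=> // [z z' _ _ /(can_inj oppK)|z _]//; exists (opp z).
Qed.

Lemma translate_add (v w : V) (S : Ind (2 * t)) :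
  translate v (translate w S) = translate (v + w)%R S.
Proof.
apply: pts_inj; rewrite /translate /pts/= -imfset_comp.
by apply: eq_imfset => // x /=; rewrite addrA.
Qed.

Lemma coef_shift z s : coef (shift_index z s) = coef s.
Proof. by rewrite /coef card_shift_index pweight_shift. Qed.

Lemma orbit_shift z s (x : V) : coef s != 0%R ->
  orbit (shift_index z s) x = orbit s (x + lattice z)%R.
Proof.
move=> cs; apply: pts_inj; rewrite !(orbit_pts L0 FL lw) ?coef_shift//.
rewrite places_shift -imfset_comp; apply: eq_imfset => // y /=.
by rewrite -addrA (addrC y).
Qed.

Lemma esum_shift z (a : {fset P} -> \bar R) :
  \esum_(s in [set: {fset P}]) a s = \esum_(s in [set: {fset P}]) a (shift_index z s).
Proof.
apply: reindex_esum; split=> // [s s' _ _|s _].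
  exact: (can_inj (shift_indexK z)).
by exists (shift_index [ffun i => - z i]%R s) => //; exact: shift_indexNK.
Qed.

(** A translation by [v] moves the domain of averaging to the period shifted by [v]. Cut this along
    the lattice and move the piece in cell [z] back into the period: this replaces [s] by
    [shift_index z s], which has the same coefficient and is again summed over. *)
Lemma periodic_translation_invariant : translation_invariant periodic_measure.
Proof.
move=> v A mA; rewrite [LHS]periodic_measureE [RHS]periodic_measureE.
have mO s c : measurable ([set x | A (orbit s (x + c)%R)] : set (borel V)).
  exact: (translate_borel c (orbit_measurable L s mA)).
have mT c : measurable ([set x | torus (x + c)%R] : set (borel V)).
  by apply: translate_borel; exact: torus_borel.
(* The contribution of those [x] of the period for which x - v + lattice z lies in the period. *)
pose G s z := (coef s)%:E *
  leb ([set x | A (orbit s x)] `&` torus `&` [set x | torus (x + (lattice z - v))%R]).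
have G0 s z : 0 <= G s z.
  by rewrite mule_ge0 ?lebesgue_rV_ge0// lee_fin (coef_ge0 L0 lw).
transitivity (\esum_(s in [set: {fset P}]) \esum_(z in [set: Z]) G s z); last first.
  apply: eq_esum => s _; rewrite esumZl ?(coef_ge0 L0 lw)//; last first.
    by move=> z; exact: lebesgue_rV_ge0.
  rewrite /orbit_mass; congr (_ * _); rewrite (@leb_tiles (- v)%R); last first.
    by apply: measurableI; [exact: orbit_measurable|exact: torus_borel].
  by apply: eq_esum => z _; rewrite [(- v + _)%R]addrC.
rewrite (exchange_esum G0).
(* For fixed [z] the shift is a bijection on the index sets, so the two sums are exchanged before
   reindexing. *)
transitivity (\esum_(s in [set: {fset P}]) \esum_(z in [set: Z]) G (shift_index z s) z); last first.
  rewrite [LHS]exchange_esum; last by move=> *; exact: G0.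
  by apply: eq_esum => z _; rewrite [RHS](esum_shift z (G^~ z)).
apply: eq_esum => s _.
have [cs|cs] := eqVneq (coef s) 0%R.
  rewrite /orbit_mass cs mul0e esum1// => z _; by rewrite /G coef_shift cs mul0e.
transitivity ((coef s)%:E * leb ([set x | A (orbit s x)] `&` [set x | torus (x + (- v))%R])).
  rewrite /orbit_mass; congr (_ * _); rewrite -[RHS](lebesgue_rV_translate v).
  congr leb; apply/seteqP; split=> x /=.
    rewrite /orbit translate_add => -[Ax Tx]; split=> //.
    by rewrite addrAC subrr add0r.
  by rewrite /orbit translate_add addrAC subrr add0r.
rewrite (@leb_tilesN 0%R); last first.
  by apply: measurableI => //; exact: orbit_measurable.
rewrite -esumZl ?(coef_ge0 L0 lw)//; last by move=> z; exact: lebesgue_rV_ge0.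
apply: eq_esum => z _; rewrite /G coef_shift; congr (_ * _).
rewrite -[LHS](lebesgue_rV_translate (lattice z)); congr leb.
have e1 (x : V) : orbit (shift_index z s) x = orbit s (lattice z + x)%R.
  by rewrite orbit_shift// addrC.
have e2 (x : V) : (lattice z + x + (0 - lattice z) = x)%R by rewrite add0r addrAC subrr add0r.
have e3 (x : V) : (lattice z + x + - v = x + (lattice z - v))%R.
  by rewrite (addrC (lattice z)) addrA.
apply/seteqP; split=> x /=; rewrite e1 e2 e3; tauto.
Qed.

Lemma esum_fset_sub (a : V -> \bar R) : (forall x, 0 <= a x) ->
  \esum_(x in [set: FF]) a (val x) = \sum_(x <- FF) a x.
Proof.
move=> a0; rewrite -(@reindex_esum _ _ _ _ [set` FF] val); last first.
  split=> [x _|x y _ _ /val_inj//|x /= xF]; first exact: valP.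
  by exists [` xF]%fset.
rewrite esum_fset; [|exact: finite_fset|by move=> x _; exact: a0].
rewrite [RHS]fsbig_seq; last exact: fset_uniq.
by [].
Qed.

Lemma pweight_fset1 p : pweight [fset p]%fset = l [fset val p.1]%fset.
Proof.
rewrite /pweight /cells imfset_fset1 big_seq_fset1; congr l.
apply/fsetP => x; apply/sliceP/fset1P => [[q [/fset1P -> _ ->]]//|->].
by exists p; split=> //; exact/fset1P.
Qed.

(** Only one-point sets {(x, z)} produce singletons, with [t] positive so that they pass the cutoff.
    For fixed [x] the periods shifted by x + lattice z tile the space, so summing over [z] gives the
    full measure of [B]. *)
Lemma periodic_has_density : (0 < t)%N ->
  has_density periodic_measure ((\sum_(x <- FF) l [fset x]%fset) / period ^+ N)%R.
Proof.
move=> t0 B mB; have [l0 _ _ _] := lw.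
have p0 : (0 <= period ^+ N)%R by rewrite exprn_ge0// ltW// period0.
pose A : set (Ind (2 * t)) := [set S | exists2 x, B x & pts S = [fset x]%fset].
rewrite [LHS]periodic_measureE -/A.
rewrite (@esum_support _ _ (range (fun p => [fset p]%fset))); last first.
  move=> s hs; rewrite /orbit_mass; have [->|cs] := eqVneq (coef s) 0%R; first by rewrite mul0e.
  rewrite (_ : _ @^-1` _ = set0) ?set0I ?lebesgue_rV0 ?mule0//.
  apply/seteqP; split=> // x [b _].
  rewrite (orbit_pts L0 FL lw)// => /(congr1 (fun X : {fset V} => #|` X|)).
  rewrite cardfs1 card_imfset/=; last exact: addrI.
  rewrite card_imfset/=; last exact: place_inj.
  by move=> /eqP/cardfs1P[p sp]; apply: hs; exists p.
rewrite esum_image; last by move=> p q _ _ /fset1_inj.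
have -> : [set: P] = [set: FF] `*`` (fun=> [set: Z]) by apply/seteqP; split.
have c0 p : coef [fset p]%fset = (l [fset val p.1]%fset / period ^+ N)%R.
  by rewrite /coef cardfs1 pweight_fset1 muln_gt0 t0.
transitivity (\esum_(x in [set: FF]) ((l [fset val x]%fset / period ^+ N)%:E * leb B)); last first.
  rewrite (@esum_fset_sub (fun x => (l [fset x]%fset / period ^+ N)%:E * leb B)); last first.
    by move=> x; rewrite mule_ge0 ?lebesgue_rV_ge0// lee_fin divr_ge0.
  rewrite -ge0_sume_distrl; last by move=> x _; rewrite lee_fin divr_ge0.
  by rewrite sumEFin mulr_suml.
transitivity (\esum_(x in [set: FF]) \esum_(z in [set: Z]) orbit_mass [fset (x, z)]%fset A).
  rewrite esum_esum; last by move=> x z _ _; exact: (orbit_mass_ge0 L0 lw).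
  by apply: eq_esum => -[x z] _.
apply: eq_esum => x _; rewrite (leb_tilesN (- val x)%R mB) -esumZl; last 2 first.
- by rewrite divr_ge0.
- by move=> z; exact: lebesgue_rV_ge0.
apply: eq_esum => z _; rewrite /orbit_mass c0.
have [->|lx] := eqVneq (l [fset val x]%fset) 0%R; first by rewrite !mul0r !mul0e.
congr (_ * _); rewrite -[RHS](lebesgue_rV_translate (place (x, z))); congr leb.
have cn0 : coef [fset (x, z)]%fset != 0%R.
  by rewrite c0 mulf_neq0// invr_neq0// expf_neq0// gt_eqF// period0.
have E (y : V) : pts (orbit [fset (x, z)]%fset y) = [fset (place (x, z) + y)%R]%fset.
  by rewrite (orbit_pts L0 FL lw)// /places !imfset_fset1 addrC.
have Tx (y : V) : (place (x, z) + y + (- val x - lattice z) = y)%R.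
  by rewrite /place/= -opprD addrAC subrr add0r.
apply/seteqP; split=> y.
  move=> -[[b Bb]]; rewrite E => /fset1_inj bE Ty; split; first by rewrite /= bE.
  by rewrite /= Tx.
move=> [/= By Ty]; split.
  by exists (place (x, z) + y)%R; rewrite ?E.
by rewrite Tx in Ty.
Qed.

Lemma finite_places (C : R) :
  exists PT : {fset P}, forall p, (forall i, `|place p ord0 i| <= C)%R -> p \in PT.
Proof.
have p0 := period0 L0.
(* A bound on the lattice indices of places with coordinates at most [C]; [zof] enumerates the
   vectors with entries from -M to M. *)
pose M := Num.truncn ((`|C| + L) / period)%R.
pose zof (k : {ffun 'I_N -> 'I_(M + M).+1}) : Z := [ffun i => (k i)%:Z - M%:Z]%R.
have /finite_fsetP[PT PTE] : finite_set
    (range (fun q : FF * {ffun 'I_N -> 'I_(M + M).+1} => (q.1, zof q.2))).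
  exact/finite_image/finite_finset.
exists PT => p pC; suff : [set` PT] p by [].
have zM i : (`|p.2 i| <= M)%N.
  have /andP[h1 h2] := coord_place FL p i.
  have := pC i; rewrite ler_norml => /andP[h3 h4].
  rewrite -ltnS -(ltr_nat R); apply: le_lt_trans (truncnS_gt _).
  rewrite natr_absz intr_norm ler_pdivlMr// -[X in (_ * X <= _)%R](gtr0_norm p0) -normrM.
  have := ler_norm C; rewrite mulrC ler_norml => h5; apply/andP; split; lra.
rewrite -PTE; exists (p.1, [ffun i => inord (absz (p.2 i + M%:Z)%R)]) => //=.
rewrite [RHS]surjective_pairing; congr (_, _); apply/ffunP => i; rewrite !ffunE.
have := zM i => h.
have h' : (0 <= p.2 i + M%:Z)%R.
  by rewrite -lerBlDr sub0r lerNl (le_trans (ler_norm _))// normrN -abszE lez_nat.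
rewrite inordK ?gez0_abs ?addrK//.
rewrite ltnS -lez_nat gez0_abs// PoszD lerD2r (le_trans (ler_norm _))//.
Qed.

Lemma orbit_bounded (C : R) : exists PT : {fset P}, forall s x, coef s != 0%R ->
  torus x -> (forall y, y \in pts (orbit s x) -> `|y| <= C)%R -> (s `<=` PT)%fset.
Proof.
have [PT PTP] := finite_places (C + period).
exists PT => s x cs Tx xC; apply/fsubsetP => p ps; apply: PTP => i.
have px : (place p + x)%R \in pts (orbit s x).
  by rewrite (orbit_pts L0 FL lw)// addrC; apply/in_imfset/in_imfset.
have /andP[] := Tx i; rewrite !mxE => x0 xp.
have := le_trans (coord_norm (place p + x)%R i) (xC _ px); rewrite !mxE.
rewrite !ler_norml => /andP[h1 h2]; apply/andP; split; lra.
Qed.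

Lemma periodic_finite_sum (PT : {fset P}) A :
  (forall s, ~~ (s `<=` PT)%fset -> orbit_mass s A = 0) ->
  periodic_measure A = \sum_(s <- fpowerset PT) orbit_mass s A.
Proof.
move=> A0; rewrite periodic_measureE (@esum_support _ _ [set` fpowerset PT]); last first.
  by move=> s /negP; rewrite /= fpowersetE; exact: A0.
rewrite esum_fset; [|exact: finite_fset|by move=> s _; exact: (orbit_mass_ge0 L0 lw)].
by rewrite [RHS]fsbig_seq; [|exact: fset_uniq].
Qed.

(** Translations range over one bounded period, so only subsets of finitely many places can end up
    in a bounded region. This gives local finiteness and turns integrals of kernels with compact
    support into finite sums. *)
Lemma periodic_bounded (C : R) : exists PT : {fset P}, forall A,
  (forall S, A S -> forall y, y \in pts S -> `|y| <= C)%R ->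
  periodic_measure A = \sum_(s <- fpowerset PT) orbit_mass s A.
Proof.
have [PT PTP] := orbit_bounded C.
exists PT => A AC; apply: periodic_finite_sum => s; apply: contraNeq => os.
have cs : coef s != 0%R by apply: contraNneq os => cs; rewrite /orbit_mass cs mul0e.
have [x [Ax Tx]] : (orbit s @^-1` A `&` torus) !=set0.
  by apply/set0P; apply: contraNneq os => E; rewrite /orbit_mass E lebesgue_rV0 mule0.
exact: PTP cs Tx (AC _ Ax).
Qed.

Lemma orbit_mass_lt_pinfty s A : orbit_mass s A < +oo.
Proof.
rewrite /orbit_mass; apply: lte_mul_pinfty; rewrite ?lee_fin ?(coef_ge0 L0 lw)//.
apply: le_lt_trans (lebesgue_rV_mono (@subIsetr _ _ _)) _.
by rewrite (leb_torus _ L0) ltry.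
Qed.

Lemma le_periodic A B : A `<=` B -> periodic_measure A <= periodic_measure B.
Proof.
move=> AB; rewrite !periodic_measureE; apply: le_esum => s _; apply: lee_wpmul2l.
  by rewrite lee_fin (coef_ge0 L0 lw).
by apply: lebesgue_rV_mono; apply: setSI => x; exact: AB.
Qed.

Lemma periodic_radon : radon periodic_measure.
Proof.
split=> [S|B mB].
  have [r rP] : exists r, forall x, x \in pts S -> (`|x| < r)%R.
    exists (\sum_(x <- pts S) `|x| + 1)%R => x xS.
    by rewrite (big_rem x)//= -addrA ltrDl ltr_wpDl// sumr_ge0.
  exists [set S' : Ind (2 * t) | [set` pts S'] `<=` ball (0%R : V) r].
    split; first by apply: open_subpts; exact: ball_open.
    by move=> x /= /rP; rewrite -ball_normE /= sub0r normrN.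
  have [PT PTE] := periodic_bounded r; rewrite [X in X < _]PTE.
    by apply: lte_sum_pinfty => s _; exact: orbit_mass_lt_pinfty.
  move=> S' S'r y /S'r; rewrite -ball_normE /= sub0r normrN; exact: ltW.
(* Inner regularity: a finite partial sum nearly exhausts the measure. In each of its terms the set
   of translations is approximated from inside by a compact set, whose continuous image is
   compact. *)
apply/eqP; rewrite eq_le; apply/andP; split; last first.
  by rewrite ge_ereal_sup// => _ [K [_ KB] <-]; exact: le_periodic.
rewrite [leLHS]periodic_measureE ge_ereal_sup// => _ [X [finX _] <-].
rewrite fsbig_finite//; set r := fset_set X.
(* An error of e / E for each translation set adds up, with the coefficients, to at most [e]; the 1
   keeps the divisor positive. *)
pose E := (1 + \sum_(s <- r) coef s)%R.
have E0 : (0 < E)%R by rewrite ltr_wpDr// sumr_ge0// => s _; exact: (coef_ge0 L0 lw).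
apply/lee_addgt0Pr => e e0.
have /choice[K KP] : forall s, exists K, [/\ compact K, K `<=` orbit s @^-1` B `&` torus &
    leb (orbit s @^-1` B `&` torus) <= leb K + (e / E)%:E].
  move=> s; apply: (@lebesgue_rV_inner_regular _ _ 0%R (const_mx period)).
  - by move=> i; rewrite !mxE ltW// period0.
  - by apply: (@measurableI _ (borel V)); [exact: orbit_measurable|exact: torus_borel].
  - by move=> x [].
  - by rewrite divr_gt0.
pose D := \big[setU/set0]_(s <- r) (orbit s @` K s).
apply: (@le_trans _ _ (periodic_measure D + e%:E)); last first.
  rewrite leeD2r//; apply: ereal_sup_ubound; exists D => //; split.
    apply: bigsetU_compact => s _; have [cK _ _] := KP s.
    apply: continuous_compact => //; apply: continuous_subspaceT.
    exact: orbit_continuous.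
  rewrite /D -bigcup_seq => S [s _ [x Kx <-]]; have [_ KB _] := KP s.
  by have [] := KB _ Kx.
apply: (@le_trans _ _ (\sum_(s <- r) (orbit_mass s D + (coef s * (e / E))%:E))).
  rewrite big_seq [leRHS]big_seq; apply: lee_sum => s sr.
  have [_ KB Ke] := KP s; rewrite /orbit_mass EFinM -ge0_muleDr ?lebesgue_rV_ge0//; last first.
    by rewrite lee_fin divr_ge0// ltW.
  apply: lee_wpmul2l; first by rewrite lee_fin (coef_ge0 L0 lw).
  apply: (le_trans Ke); rewrite leeD2r//; apply: lebesgue_rV_mono => x Kx.
  split; last by have [] := KB _ Kx.
  by rewrite /= /D -bigcup_seq; exists s => //; exists x.
rewrite big_split/=; apply: leeD.
  rewrite [leRHS]periodic_measureE; apply: esum_ge; exists [set` r]; first by split.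
  by rewrite -fsbig_seq// fset_uniq.
rewrite sumEFin lee_fin -mulr_suml mulrC -mulrA ler_piMr ?(ltW e0)//.
by rewrite ler_pdivrMl// mulr1 /E lerDr.
Qed.

(** Positivity holds for each translation [x] before averaging. By [sum_union_swap] the sum is, up
    to the volume factor, the sum of all entries of the Schur product of [pkernel] with [K]
    evaluated at the translated places. *)
Lemma pairing_ge0 (K : Ind t -> Ind t -> R) (PT : {fset P}) (x : V) : psd K ->
  (0 <= \sum_(s <- fpowerset PT) coef s * A_op K (orbit s x))%R.
Proof.
move=> Kp; pose h p := (x + place p)%R.
have hi : injective h by move=> p q /addrI /(place_inj L0 FL).
pose k (j j' : {fset P}) :=
  K (mkind _ t [fset h p | p in j]%fset) (mkind _ t [fset h p | p in j']%fset).
pose pt (j j' : {fset P}) := (#|` j| <= t)%N && (#|` j'| <= t)%N.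
pose c s : R := (pweight s / period ^+ N)%R.
have -> : (\sum_(s <- fpowerset PT) coef s * A_op K (orbit s x) =
    \sum_(s <- fpowerset PT) c s * (\sum_(j <- fpowerset s) \sum_(j' <- fpowerset s)
      if pt j j' && ((j `|` j')%fset == s) then k j j' else 0))%R.
  apply: eq_bigr => s _; have [cs|cs] := eqVneq (coef s) 0%R.
    (* The cutoff in [coef] costs nothing: a set with more than 2t points is not a union of two sets
       with at most [t] points. *)
    rewrite cs mul0r; move/eqP: cs; rewrite /coef; case: leqP => [st|st].
      by move=> /eqP; rewrite -/(c s) => ->; rewrite mul0r.
    move=> _; rewrite big1 ?mulr0// => j _; rewrite big1// => j' _.
    rewrite /pt; case: ifP => // /andP[/andP[jt j't] /eqP js].
    move: st; rewrite -js ltnNge (leq_trans (leq_card_fsetU _ _))//.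
    by rewrite mul2n -addnn leq_add.
  have st : (#|` s| <= 2 * t)%N by move: cs; rewrite /coef; case: leqP; rewrite ?eqxx.
  have -> : coef s = c s by rewrite /coef st.
  congr (_ * _)%R.
  rewrite (@A_opE _ _ _ _ _ _ _ s h); [|by move=> ? ? _ _; exact: hi|].
    by apply: eq_bigr => j _; apply: eq_bigr => j' _; rewrite andbA.
  by rewrite (orbit_pts L0 FL lw)// /places -imfset_comp.
rewrite sum_union_swap.
have := psd_sum (fpowerset PT) id (fun=> 1%R)
  (psdM (pkernel_psd lw) (psd_comp (fun j => mkind _ t [fset h p | p in j]%fset) Kp)).
move=> /(mulr_ge0 (_ : 0 <= (period ^+ N)^-1)%R) -/(_ _).
rewrite invr_ge0 exprn_ge0 ?(ltW (period0 L0))// => /(_ isT); congr (0 <= _)%R.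
rewrite mulr_sumr; apply: eq_bigr => j _; rewrite mulr_sumr; apply: eq_bigr => j' _.
rewrite /pkernel /pt /c; case: ifP => _; rewrite ?mulr0 ?mul0r ?mulr0// !mul1r.
by rewrite mulrA (mulrC _ (pweight _)).
Qed.

Definition torus_measure : {measure set (borel V) -> \bar R} :=
  mrestr (@lebV R n) (@torus_borel R n L).

Lemma orbit_mass_integral s (f : borel (Ind (2 * t)) -> \bar R) :
  measurable_fun setT f -> (forall S, 0 <= f S) ->
  \int[orbit_measure L0 lw s]_S f S = \int[torus_measure]_x ((coef s)%:E * f (orbit s x)).
Proof.
move=> mf f0.
rewrite ge0_integralZl ?lee_fin ?(coef_ge0 L0 lw)//; last first.
  exact: (measurableT_comp mf (orbit_measurable_fun L s)).
have := ge0_integral_pushforward (orbit_measurable_fun L s) torus_measure measurableT mf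
  (fun S _ => f0 S).
set pm := (X in integral X _ _) => pmI.
rewrite preimage_setT in pmI.
rewrite -pmI -[(coef s)%:E]/((NngNum (coef_ge0 L0 lw s))%:num%:E) -ge0_integral_mscale//.
exact: orbit_measurable_fun.
Qed.

(** The measure agrees with a finite sum only on subsets of [D]; as [f] vanishes off [D], the
    integral over [D] is all that counts. *)
Lemma periodic_integral (f : borel (Ind (2 * t)) -> \bar R) (PT : {fset P})
    (D : set (borel (Ind (2 * t)))) :
  measurable D ->
  (forall A, A `<=` D -> periodic_measure A = \sum_(s <- fpowerset PT) orbit_mass s A) ->
  measurable_fun setT f -> (forall S, 0 <= f S) -> (forall S, ~ D S -> f S = 0) ->
  \int[periodic_measure]_S f S =
  \int[torus_measure]_x (\sum_(s <- fpowerset PT) (coef s)%:E * f (orbit s x)).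
Proof.
move=> mD permD mf f0 fD.
have mfD : measurable_fun D f by exact: measurable_funTS.
pose r := fpowerset PT.
pose m_ k : {measure set (borel (Ind (2 * t))) -> \bar R} := orbit_measure L0 lw (nth fset0 r k).
transitivity (\int[msum m_ (size r)]_(S in D) f S).
  rewrite (integral_support _ fD); apply: eq_measure_integral => A mA AD.
  rewrite [LHS]permD// (big_nth fset0) big_mkord /msum.
  by apply: eq_bigr => i _.
rewrite ge0_integral_measure_sum//.
rewrite ge0_integral_sum//; last 2 first.
- move=> s; apply: measurable_funeM; exact: (measurableT_comp mf (orbit_measurable_fun L s)).
- by move=> s x _; rewrite mule_ge0// lee_fin (coef_ge0 L0 lw).
rewrite [RHS](big_nth fset0) big_mkord; apply: eq_bigr => i _; rewrite -(integral_support _ fD).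
exact: orbit_mass_integral.
Qed.

(** [A_op K] is continuous and lives on sets in a bounded region, so its integral is an average over
    translations of finite sums, which are nonnegative by [pairing_ge0]. Positive and negative parts
    are treated apart, as the formula for the integral is for nonnegative functions. *)
Lemma periodic_adjoint_psd : adjoint_psd periodic_measure.
Proof.
move=> K Kc Ks Kp; pose f := A_op K.
have fc : continuous f by exact: continuous_A_op.
have [r rK] : exists r : R, forall J J', K J J' != 0%R ->
    forall x, x \in (pts J `|` pts J')%fset -> (`|x| <= r)%R.
  pose D := closure [set p : Ind t * Ind t | K p.1 p.2 != 0%R].
  have c1 : compact (fst @` D).
    by apply: continuous_compact => //; apply: continuous_subspaceT => x; exact: cvg_fst.
  have c2 : compact (snd @` D).
    by apply: continuous_compact => //; apply: continuous_subspaceT => x; exact: cvg_snd.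
  have [r1 h1] := compact_ind_bounded c1; have [r2 h2] := compact_ind_bounded c2.
  exists (Num.max r1 r2) => J J' KJ x; have DJ : D (J, J') by exact: subset_closure.
  rewrite inE le_max => /orP[xJ|xJ']; apply/orP; [left|right].
    by apply: (h1 J) xJ; exists (J, J').
  by apply: (h2 J') xJ'; exists (J, J').
pose D : set (Ind (2 * t)) := [set S | [set` pts S] `<=` [set y : V | `|y| <= r]%R].
have clB : closed [set y : V | `|y| <= r]%R.
  apply: (@preimage_closed _ _ (fun y : V => `|y|%R) [set z | (z <= r)%R]).
    by move=> x _; exact: norm_continuous.
  exact: closed_le.
have clD : closed D by exact: closed_subpts.
have mD : measurable (D : set (borel (Ind (2 * t)))).
  by rewrite -[D]setCK; apply: measurableC; apply: sub_sigma_algebra; rewrite openC.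
have fD S : ~ D S -> f S = 0%R.
  move=> nD; rewrite /f /A_op fsbig1// => -[J J'] /= JS.
  apply: contra_notP nD => /eqP KJ y yS; apply: (rK _ _ KJ).
  by rewrite JS.
have [PT PTE] := periodic_bounded r.
have permD A : A `<=` D -> periodic_measure A = \sum_(s <- fpowerset PT) orbit_mass s A.
  by move=> AD; apply: PTE => S /AD DS y; exact: DS.
pose F (S : borel (Ind (2 * t))) := (f S)%:E.
have mf : measurable_fun setT F.
  by apply/measurable_EFinP; exact: continuous_borel.
have [M Mf] : exists M : R, forall S, (`|f S| <= M)%R.
  have : compact (f @` D).
    apply: continuous_compact; first exact: continuous_subspaceT.
    apply: compact_subpts; apply: bounded_closed_compact; last exact: clB.
    by exists r; split=> [|M rM y /= yr]; [exact: num_real|exact: le_trans yr (ltW rM)].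
  move=> /compact_bounded[M [_ /(_ (`|M| + 1)%R)]] MP.
  exists (`|M| + 1)%R => S; have [DS|/fD ->] := pselect (D S).
    by apply: MP; [rewrite (le_lt_trans (ler_norm _))// ltrDl|exists S].
  by rewrite normr0 addr_ge0.
rewrite -[integral _ _ _]/(\int[periodic_measure]_S F S) integralE.
have fpos (S : borel (Ind (2 * t))) : 0 <= F^\+ S by exact: funepos_ge0.
have fneg (S : borel (Ind (2 * t))) : 0 <= F^\- S by exact: funeneg_ge0.
have posD (S : borel (Ind (2 * t))) : ~ D S -> F^\+ S = 0.
  by move=> /fD fS; rewrite funeposE /F fS maxxx.
have negD (S : borel (Ind (2 * t))) : ~ D S -> F^\- S = 0.
  by move=> /fD fS; rewrite funenegE /F fS oppe0 maxxx.
have mpos := measurable_funepos mf; have mneg := measurable_funeneg mf.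
(* Comparing the two parts yields a nonnegative difference only if the negative part has a finite
   integral; it is bounded and lives on a set of finite measure. *)
have finneg : \int[periodic_measure]_S F^\- S < +oo.
  rewrite (integral_support _ negD).
  apply: (@le_lt_trans _ _ (\int[periodic_measure]_(S in D) (cst M%:E S))).
    apply: ge0_le_integral => //.
    - exact: measurable_funTS.
    - move=> S _; rewrite funenegE -EFinN -EFin_max lee_fin ge_max.
      by rewrite (le_trans (ler_norm _)) ?normrN ?Mf// (le_trans _ (Mf S)).
  rewrite integral_cst//; apply: lte_mul_pinfty; rewrite ?lee_fin//.
    by rewrite (le_trans _ (Mf point)).
  by rewrite [X in X < _]permD//; apply: lte_sum_pinfty => s _; exact: (orbit_mass_lt_pinfty).
rewrite sube_ge0; last first.
  by apply/orP; left; rewrite ge0_fin_numE//; apply: integral_ge0 => S _; exact: fneg.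
rewrite !(periodic_integral mD permD)//.
have c0 := coef_ge0 L0 lw.
have ms (g : borel (Ind (2 * t)) -> \bar R) : measurable_fun setT g ->
    measurable_fun setT (fun x : borel V => \sum_(s <- fpowerset PT) (coef s)%:E * g (orbit s x)).
  move=> mg; apply: emeasurable_sum => s; apply: measurable_funeM.
  exact: (measurableT_comp mg (orbit_measurable_fun L s)).
(* For each translation [x] the sum of the negative parts is at most that of the positive parts;
   this is [pairing_ge0] rearranged. *)
apply: ge0_le_integral => //.
- by move=> x _; apply: sume_ge0 => s _; rewrite mule_ge0// lee_fin.
- exact: ms.
- exact: ms.
move=> x _.
under eq_bigr do rewrite funenegE -EFinN -EFin_max -EFinM.
under [leRHS]eq_bigr do rewrite funeposE -EFin_max -EFinM.
rewrite !sumEFin lee_fin -subr_ge0 -sumrB.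
have := pairing_ge0 PT x Kp; congr (0 <= _)%R; apply: eq_bigr => s _.
rewrite -mulrBr -/(f _); congr (_ * _)%R; case: (leP 0%R (f (orbit s x))) => h.
  by rewrite max_r ?oppr_le0// subr0.
by rewrite max_l ?oppr_ge0 ?ltW// sub0r opprK.
Qed.

End periodic_properties.

(** * Comparison of the two problems *)

Section lower_bound.
Variables (R : realType) (n t : nat).
Hypothesis t0 : (0 < t)%N.
Local Notation N := n.+1.
Local Notation V := 'rV[R]_N.
Local Open Scope ereal_scope.

Lemma las_finite_le (FF : {fset V}) (L : R) : (0 < L)%R ->
  (forall x, x \in FF -> forall i, 0 <= x ord0 i <= L)%R ->
  las_finite t [set` FF] <= las_Rn R N t * ((L + 2) ^+ N)%R%:E.
Proof.
move=> L0 FL; have p0 : (0 < (L + 2) ^+ N)%R by rewrite exprn_gt0// addr_gt0.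
apply: ge_ereal_sup => _ [lam [lam0 lamp] <-].
have [l lw ->] := finite_weights lam0 lamp.
have := periodic_has_density L0 FL lw t0; rewrite /period; set c := (_ / _)%R => dc.
have -> : (\sum_(x <- FF) l [fset x]%fset)%R = (c * (L + 2) ^+ N)%R.
  by rewrite /c mulfVK// gt_eqF.
rewrite EFinM; apply: lee_wpmul2r; first by rewrite lee_fin ltW.
apply: ereal_sup_ubound; exists c => //; exists (periodic_measure L0 lw); split=> //.
- exact: periodic_radon.
- exact: periodic_translation_invariant.
- exact: periodic_measure0.
- exact: periodic_adjoint_psd.
Qed.

(** The factor is ((L + 2) / L)^N with L = 2^k, the price of the margin around the cube. *)
Lemma las_density_le k :
  las_density R N t k <= las_Rn R N t * ((1 + 2 * 2^-1 ^+ k) ^+ N)%R%:E.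
Proof.
have L0 : (0 < 2 ^+ k :> R)%R by rewrite exprn_gt0.
have -> : ((1 + 2 * 2^-1 ^+ k) ^+ N = (2 ^+ k + 2) ^+ N * (2 ^+ (k * N))^-1 :> R)%R.
  rewrite exprM -[((_ ^+ N)^-1)%R]exprVn -exprMn; congr (_ ^+ N)%R.
  by rewrite [in RHS]mulrDl exprVn mulfV// gt_eqF.
rewrite /las_density EFinM muleA; apply: lee_wpmul2r.
  by rewrite lee_fin invr_ge0 exprn_ge0.
apply: ge_ereal_sup => _ [F [/finite_fsetP[FF ->] FC] <-].
apply: las_finite_le => // x /FC[y yC <-] i; rewrite mxE.
have /andP[y0 y1] := yC i; rewrite mulr_ge0 ?(ltW L0)//=.
by rewrite -[leRHS]mulr1 ler_wpM2l// ltW.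
Qed.

(** A squeeze when [las_Rn] is finite. At an infinite value one of the two inequalities already
    makes every density equal to it. *)
Lemma las_density_cvg : las_density R N t @ \oo --> las_Rn R N t.
Proof.
have r0 : (fun k => 1 + 2 * 2^-1 ^+ k : R)%R @ \oo --> (1%R : R).
  rewrite -[X in _ --> X]addr0 -[X in (_ + X)%R](mulr0 2%R).
  apply: cvgD; first exact: cvg_cst.
  apply: cvgM; first exact: cvg_cst.
  by apply: cvg_expr; rewrite ger0_norm// invf_lt1// ltr1n.
have r1 : (fun k => (1 + 2 * 2^-1 ^+ k) ^+ N : R)%R @ \oo --> (1%R : R).
  rewrite -[X in _ --> X](expr1n _ N).
  exact: (cvg_comp _ _ r0 (@exprn_continuous R N 1%R)).
have sq k := las_density_le k; have lo k := @las_Rn_le_density R n t k.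
have rpos k : (0 < (1 + 2 * 2^-1 ^+ k) ^+ N :> R)%R by rewrite exprn_gt0// addr_gt0// mulr_gt0.
case E : (las_Rn R N t) => [c| |].
- apply: (@squeeze_cvge _ _ _ _ (fun=> c%:E) _ (fun k => (c * (1 + 2 * 2^-1 ^+ k) ^+ N)%R%:E)).
  + by apply: nearW => k; rewrite EFinM -E lo sq.
  + exact: cvg_cst.
  + apply: cvg_EFin; first exact: nearW.
    by rewrite -[X in _ --> X]mulr1; apply: cvgM => //; exact: cvg_cst.
- rewrite (_ : las_density R N t = fun=> +oo); first exact: cvg_cst.
  by apply/funext => k; apply/eqP; rewrite -leye_eq -E.
- rewrite (_ : las_density R N t = fun=> -oo); first exact: cvg_cst.
  apply/funext => k; apply/eqP; rewrite -leeNy_eq (le_trans (sq k))// E.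
  by rewrite gt0_mulNye// lte_fin.
Qed.

End lower_bound.

Theorem theorem6p16 (R : realType) (n t : nat) (hn : (1 <= n)%N)
    (ht : (1 <= t)%N) :
  cvgn (las_density R n t) /\ las_Rn R n t = delta_las R n t.
Proof.
case: n hn => // n _; have cv := @las_density_cvg R n t ht.
by split; [apply/cvg_ex; exists (las_Rn R n.+1 t)|rewrite /delta_las (cvg_lim _ cv)].
Qed.
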